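(* Let $d\ge 2$, let $C\subset\mathbb R^d$ be a closed convex cone that is pointed (contains no line) and has non-empty interior, and let $\mathbf k\in \mathbb Z^d\cap\operatorname{Int} C$. There are constants $c_1,c_2>0$ not depending on $n$ such that for every $i\in\{0,1,\dots,d-1\}$ $$\lim_{n\to\infty}\mathrm Q_n\Big\{T\in\mathcal T(C,n\mathbf k): c_1<\frac{f_i(T)}{n^{d(d-1)/(d+1)}}<c_2\Big\}=1,$$ and $$\lim_{n\to\infty}\mathrm Q_n\Big\{T\in\mathcal T(C,n\mathbf k): c_1<\frac{F(T)}{n^{d(d-1)/(d+1)}}<c_2\Big\}=1.$$
   Context: An integral zonotope in $C$ is a set of the form $T=\{\sum_{i=1}^m\alpha_i\mathbf v_i : (\alpha_1,\dots,\alpha_m)\in[0,1]^m\}$ with $m\in\mathbb N$ and $\mathbf v_1,\dots,\mathbf v_m\in\mathbb Z^d\cap C$; its endpoint is $\sum_{i=1}^m\mathbf v_i$. $\mathcal T(C,n\mathbf k)$ is the finite family of all integral zonotopes in $C$ (as sets) whose endpoint is $n\mathbf k$, and $\mathrm Q_n$ is the uniform probability distribution on $\mathcal T(C,n\mathbf k)$. For a zonotope $T$, $f_i(T)$ is the number of $i$-dimensional faces of $T$, and $F(T)$ is the number of towers (flags) of $T$, i.e. of chains $F_0\subset F_1\subset\dots\subset F_{d-1}$ where $F_i$ is an $i$-dimensional face of $T$. *)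

(* Defs.v *)
From HB Require Import structures.
From mathcomp Require Import all_boot all_order all_algebra finmap.
From mathcomp Require Import all_classical all_reals all_analysis.
Set Implicit Arguments.
Unset Strict Implicit.
Unset Printing Implicit Defensive.
Import Order.TTheory GRing.Theory Num.Theory.
Import numFieldNormedType.Exports.
Local Open Scope classical_set_scope.
Local Open Scope ring_scope.

(* [fset_set] sends infinite sets to the empty finite set, so this is a true
   cardinality on finite sets only, and 0 on infinite ones. *)
Definition card_set (T : choiceType) (A : set T) : nat := #|` fset_set A |%fset.

Definition unif_prob (R : realType) (T : choiceType) (X A : set T) : R :=
  (card_set (X `&` A))%:R / (card_set X)%:R.

Section Geometry.
Variables (R : realType) (d : nat).
Local Notation V := 'rV[R]_d.
Implicit Types (C T F : set V) (k x : V).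

Definition convex_cone C : Prop :=
  [/\ C !=set0, convex_set (C : set (convex_lmodType V)) &
      forall (t : R) x, 0 <= t -> C x -> C (t *: x)].

Definition contains_line C : Prop :=
  exists x v : V, v != 0 /\ forall t : R, C (x + t *: v).

Definition lattice_points C : set V := C `&` [set v | v \is a mxOver Num.int].

Definition zonotope (m : nat) (v : 'I_m -> V) : set V :=
  [set x | exists a : 'I_m -> R,
     (forall i, 0 <= a i <= 1) /\ x = \sum_(i < m) a i *: v i].

(* A set of sets: generating families giving the same zonotope are
   identified. *)
Definition zonotopes_with_endpoint C (e : V) : set (set V) :=
  [set T | exists (m : nat) (v : 'I_m -> V),
     [/\ forall i, lattice_points C (v i),
         \sum_(i < m) v i = e & T = zonotope v]].

(* [T] itself ([u = 0], [b = 0]) and possibly [set0] are faces; the empty face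
   has no dimension in the sense of [has_dim] below. *)
Definition face T F : Prop :=
  exists (u : 'cV[R]_d) (b : R),
    (forall x, T x -> (x *m u) 0 0 <= b) /\
    F = T `&` [set x | (x *m u) 0 0 = b].

Definition affine_hull F : set V :=
  [set x | exists (m : nat) (p : 'I_m -> V) (a : 'I_m -> R),
     [/\ forall i, F (p i), \sum_(i < m) a i = 1 &
         x = \sum_(i < m) a i *: p i]].

Definition has_dim F (i : nat) : Prop :=
  exists (x0 : V) (U : {vspace V}),
    \dim U = i /\ affine_hull F = [set x0 + u | u in [set u | u \in U]].

Definition faces_of_dim T (i : nat) : set (set V) :=
  [set F | face T F /\ has_dim F i].

Definition num_faces (i : nat) T : nat := card_set (faces_of_dim T i).

Definition towers T : set ('I_d -> set V) :=
  [set phi | (forall i : 'I_d, faces_of_dim T i (phi i)) /\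
             (forall i j : 'I_d, (i <= j)%N -> phi i `<=` phi j)].

Definition num_towers T : nat := card_set (towers T).

Definition Q C k (n : nat) (A : set (set V)) : R :=
  unif_prob R (zonotopes_with_endpoint C (n%:R *: k)) A.

Definition growth (n : nat) : R :=
  n%:R `^ ((d * (d - 1))%:R / (d + 1)%:R).

End Geometry.

(* Main.v *)
(* Write N = n^(1/(d+1)), so that the growth rate is N^(d(d-1)).  In a pointed cone a
   zonotope is determined by its multiplicities on primitive lattice vectors: the face
   in a generic direction orthogonal to a primitive vector is the segment carried by it.
   So the uniform law on zonotopes is the uniform law on multiplicity functions w with
   sum_p w(p) p = n k.

   Upper bounds hold for every zonotope.  A linear functional dominating the norm on C
   shows that at most c N^d primitive vectors occur.  Faces correspond to sign vectors
   of functionals on the M generators, and deletion-restriction bounds these by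
   c M^(d-1); a tower is coded by d-1 generators and d signs.

   Lower bounds hold for typical zonotopes.  Fix a frame of lattice vectors of C and, for
   each j < d-1, a family A_j of about (eps N)^d lattice directions dominated by their
   j-th coordinate in that frame.
   - If w charges a positive proportion of each A_j, choosing one direction in each A_j
     spans hyperplanes with at least c N^(d(d-1)) distinct normals: a normal with
     denominator m is orthogonal to few lattice points of a box (packing of m
     translates), and few normals have a small denominator.  Perturbing a normal
     lexicographically along a dual basis gives a tower, and dominance makes distinct
     normals give distinct faces in every dimension.
   - The functions w charging A_j too little are rare, by switching.  Sort the primitive
     vectors into boundedly many classes; a basic solution of a linear program selects
     classes to empty (d+1 of them only partially), whose mass is a small multiple kappa
     of n k up to an element of C.  This mass is spent on an arbitrary subset of the
     unused part of A_j, plus one filling lattice vector.  The gain, 2^(c eps^d N^d),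
     exceeds the number exp(c kappa N^d) of preimages, as kappa is of order eps^(d+1). *)

Require Import Defs.
From HB Require Import structures.
From mathcomp Require Import all_boot all_order all_algebra finmap.
From mathcomp Require Import all_classical all_reals all_analysis.
From mathcomp Require Import ring lra zify.
Import Order.TTheory GRing.Theory Num.Theory.
Import numFieldNormedType.Exports.
Local Open Scope classical_set_scope.
Local Open Scope ring_scope.

Set Implicit Arguments.
Unset Strict Implicit.
Unset Printing Implicit Defensive.

(** * Faces of a zonotope *)

(** In the code d = [D.+1], so N^(D+2) = n. A family [A_j] holds at most L^(D+1) vectors of norm
    O(L) with L about eps N; its total is O(eps^(D+2) n), which fixes kappa. Gain and cost then
    differ by one factor eps, and a small eps wins. Mass is freed by whole classes because the
    inverse of a switch must be cheap to describe: naming individual vectors would cost as much as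
    the gain, naming subsets of boundedly many classes costs a constant. Classes are residues modulo
    their number q, so each has density 1/q at every scale beyond q: kappa q of them, with mass
    kappa n, admit only exp(O(kappa N^d)) configurations. The d+1 fractional classes may carry the
    whole mass; they are equally cheap once q is at least (d+1)/kappa^(d+1). The linear program is
    vector valued because the freed mass, less the mass spent, must lie in [C]: only then does one
    more lattice vector of [C] restore the endpoint exactly. On the geometric side, dominance gives
    at once the independence of the chosen generators and the sign test that separates two normals,
    so that no face has to be computed. *)

Definition dot (R : realType) (d : nat) (x : 'rV[R]_d) (u : 'cV[R]_d) : R :=
  (x *m u) 0 0.

Section Dot.
Variables (R : realType) (d : nat).
Implicit Types (x y : 'rV[R]_d) (u w : 'cV[R]_d).

Lemma dotE x u : dot x u = \sum_i x 0 i * u i 0.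
Proof. by rewrite /dot mxE. Qed.

Lemma dotDl x y u : dot (x + y) u = dot x u + dot y u.
Proof. by rewrite /dot mulmxDl mxE. Qed.

Lemma dotBl x y u : dot (x - y) u = dot x u - dot y u.
Proof. by rewrite /dot mulmxBl !mxE. Qed.

Lemma dotZl a x u : dot (a *: x) u = a * dot x u.
Proof. by rewrite /dot -scalemxAl mxE. Qed.

Lemma dot0l u : dot 0 u = 0.
Proof. by rewrite /dot mul0mx mxE. Qed.

Lemma dotDr x u w : dot x (u + w) = dot x u + dot x w.
Proof. by rewrite /dot mulmxDr mxE. Qed.

Lemma dotZr a x u : dot x (a *: u) = a * dot x u.
Proof. by rewrite /dot -scalemxAr mxE. Qed.

Lemma dotNr x u : dot x (- u) = - dot x u.
Proof. by rewrite /dot mulmxN mxE. Qed.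

Lemma dot0r x : dot x 0 = 0.
Proof. by rewrite /dot mulmx0 mxE. Qed.

Lemma dot_suml (I : Type) (r : seq I) (P : pred I) (F : I -> 'rV[R]_d) u :
  dot (\sum_(i <- r | P i) F i) u = \sum_(i <- r | P i) dot (F i) u.
Proof. by rewrite /dot mulmx_suml summxE. Qed.

Lemma dot_span0 (s : seq 'rV[R]_d) u x :
  {in s, forall y, dot y u = 0} -> x \in span s -> dot x u = 0.
Proof.
move=> s0 /(@coord_span _ _ _ (in_tuple s)) ->.
rewrite dot_suml big1 // => i _; rewrite dotZl.
by rewrite (s0 _ (mem_nth 0 _)) ?mulr0 //; case: i.
Qed.

End Dot.

Section Zono.
Variables (R : realType) (d : nat) (I : finType) (v : I -> 'rV[R]_d).
Local Notation V := 'rV[R]_d.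
Implicit Types (u w : 'cV[R]_d).

Definition zono : set V :=
  [set x | exists a : I -> R,
     (forall i, 0 <= a i <= 1) /\ x = \sum_i a i *: v i].

Definition zface u : set V :=
  [set x | exists a : I -> R,
     [/\ forall i, 0 <= a i <= 1, forall i, 0 < dot (v i) u -> a i = 1,
         forall i, dot (v i) u < 0 -> a i = 0 & x = \sum_i a i *: v i]].

Definition supp_fun u : R := \sum_(i | 0 < dot (v i) u) dot (v i) u.

(** Base point of the face in direction [u]: the face is this point plus the zonotope of the
    generators orthogonal to [u]. *)
Definition zbase u : V := \sum_(i | 0 < dot (v i) u) v i.

Definition zseq u : seq V := [seq v i | i <- enum I & dot (v i) u == 0].

Definition zspan u : {vspace V} := span (zseq u).

Lemma zono_le_supp u x : zono x -> dot x u <= supp_fun u.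
Proof.
case=> a [a01 ->]; rewrite dot_suml /supp_fun.
rewrite (bigID (fun i => 0 < dot (v i) u)) /= -[leRHS]addr0.
apply: lerD; last first.
  by apply: sumr_le0 => i; rewrite dotZl -leNgt => h; case/andP: (a01 i) => a0 _; exact: mulr_ge0_le0.
apply: ler_sum => i h; rewrite dotZl; case/andP: (a01 i) => a0 a1.
by rewrite ler_piMl // ltW.
Qed.

Lemma zfaceE u : zface u = zono `&` [set x | dot x u = supp_fun u].
Proof.
apply/seteqP; split=> x.
  case=> a [a01 ap an ->]; split; first by exists a.
  rewrite /= dot_suml (bigID (fun i => 0 < dot (v i) u)) /=.
  rewrite [X in _ + X]big1 ?addr0; last first.
    move=> i; rewrite -leNgt le_eqVlt dotZl => /orP[/eqP -> |h]; first by rewrite mulr0.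
    by rewrite an // mul0r.
  by apply: eq_bigr => i h; rewrite dotZl ap // mul1r.
case=> -[a [a01 xE]] /=; rewrite xE dot_suml => e.
(* [t i] is the deficit of the [i]-th term from its largest possible value. The deficits are
   nonnegative and sum to 0, so each vanishes. *)
pose t i := (if 0 < dot (v i) u then dot (v i) u else 0) - a i * dot (v i) u.
have t0 i : 0 <= t i.
  rewrite /t; case/andP: (a01 i) => a0 a1; case: ltP => h.
    by rewrite subr_ge0 ler_piMl // ltW.
  by rewrite sub0r oppr_ge0 mulr_ge0_le0.
have /psumr_eq0P ts : \sum_i t i = 0.
  rewrite sumrB -big_mkcond /= -/(supp_fun u) -e.
  by apply/eqP; rewrite subr_eq0; apply/eqP; apply: eq_bigr => i _; rewrite dotZl.
exists a; split=> // i h; have /eqP := ts (fun i _ => t0 i) i isT; rewrite /t.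
  rewrite h subr_eq0 eq_sym -subr_eq0 -{2}[dot (v i) u]mul1r -mulrBl mulf_eq0.
  by rewrite subr_eq0 (gt_eqF h) orbF => /eqP.
by rewrite ltNge (ltW h) /= sub0r oppr_eq0 mulf_eq0 (lt_eqF h) orbF => /eqP.
Qed.

Lemma zbase_face u : zface u (zbase u).
Proof.
exists (fun i => (0 < dot (v i) u)%R%:R); split=> [i|i ->|i h|] //.
- by case: (0 < _); rewrite ?lexx ler01.
- by rewrite ltNge (ltW h).
- rewrite /zbase big_mkcond; apply: eq_bigr => i _.
  by case: (0 < _); rewrite ?scale1r ?scale0r.
Qed.

(** A supporting level that is attained must be the maximum [supp_fun u], since [zbase u] attains
    that maximum. Non-emptiness discards the face [set0]. *)
Lemma face_zface (F : set V) : face zono F -> F !=set0 -> exists u, F = zface u.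
Proof.
case=> u [b [ub ->]] [x [Tx xb]]; exists u; rewrite zfaceE.
suff -> : b = supp_fun u by [].
have := zbase_face u; rewrite zfaceE => -[/ub]; rewrite /= -!/(dot _ _) => h1 h2.
by apply/eqP; rewrite eq_le -{1}xb (zono_le_supp u Tx) -h2 h1.
Qed.

Lemma zface_face u : face zono (zface u).
Proof.
exists u, (supp_fun u); split; first by move=> x; exact: zono_le_supp.
exact: zfaceE.
Qed.

Lemma mem_zspan u i : dot (v i) u = 0 -> v i \in zspan u.
Proof.
move=> h; apply: memv_span; apply/mapP; exists i => //.
by rewrite mem_filter h eqxx mem_enum.
Qed.

Lemma zspan_dot0 u x : x \in zspan u -> dot x u = 0.
Proof.
by apply: dot_span0 => y /mapP[i]; rewrite mem_filter => /andP[/eqP h _] ->.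
Qed.

Lemma zspan_sub u (W : {vspace V}) :
  (forall i, dot (v i) u = 0 -> v i \in W) -> (zspan u <= W)%VS.
Proof.
move=> h; apply/span_subvP => y /mapP[i]; rewrite mem_filter => /andP[/eqP e _] ->.
exact: h.
Qed.

Lemma zface_coset u x : zface u x -> x - zbase u \in zspan u.
Proof.
case=> a [a01 ap an ->].
rewrite /zbase [X in _ - X]big_mkcond -sumrB; apply: memv_suml => i _.
case: (ltgtP (dot (v i) u) 0) => h.
- by rewrite an // scale0r subr0 mem0v.
- by rewrite ap // scale1r subrr mem0v.
- by rewrite subr0; apply: memvZ; exact: mem_zspan.
Qed.

Lemma zbase_add u i : dot (v i) u = 0 -> zface u (zbase u + v i).
Proof.
move=> h; exists (fun j => ((0 < dot (v j) u) || (j == i))%:R); split=> [j|j ->|j hj|] //.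
- by case: (_ || _); rewrite ?lexx ler01.
- rewrite ltNge (ltW hj) /=; case: eqP => // e.
  by move: hj; rewrite e h ltxx.
- rewrite /zbase (bigD1 i (P := xpredT)) //= eqxx orbT scale1r addrC; congr (_ + _).
  rewrite [RHS](eq_bigr (fun j => (0 < dot (v j) u)%R%:R *: v j)); last first.
    by move=> j /negbTE ->; rewrite orbF.
  rewrite big_mkcond [RHS]big_mkcond; apply: eq_bigr => j _.
  case: (eqVneq j i) => [->|_] /=; first by rewrite h ltxx.
  by case: (0 < _); rewrite ?scale1r ?scale0r.
Qed.

Lemma zface_hull u :
  affine_hull (zface u) = [set zbase u + w | w in [set w | w \in zspan u]].
Proof.
apply/seteqP; split=> x.
  case=> m [p [a [Fp a1 ->]]].
  exists (\sum_(i < m) a i *: (p i - zbase u)).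
    by apply: memv_suml => i _; apply: memvZ; exact: zface_coset.
  under eq_bigr do rewrite scalerBr.
  by rewrite sumrB -scaler_suml a1 scale1r addrC subrK.
case=> w wU <-.
have := coord_span (X := in_tuple (zseq u)) wU; set s := in_tuple _ => wE.
pose c := fun i => coord s i w.
pose p (i : 'I_(size (zseq u)).+1) :=
  if unlift ord0 i is Some j then zbase u + s`_j else zbase u.
(* The base point receives the weight that completes the coordinates to an affine combination. *)
pose a (i : 'I_(size (zseq u)).+1) :=
  if unlift ord0 i is Some j then c j else 1 - \sum_j c j.
have aS j : a (lift ord0 j) = c j by rewrite /a liftK.
have pS j : p (lift ord0 j) = zbase u + s`_j by rewrite /p liftK.
have a0 : a ord0 = 1 - \sum_j c j by rewrite /a unlift_none.
have p0 : p ord0 = zbase u by rewrite /p unlift_none.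
exists (size (zseq u)).+1, p, a; split.
- move=> i; rewrite /p; case: unliftP => [j _|_]; last exact: zbase_face.
  have /mapP[k] := mem_nth 0 (ltn_ord j); rewrite mem_filter => /andP[/eqP e _] ->.
  exact: zbase_add.
- rewrite big_ord_recl a0 [X in _ + X](eq_bigr c); last by move=> j _; exact: aS.
  by rewrite addrNK.
- rewrite big_ord_recl a0 p0.
  rewrite [X in _ = _ + X](eq_bigr (fun j => c j *: zbase u + c j *: s`_j)); last first.
    by move=> j _; rewrite -scalerDr; congr (_ *: _); [exact: aS|exact: pS].
  rewrite big_split /= -scaler_suml addrA -scalerDl subrK scale1r.
  by rewrite {1}wE.
Qed.

Lemma coset_inj (x y : V) (U W : {vspace V}) :
  [set x + w | w in [set w | w \in U]] = [set y + w | w in [set w | w \in W]] ->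
  U = W.
Proof.
wlog suff sub : x y U W / [set x + w | w in [set w | w \in U]] =
    [set y + w | w in [set w | w \in W]] -> (U <= W)%VS.
  by move=> e; apply/eqP; rewrite eqEsubv (sub _ _ _ _ e) (sub _ _ _ _ (esym e)).
move=> e; apply/subvP => z zU.
have [w1 /= w1W e1] : [set y + w | w in [set w | w \in W]] x.
  by rewrite -e; exists 0; rewrite ?addr0 //= mem0v.
have [w2 /= w2W e2] : [set y + w | w in [set w | w \in W]] (x + z).
  by rewrite -e; exists z.
have -> : z = w2 - w1.
  by apply: (@addrI _ (y + w1)); rewrite [in LHS]e1 -e2 -addrA [w1 + _]addrC subrK.
exact: rpredB.
Qed.

Lemma has_dim_zface u i : has_dim (zface u) i <-> \dim (zspan u) = i.
Proof.
split=> [[x0 [U [<- e]]]|h]; last by exists (zbase u), (zspan u); split=> //; exact: zface_hull.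
by congr (\dim _); apply: (@coset_inj (zbase u) x0); rewrite -zface_hull.
Qed.

Lemma has_dim_neq0 (F : set V) i : has_dim F i -> F !=set0.
Proof.
case=> x0 [U [_ e]].
have : affine_hull F x0 by rewrite e; exists 0; rewrite ?addr0 //= mem0v.
case=> -[|m] [p [a [Fp a1 _]]]; first by move: a1; rewrite big_ord0 => /eqP; rewrite eq_sym oner_eq0.
by exists (p ord0).
Qed.

Lemma faces_of_dim_zface (F : set V) i :
  faces_of_dim zono i F <-> exists2 u, F = zface u & \dim (zspan u) = i.
Proof.
split=> [[fF dF]|[u -> h]].
  have [u e] := face_zface fF (has_dim_neq0 dF); exists u => //.
  by apply/has_dim_zface; rewrite -e.
by split; [exact: zface_face|exact/has_dim_zface].
Qed.

Lemma zface_sg_sub u w :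
  (forall i, dot (v i) w != 0 -> Num.sg (dot (v i) u) = Num.sg (dot (v i) w)) ->
  zface u `<=` zface w.
Proof.
move=> h x [a [a01 ap an ->]]; exists a; split=> // i hi.
  by apply: ap; rewrite -sgr_gt0 h ?gt_eqF // sgr_gt0.
by apply: an; rewrite -sgr_lt0 h ?lt_eqF // sgr_lt0.
Qed.

Lemma zface_sg_eq u w :
  (forall i, v i != 0 -> Num.sg (dot (v i) u) = Num.sg (dot (v i) w)) ->
  zface u = zface w.
Proof.
move=> h; apply/seteqP; split; apply: zface_sg_sub => i.
  by case: (eqVneq (v i) 0) => [->|/h //]; rewrite dot0l eqxx.
by case: (eqVneq (v i) 0) => [->|/h //]; rewrite dot0l eqxx.
Qed.

(* If [v i] pushes [u] up but not [w], removing [v i] from a point of the [w]-face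
   gives a point of the [w]-face which is not [u]-maximal. *)
Lemma zface_sub_pos u w i : zface w `<=` zface u -> 0 < dot (v i) u -> 0 < dot (v i) w.
Proof.
move=> e hu; rewrite ltNge; apply/negP => hw.
have : zface u (zbase w) by apply: e; exact: zbase_face.
rewrite zfaceE => -[_ /= e1].
have : dot (zbase w + v i) u <= supp_fun u.
  apply: zono_le_supp.
  exists (fun j => ((0 < dot (v j) w) || (j == i))%:R); split=> [j|].
    by case: (_ || _); rewrite ?lexx ler01.
  rewrite /zbase (bigD1 i (P := xpredT)) //= eqxx orbT scale1r addrC; congr (_ + _).
  rewrite [RHS](eq_bigr (fun j => (0 < dot (v j) w)%R%:R *: v j)); last first.
    by move=> j /negbTE ->; rewrite orbF.
  rewrite big_mkcond [RHS]big_mkcond; apply: eq_bigr => j _.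
  case: (eqVneq j i) => [->|_] /=; first by rewrite ltNge hw.
  by case: (0 < _); rewrite ?scale1r ?scale0r.
by rewrite dotDl e1 gerDl leNgt hu.
Qed.

(** Mirror of the positive case: the [w]-face has a point with coefficient 1 on [v i], and lowering
    this coefficient to 0 would push [u] above its maximum. *)
Lemma zface_sub_neg u w i : zface w `<=` zface u -> dot (v i) u < 0 -> dot (v i) w < 0.
Proof.
move=> e hu; rewrite ltNge; apply/negP => hw.
have [a [a01 ap an xE]] : zface w (zbase w) by exact: zbase_face.
pose b j := if j == i then 1 else a j.
have : zface w (\sum_j b j *: v j).
  exists b; split=> // j; rewrite /b; case: (eqVneq j i) => [e1|_] //.
  - by rewrite lexx ler01.
  - exact: ap.
  - by rewrite e1 ltNge hw.
  - exact: an.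
move=> /e; rewrite zfaceE => -[_ /= e1].
have : dot (\sum_j (if j == i then 0 else a j) *: v j) u <= supp_fun u.
  apply: zono_le_supp; exists (fun j => if j == i then 0 else a j); split=> // j.
  by case: eqP; rewrite ?lexx ?ler01.
rewrite -e1 -subr_ge0 -dotBl -sumrB (bigD1 i) //= /b eqxx scale0r subr0 scale1r.
rewrite big1 ?addr0; first by rewrite leNgt hu.
by move=> j /negbTE ->; rewrite subrr.
Qed.

Lemma zface_sub_ge u w i : zface u `<=` zface w -> 0 <= dot (v i) u -> 0 <= dot (v i) w.
Proof.
by move=> e; rewrite [in X in _ -> X]leNgt leNgt; apply: contra; apply: zface_sub_neg.
Qed.

Lemma perturb u w : exists2 e : R, 0 < e &
  forall i, Num.sg (dot (v i) (u + e *: w)) =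
    if dot (v i) u == 0 then Num.sg (dot (v i) w) else Num.sg (dot (v i) u).
Proof.
(* [S] dominates every ratio of [w] to [u] on a generator; where [u] vanishes the term is 0, because
   0 is its own inverse. *)
pose S := \sum_i `|dot (v i) w| / `|dot (v i) u|.
have S0 : 0 <= S by apply: sumr_ge0 => i _; rewrite divr_ge0.
have S1 : 0 < 1 + S by rewrite ltr_wpDr.
exists (1 + S)^-1; first by rewrite invr_gt0.
move=> i; rewrite dotDr dotZr; case: eqP => [->|/eqP h].
  by rewrite add0r sgrM gtr0_sg ?mul1r // invr_gt0.
have lt1 : `|(1 + S)^-1 * dot (v i) w| < `|dot (v i) u|.
  rewrite normrM gtr0_norm ?invr_gt0 // mulrC ltr_pdivrMr // mulrC.
  rewrite mulrDl mul1r (@le_lt_trans _ _ (S * `|dot (v i) u|)) //; last first.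
    by rewrite ltrDr normr_gt0.
  rewrite -ler_pdivrMr ?normr_gt0 // /S (bigD1 i) //= lerDl.
  by apply: sumr_ge0 => j _; rewrite divr_ge0.
move: lt1 h; set x := dot (v i) u; set y := _ * _ => lt1 h.
have [xp|xn|x0] := ltgtP x 0; last by rewrite x0 eqxx in h.
- rewrite !ltr0_sg //; move: lt1; rewrite (ltr0_norm xp) ltr_norml; lra.
- rewrite !gtr0_sg //; move: lt1; rewrite (gtr0_norm xn) ltr_norml; lra.
Qed.

End Zono.

(** * Sign vectors and the number of faces *)

Section CardSet.
Variable U : choiceType.
Implicit Type S : set U.

Lemma card_set_cover (W : eqType) (l : seq W) S (f : W -> U) :
  (forall x, S x -> exists2 y, y \in l & x = f y) ->
  finite_set S /\ (card_set S <= size l)%N.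
Proof.
move=> h.
have fS : finite_set S.
  apply: (@sub_finite_set _ _ [set` [seq f y | y <- l]]).
    by move=> x /h[y yl ->]; exact: map_f.
  exact: finite_seq.
split=> //; rewrite /card_set -(size_map f l).
apply: uniq_leq_size; first exact: fset_uniq.
move=> x; rewrite in_fset_set // inE => /h[y yl ->]; exact: map_f.
Qed.

Lemma card_set_inj (T : finType) (A : {set T}) S (g : U -> T) :
  (forall x y, S x -> S y -> g x = g y -> x = y) ->
  (forall x, S x -> g x \in A) ->
  finite_set S /\ (card_set S <= #|A|)%N.
Proof.
move=> gi gA; rewrite cardE.
have [->|/set0P[x0 Sx0]] := eqVneq S set0.
  by split=> //; rewrite /card_set fset_set0 cardfs0.
apply: (@card_set_cover _ _ _ (fun t => xget x0 [set x | S x /\ g x = t])) => x Sx.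
exists (g x); first by rewrite mem_enum gA.
case: xgetP => [y _ [Sy e]|/(_ x)[]]; first exact: gi.
by split.
Qed.

(** Finiteness has to be assumed: [card_set] is 0 on infinite sets, so no lower bound could hold
    there. *)
Lemma card_set_ge (T : finType) (A : {set T}) S (f : T -> U) :
  finite_set S -> {in A &, injective f} -> (forall t, t \in A -> S (f t)) ->
  (#|A| <= card_set S)%N.
Proof.
move=> fS fi fA; rewrite /card_set cardE -(size_map f).
apply: uniq_leq_size.
  by rewrite map_inj_in_uniq ?enum_uniq // => x y; rewrite !mem_enum; exact: fi.
move=> x /mapP[t]; rewrite mem_enum => tA ->.
by rewrite in_fset_set // inE; exact: fA.
Qed.

End CardSet.

Section SignVectors.
Variables (R : realType) (d : nat).
Local Notation V := 'rV[R]_d.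
Implicit Types (s : seq V) (W : {vspace 'cV[R]_d}) (u w : 'cV[R]_d).

Definition sgs s u := [seq Num.sg (dot p u) | p <- s].

Definition perpv (p : V) W : {vspace 'cV[R]_d} :=
  (W :&: lker (linfun (mulmx p : 'cV[R]_d -> 'M[R]_1)))%VS.

Lemma mem_perpv p W u : (u \in perpv p W) = (u \in W) && (dot p u == 0).
Proof.
rewrite memv_cap memv_ker lfunE /=; congr andb; apply/eqP/eqP => [e|e].
  by rewrite /dot e mxE.
by apply/matrixP => i j; rewrite !ord1 [RHS]mxE; exact: e.
Qed.

Lemma sgs_eqP s u w :
  reflect (forall p, p \in s -> Num.sg (dot p u) = Num.sg (dot p w))
          (sgs s u == sgs s w).
Proof. by apply: (iffP eqP) => [/eq_in_map//|h]; apply/eq_in_map. Qed.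

Lemma sgs_convex s u w (a b : R) : 0 < a -> 0 < b ->
  sgs s u = sgs s w -> sgs s (a *: u + b *: w) = sgs s u.
Proof.
move=> a0 b0 /eqP/sgs_eqP e; apply/eqP/sgs_eqP => p /e; rewrite dotDr !dotZr.
case: (ltgtP (dot p u) 0) => h.
- rewrite (ltr0_sg h) => /esym/eqP; rewrite sgr_cp0 => h'.
  by rewrite ltr0_sg // -oppr_gt0; nra.
- rewrite (gtr0_sg h) => /esym/eqP; rewrite sgr_cp0 => h'.
  by rewrite gtr0_sg //; nra.
- rewrite h sgr0 => /esym/eqP; rewrite sgr_eq0 => /eqP ->.
  by rewrite !mulr0 addr0 sgr0.
Qed.

(** The three patterns on a line are those of a spanning vector, of its opposite and of 0. *)
Lemma sgs_cover1 s W : (\dim W <= 1)%N ->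
  exists2 l : seq (seq R), (size l <= 3)%N & forall u, u \in W -> sgs s u \in l.
Proof.
move=> dW; pose w := vpick W.
exists [:: sgs s w; sgs s (- w); sgs s 0] => // u uW.
have : u \in <[w]>%VS.
  case: (eqVneq W 0%VS) => [W0|Wn0].
    by move: uW; rewrite W0 memv0 => /eqP ->; rewrite mem0v.
  suff -> : <[w]>%VS = W by [].
  apply/eqP; rewrite -(dimv_leqif_eq (_ : <[w]> <= W)%VS); last first.
    by rewrite -memvE memv_pick.
  rewrite eqn_leq dimvS -?memvE ?memv_pick //= dim_vline.
  by rewrite vpick0 Wn0.
case/vlineP => c ->.
have sE (b : R) z : sgs s (b *: z) = [seq Num.sg b * Num.sg (dot p z) | p <- s].
  by apply: eq_map => p; rewrite dotZr sgrM.
case: (ltgtP c 0) => h.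
- rewrite !inE; apply/orP; right; apply/orP; left; apply/eqP.
  by rewrite -scaleN1r !sE (ltr0_sg h) ltr0_sg // oppr_lt0 ltr01.
- rewrite !inE; apply/orP; left; apply/eqP.
  by rewrite sE (gtr0_sg h); apply: eq_map => p; rewrite mul1r.
- by rewrite h scale0r !inE eqxx !orbT.
Qed.

(* Deletion-restriction: a sign pattern on [s] realised on [W] extends to [p :: s]
   in a single way, unless it is also realised on the hyperplane [p = 0] of [W]. *)
Lemma sgs_cover s W k : (\dim W <= k.+1)%N ->
  exists2 l : seq (seq R), (size l <= 3 * (2 * size s + 1) ^ k)%N &
    forall u, u \in W -> sgs s u \in l.
Proof.
elim: s W k => [|p s IH] W [|k] dW.
- by exists [:: [::]] => // u _; rewrite inE.
- exists [:: [::]]; last by move=> u _; rewrite inE.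
  by rewrite /= muln0 add0n exp1n.
- by have [l sl hl] := sgs_cover1 (p :: s) dW; exists l; rewrite ?expn0 ?muln1.
have [l sl hl] := IH W k.+1 dW.
case: (pselect (forall u, u \in W -> dot p u = 0)) => [W0|/existsNP[u0 /not_implyP[u0W u0p]]].
  exists [seq 0 :: t | t <- l].
    rewrite size_map (leq_trans sl) // leq_mul2l /= leq_exp2r //=; lia.
  by move=> u uW; rewrite /sgs /= W0 // sgr0 map_f // hl.
have dW' : (\dim (perpv p W) <= k.+1)%N.
  rewrite -ltnS (leq_trans _ dW) // ltn_neqAle dimvS ?capvSl // andbT.
  rewrite (dimv_leqif_eq (capvSl _ _)); apply: contra_notN u0p => /eqP e.
  by apply/eqP; move: u0W; rewrite -e mem_perpv => /andP[].
have [l' sl' hl'] := IH _ k dW'.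
(* The sign to put in front of [t]: 0 if [t] is realised on the hyperplane, otherwise the sign of
   [p] at any realisation, which [opp] below shows to be unique. *)
pose ext t : R := if `[< exists2 u, u \in perpv p W & sgs s u = t >] then 0 else
  Num.sg (dot p (xget 0 [set u | u \in W /\ sgs s u = t])).
exists ([seq ext t :: t | t <- l] ++ [seq 1 :: t | t <- l'] ++ [seq -1 :: t | t <- l']).
  rewrite !size_cat !size_map /= expnS; move: sl sl'; rewrite expnS.
  have := @leq_exp2r (2 * size s + 1) (2 * (size s).+1 + 1) k.
  case: k {IH dW dW' hl hl'} => [|k] h; first by rewrite !expn0; lia.
  have {}h : ((2 * size s + 1) ^ k.+1 <= (2 * (size s).+1 + 1) ^ k.+1)%N by rewrite h //; lia.
  nia.
move=> u uW; rewrite !mem_cat /sgs /= -/(sgs s u).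
case: (pselect (exists2 w, w \in perpv p W & sgs s w = sgs s u)) => [ex|nex].
  have extE : ext (sgs s u) = 0 by rewrite /ext; case: asboolP.
  have mem' : sgs s u \in l' by case: ex => w wW <-; exact: hl'.
  case: (ltgtP (dot p u) 0) => h.
  - by rewrite ltr0_sg // (map_f _ mem') !orbT.
  - by rewrite gtr0_sg // (map_f (cons 1) mem') !orbT.
  - by rewrite h sgr0 -{1}extE (map_f (fun t => ext t :: t) (hl _ uW)).
apply/orP; left.
suff -> : Num.sg (dot p u) = ext (sgs s u) by rewrite (map_f (fun t => ext t :: t) (hl _ uW)).
rewrite /ext; case: asboolP => // _.
case: xgetP => [w _ [wW we]|/(_ u)[]//].
have nz z : z \in W -> sgs s z = sgs s u -> dot p z != 0.
  by move=> zW ze; apply/eqP => z0; apply: nex; exists z; rewrite // mem_perpv zW z0 eqxx.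
(* Two realisations of one pattern on opposite sides of the hyperplane have a positive combination
   on it with the same pattern. *)
have opp z1 z2 : z1 \in W -> z2 \in W -> sgs s z1 = sgs s u -> sgs s z2 = sgs s u ->
    dot p z1 < 0 -> 0 < dot p z2 -> False.
  move=> z1W z2W e1 e2 n1 n2; apply: nex.
  exists (dot p z2 *: z1 + (- dot p z1) *: z2); last first.
    by rewrite sgs_convex // ?oppr_gt0 // e1 e2.
  by rewrite mem_perpv rpredD ?memvZ //= dotDr !dotZr; apply/eqP; ring.
case: (ltgtP (dot p u) 0) (nz _ uW erefl) => // hu _;
  case: (ltgtP (dot p w) 0) (nz _ wW we) => // hw _.
- by rewrite !ltr0_sg.
- by case: (opp u w).
- by case: (opp w u).
- by rewrite !gtr0_sg.
Qed.

End SignVectors.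

Section UpperFaces.
Variables (R : realType) (D : nat) (I : finType) (v : I -> 'rV[R]_D.+1).

Definition nzgen : {set I} := [set i | v i != 0].

(** A face depends only on the signs of [u] on the non-zero generators. The bound is in terms of
    [nzgen], not of [I], because [I] will index all available primitive vectors, most of them with
    multiplicity 0. *)
Lemma num_faces_ub i :
  finite_set (faces_of_dim (zono v) i) /\
  (num_faces i (zono v) <= 3 * (2 * #|nzgen| + 1) ^ D)%N.
Proof.
pose s := [seq v i | i <- enum nzgen].
have dW : (\dim (fullv : {vspace 'cV[R]_D.+1}) <= D.+1)%N by rewrite dimvf /dim /= muln1.
have [l sl hl] := sgs_cover s dW.
pose f t := zface v (xget 0 [set u | sgs s u = t]).
have [|fin le] := @card_set_cover _ _ l (faces_of_dim (zono v) i) f.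
  move=> F /faces_of_dim_zface[u -> _]; exists (sgs s u); first exact: hl (memvf u).
  rewrite /f; case: xgetP => [w _ /eqP/sgs_eqP e|/(_ u)[]//].
  apply: zface_sg_eq => j nz; rewrite e //; apply/mapP; exists j => //.
  by rewrite mem_enum inE.
by split=> //; rewrite (leq_trans le) // (leq_trans sl) // size_map -cardE.
Qed.

End UpperFaces.

(** * The number of towers *)

Section TowerUpper.
Variables (R : realType) (D : nat) (I : finType) (v : I -> 'rV[R]_D.+1).
Local Notation V := 'rV[R]_D.+1.
Implicit Types (u w : 'cV[R]_D.+1) (phi : 'I_D.+1 -> set V).

(** A direction [v i] of the smaller face is a difference of two of its points, [zbase] and
    [zbase + v i], and both lie in the larger face. *)
Lemma zspan_mono u w : zface v u `<=` zface v w -> (zspan v u <= zspan v w)%VS.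
Proof.
move=> sub; apply: zspan_sub => i h; apply: mem_zspan.
have := sub _ (zbase_face v u); rewrite zfaceE => -[_ /= e1].
have := sub _ (zbase_add h); rewrite zfaceE => -[_ /=]; rewrite dotDl e1.
by rewrite -[X in _ = X]addr0 => /addrI.
Qed.

Lemma dim_add_line (L : {vspace V}) (x : V) :
  x \notin L -> \dim (L + <[x]>) = (\dim L).+1.
Proof.
move=> nm; rewrite dimv_disjoint_sum.
  by rewrite dim_vline (_ : x != 0) ?addn1 //; apply: contraNneq nm => ->; exact: mem0v.
apply/eqP; rewrite -subv0; apply/subvP => y; rewrite memv_cap => /andP[yL /vlineP[c yc]].
rewrite memv0; case: (eqVneq c 0) => [c0|c0]; first by rewrite yc c0 scale0r.
case/negP: nm; rewrite -[x]scale1r -(mulVf c0) -scalerA -yc; exact: memvZ.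
Qed.

Definition genspan (q : 'I_D -> I) (j : nat) : {vspace V} :=
  (\sum_(l < D | (l < j)%N) <[v (q l)]>)%VS.

Lemma genspanS (q : 'I_D -> I) (j : 'I_D) :
  genspan q j.+1 = (genspan q j + <[v (q j)]>)%VS.
Proof.
rewrite /genspan (bigD1 j) //= addvC; congr (_ + _)%VS.
apply: eq_bigl => l; rewrite ltnS leq_eqVlt; case: (eqVneq l j) => [->|ne] /=.
  by rewrite ltnn andbF.
by rewrite andbT; case: eqP => // /val_inj e; rewrite e eqxx in ne.
Qed.

(** Witnesses of a tower: normals [u i] of its faces, and generators [q j] that enlarge the space of
    face directions by one dimension at a time. *)
Record tower_data (u : 'I_D.+1 -> 'cV[R]_D.+1) (q : 'I_D -> I) phi : Prop := TowerData {
  td_face : forall i, phi i = zface v (u i);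
  td_sub : forall i j : 'I_D.+1, (i <= j)%N -> zface v (u i) `<=` zface v (u j);
  td_span : forall i, zspan v (u i) = genspan q i;
  td_q : forall j, v (q j) \notin genspan q j }.

Lemma tower_has_data phi : towers (zono v) phi -> exists uq, tower_data uq.1 uq.2 phi.
Proof.
case=> hf hs.
have /choice[u hu] : forall i, exists u, phi i = zface v u /\ \dim (zspan v u) = i.
  by move=> i; have /faces_of_dim_zface[u e1 e2] := hf i; exists u.
have sub (i j : 'I_D.+1) : (i <= j)%N -> zface v (u i) `<=` zface v (u j).
  by move=> ij; rewrite -!(hu _).1; exact: hs.
have /choice[q hq] : forall j : 'I_D, exists i, v i \in zspan v (u (lift ord0 j)) /\
    v i \notin zspan v (u (widen_ord (leqnSn D) j)).
  move=> j; apply: contrapT => /forallNP h.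
  have : (zspan v (u (lift ord0 j)) <= zspan v (u (widen_ord (leqnSn D) j)))%VS.
    apply: zspan_sub => i /mem_zspan m; apply: contrapT => /negP nm.
    by apply: (h i).
  by move/dimvS; rewrite !(hu _).2 /= /bump /= add1n ltnn.
have span (i : nat) (hi : (i < D.+1)%N) : zspan v (u (Ordinal hi)) = genspan q i.
  elim: i hi => [|i IH] hi.
    rewrite /genspan big_pred0 //; apply/eqP.
    by rewrite -dimv_eq0 (hu _).2.
  have hi' : (i < D)%N by [].
  have /= := hq (Ordinal hi').
  rewrite (_ : widen_ord _ _ = Ordinal (leqW hi')); last exact: val_inj.
  rewrite (_ : lift _ _ = Ordinal hi); last exact: val_inj.
  rewrite IH => -[m nm].
  have -> := genspanS q (Ordinal hi').
  apply/eqP; rewrite eq_sym -(dimv_leqif_eq (_ : (_ <= _)%VS)); last first.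
    rewrite subv_add -memvE m andbT -(IH (leqW hi')); apply: zspan_mono.
    by apply: sub => /=.
  by rewrite dim_add_line // -(IH (leqW hi')) !(hu _).2.
exists (u, q); split=> //=.
- by move=> i; case: (hu i).
- by case=> i hi; exact: span.
- move=> j; have [_] := hq j.
  by rewrite (_ : widen_ord _ _ = Ordinal (ltnW (ltn_ord j : (j < D)%N) : (j < D.+1)%N)) ?span //; exact: val_inj.
Qed.

Lemma sg_line (L : {vspace V}) (r x : V) u w :
  {in L, forall y, dot y u = 0} -> {in L, forall y, dot y w = 0} ->
  Num.sg (dot r u) = Num.sg (dot r w) -> x \in (L + <[r]>)%VS ->
  Num.sg (dot x u) = Num.sg (dot x w).
Proof.
move=> Lu Lw e /memv_addP[y yL [z /vlineP[c ->] ->]].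
by rewrite !dotDl !dotZl (Lu _ yL) (Lw _ yL) !add0r !sgrM e.
Qed.

Lemma sg_bool (x y : R) : x != 0 -> y != 0 -> (0 < x) = (0 < y) -> Num.sg x = Num.sg y.
Proof.
case: (ltgtP x 0) => // hx _; case: (ltgtP y 0) => // hy _ _.
  by rewrite !ltr0_sg.
by rewrite !gtr0_sg.
Qed.

(** A generator off the direction space of the top face of a tower. There is none when the zonotope
    itself has dimension [D]; the top face is then the whole zonotope. *)
Definition outside (q : 'I_D -> I) : option I := [pick i | v i \notin genspan q D].

Lemma td_dot0 (u : 'I_D.+1 -> 'cV[R]_D.+1) q phi (i : 'I_D.+1) : tower_data u q phi ->
  {in genspan q i, forall y, dot y (u i) = 0}.
Proof. by move=> td y; rewrite -(td_span td); exact: zspan_dot0. Qed.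

Lemma td_dot (u : 'I_D.+1 -> 'cV[R]_D.+1) q phi (i : 'I_D.+1) j : tower_data u q phi ->
  v j \notin genspan q i -> dot (v j) (u i) != 0.
Proof.
by move=> td; rewrite -(td_span td); apply: contraNneq; exact: mem_zspan.
Qed.

(* The faces of a tower are recovered from the top: [u i] vanishes on [genspan q i],
   a hyperplane of [genspan q i.+1], so there it is fixed by a sign, while outside
   [genspan q i.+1] its signs are those of [u i.+1]. *)
Lemma tower_data_inj (u u' : 'I_D.+1 -> 'cV[R]_D.+1) q phi phi' :
  tower_data u q phi -> tower_data u' q phi' ->
  (forall j : 'I_D, (0 < dot (v (q j)) (u (widen_ord (leqnSn D) j))) =
     (0 < dot (v (q j)) (u' (widen_ord (leqnSn D) j)))) ->
  (if outside q is Some r then (0 < dot (v r) (u ord_max)) = (0 < dot (v r) (u' ord_max))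
   else True) -> phi = phi'.
Proof.
move=> td td' sg1 sg2.
suff key r : (r <= D)%N -> forall i : 'I_D.+1, (D - r <= i)%N -> zface v (u i) = zface v (u' i).
  by apply/funext => i; rewrite (td_face td) (td_face td'); apply: (key D); rewrite ?subnn.
elim: r => [_|r IH hr] i hi.
  have -> : i = ord_max by apply: val_inj => /=; have := ltn_ord i; lia.
  apply: zface_sg_eq => j _; move: sg2; rewrite /outside; case: pickP => [r hr sg2|all _].
    apply: (@sg_line (genspan q D) (v r)).
    - exact: (td_dot0 (i := ord_max) td).
    - exact: (td_dot0 (i := ord_max) td').
    - apply: sg_bool => //; first exact: (td_dot (i := ord_max) td hr).
      exact: (td_dot (i := ord_max) td' hr).
    - suff -> : (genspan q D + <[v r]>)%VS = fullv by exact: memvf.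
      apply/eqP; rewrite -(dimv_leqif_eq (subvf _)) eqn_leq dimvS ?subvf //=.
      rewrite dimvf /dim /= mul1n.
      rewrite dim_add_line // ltnS.
      have gen m : (m <= D)%N -> \dim (genspan q m) = m.
        elim: m => [|m IHm] hm; first by rewrite /genspan big_pred0 // dimv0.
        have -> := genspanS q (Ordinal hm).
        have nm := td_q td (Ordinal hm).
        by rewrite dim_add_line // IHm ?(ltnW hm).
      by rewrite gen.
  have /negbFE m := all j.
  by rewrite (td_dot0 (i := ord_max) td m) (td_dot0 (i := ord_max) td' m).
have [hi'|hi'] := ltnP (D - r.+1) i; first by apply: IH; lia.
have iE : i = (D - r.+1)%N :> nat by apply/eqP; rewrite eqn_leq hi' hi.
have iD : (i < D)%N by lia.
pose i' := Ordinal iD; pose i1 := lift ord0 i'.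
have wi : widen_ord (leqnSn D) i' = i by exact: val_inj.
have IH1 : zface v (u i1) = zface v (u' i1) by apply: IH; rewrite /= /bump /=; lia.
have ii1 : (i <= i1)%N by rewrite /= /bump /=; lia.
apply: zface_sg_eq => j _.
have [m|nm] := boolP (v j \in genspan q i1).
  apply: (@sg_line (genspan q i) (v (q i'))).
  - exact: (td_dot0 td).
  - exact: (td_dot0 td').
  - apply: sg_bool; last by have := sg1 i'; rewrite wi.
      by apply: (td_dot td); exact: (td_q td i').
    by apply: (td_dot td'); exact: (td_q td i').
  - by have <- := genspanS q i'; move: m; rewrite /i1 /= /bump /= add1n.
(* A subface keeps all non-zero signs of the face that contains it. *)
have same w w' : zface v w `<=` zface v w' -> dot (v j) w' != 0 ->
    Num.sg (dot (v j) w) = Num.sg (dot (v j) w').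
  move=> sub; case: (ltgtP (dot (v j) w') 0) => // h _.
    by rewrite !ltr0_sg //; exact: zface_sub_neg h.
  by rewrite !gtr0_sg //; exact: zface_sub_pos h.
rewrite (same (u i) (u i1)) ?(same (u' i) (u' i1)) //.
- by apply: same; rewrite ?IH1 //; exact: td_dot td' nm.
- exact: (td_sub td').
- exact: td_dot td' nm.
- exact: (td_sub td).
- exact: td_dot td nm.
Qed.

(** The code consists of [D] generators, each non-zero, of [D] signs at these generators, and of one
    sign at [outside]. *)
Lemma num_towers_ub :
  finite_set (towers (zono v)) /\
  (num_towers (zono v) <= #|nzgen v| ^ D * 2 ^ D.+1)%N.
Proof.
have [e|/set0P[phi0 Tphi0]] := eqVneq (towers (zono v)) set0.
  by rewrite /num_towers e /card_set fset_set0 cardfs0.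
have [[u0 q0] _] := tower_has_data Tphi0.
pose dat phi := xget (u0, q0) [set uq | tower_data uq.1 uq.2 phi].
have datP phi : towers (zono v) phi -> tower_data (dat phi).1 (dat phi).2 phi.
  by move=> /tower_has_data[uq h]; rewrite /dat; case: xgetP => // /(_ uq).
pose code phi : {ffun 'I_D -> I} * {ffun 'I_D -> bool} * bool :=
  let u := (dat phi).1 in let q := (dat phi).2 in
  ([ffun j => q j], [ffun j => 0 < dot (v (q j)) (u (widen_ord (leqnSn D) j))],
   if outside q is Some r then 0 < dot (v r) (u ord_max) else true).
pose A : {set {ffun 'I_D -> I} * {ffun 'I_D -> bool} * bool} :=
  finset.setX (finset.setX [set f in ffun_on (mem (nzgen v))] (finset.setTfor _))
    (finset.setTfor _).
have [] := @card_set_inj _ _ A (towers (zono v)) code.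
- move=> phi phi' /datP td /datP td' [/ffunP e1 /ffunP e2 e3].
  have qE : (dat phi).2 = (dat phi').2 by apply/funext => j; have := e1 j; rewrite !ffunE.
  apply: (tower_data_inj td); first by rewrite qE; exact: td'.
    by move=> j; have := e2 j; rewrite !ffunE qE.
  by move: e3; rewrite qE; case: outside.
- move=> phi /datP td; rewrite !inE !andbT; apply/ffun_onP => j; rewrite ffunE inE.
  by have := td_q td j; apply: contraNneq => ->; exact: mem0v.
move=> fin le; split=> //; rewrite (leq_trans le) // !cardsX cardsE card_ffun_on !cardsT.
by rewrite card_ffun !card_bool card_ord expnS [in X in (_ <= X)%N]mulnA mulnAC.
Qed.

End TowerUpper.

(** * Lexicographic perturbation of normals *)

Section LexFaces.
Variables (R : realType) (D : nat) (I : finType) (v : I -> 'rV[R]_D.+1).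
Local Notation V := 'rV[R]_D.+1.

Section OneNormal.
Variables (u : 'cV[R]_D.+1) (w : nat -> 'cV[R]_D.+1) (p : nat -> I).

Definition pert_eps (u w : 'cV[R]_D.+1) : R := s2val (cid2 (perturb v u w)).

(* [lexn r] is [u] followed by ever smaller multiples of
   [w (D - 1)], ..., [w (D - r)]. *)
Fixpoint lexn (r : nat) : 'cV[R]_D.+1 :=
  if r is r'.+1 then lexn r' + pert_eps (lexn r') (w (D - r)) *: w (D - r) else u.

Lemma lexnS r i : Num.sg (dot (v i) (lexn r.+1)) =
  if dot (v i) (lexn r) == 0 then Num.sg (dot (v i) (w (D - r.+1)))
  else Num.sg (dot (v i) (lexn r)).
Proof. by rewrite /= /pert_eps; case: cid2. Qed.

Lemma lexn_sub r : zface v (lexn r.+1) `<=` zface v (lexn r).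
Proof. by apply: zface_sg_sub => i h; rewrite lexnS (negbTE h). Qed.

Lemma lexn_subD r m : zface v (lexn (m + r)) `<=` zface v (lexn r).
Proof. by elim: m => [|m IH] //; apply: subset_trans IH; exact: lexn_sub. Qed.

Lemma lexn_neg r i : dot (v i) u < 0 -> dot (v i) (lexn r) < 0.
Proof.
elim: r => // r IH /IH h; rewrite -sgr_lt0 lexnS lt_eqF // sgr_lt0 //.
Qed.

Lemma lexn_eq0 r i : (r <= D)%N -> dot (v i) (lexn r) = 0 ->
  dot (v i) u = 0 /\ forall l, (D - r <= l < D)%N -> dot (v i) (w l) = 0.
Proof.
elim: r => [|r IH] hr.
  by move=> h; split=> // l; rewrite subn0 => /andP[h1 h2]; have := leq_ltn_trans h1 h2; rewrite ltnn.
move=> h; have := lexnS r i; rewrite h sgr0; case: eqP => [h0|/eqP h0]; last first.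
  by move=> /esym/eqP; rewrite sgr_eq0 (negbTE h0).
have [u0 hl] := IH (ltnW hr) h0.
move=> /esym/eqP; rewrite sgr_eq0 => /eqP w0; split=> // l hll.
by case: (eqVneq l (D - r.+1)%N) => [->//|ne]; apply: hl; lia.
Qed.

(** The three hypotheses say that the generators [p l] form a basis of the hyperplane orthogonal to
    [u], with [w] as dual basis. *)
Hypothesis pu : forall l, (l < D)%N -> dot (v (p l)) u = 0.
Hypothesis pw : forall l m, (l < D)%N -> (m < D)%N -> dot (v (p l)) (w m) = (l == m)%:R.
Hypothesis uperp : forall x : V, dot x u = 0 -> x = \sum_(l < D) dot x (w l) *: v (p l).

(** Each perturbation uses a dual vector, whose values on the basis are 0 or 1, so no basis
    generator ever turns negative. *)
Lemma lexn_p_ge0 r l : (r <= D)%N -> (l < D)%N -> 0 <= dot (v (p l)) (lexn r).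
Proof.
elim: r => [|r IH] hr hl; first by rewrite /= pu.
rewrite -sgr_ge0 lexnS; case: ifP => _; last by rewrite sgr_ge0 IH // ltnW.
by rewrite pw ?sgr_ge0 ?ler0n //; lia.
Qed.

Lemma lexn_p_eq0 r l : (r <= D)%N -> (l < D - r)%N -> dot (v (p l)) (lexn r) = 0.
Proof.
elim: r => [|r IH] hr hl; first by rewrite /= pu //; lia.
apply/eqP; rewrite -sgr_eq0 lexnS IH ?eqxx //; try lia.
have ne : (l == (D - r.+1)%N) = false by apply/eqP; lia.
by rewrite pw ?ne ?sgr0 //; lia.
Qed.

(** Each step removes exactly one basis generator, the last remaining one, from the directions of
    the face. *)
Lemma lexn_dim r : (r <= D)%N -> \dim (zspan v (lexn r)) = (D - r)%N.
Proof.
move=> hr; pose X := [seq v (p l) | l <- iota 0 (D - r)].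
have sX : size X = (D - r)%N by rewrite size_map size_iota.
have nX (i : nat) : (i < size X)%N -> X`_i = v (p i).
  by move=> hi; rewrite /X (nth_map 0%N) ?size_iota -?sX // nth_iota -?sX.
have -> : zspan v (lexn r) = span X.
  apply/eqP; rewrite eqEsubv; apply/andP; split.
    apply: zspan_sub => i /(lexn_eq0 hr)[h0 h]; rewrite (uperp h0).
    apply: memv_suml => l _; have [hl|hl] := leqP (D - r) l.
      by rewrite h ?hl ?ltn_ord // scale0r mem0v.
    by apply: memvZ; apply: memv_span; apply: map_f; rewrite mem_iota.
  apply/span_subvP => x /mapP[l]; rewrite mem_iota => hl ->.
  by apply: mem_zspan; apply: lexn_p_eq0.
have fX : free (in_tuple X).
  apply/freeP => k /(congr1 (fun x => dot x)) e i.
  have /(congr1 (fun f => f (w i))) := e; rewrite dot0l dot_suml.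
  have iD : (i < D)%N by have := ltn_ord i; lia.
  rewrite (bigD1 i) //= big1.
    by rewrite addr0 dotZl nX // pw // eqxx mulr1.
  move=> j ji; rewrite dotZl nX // pw //; last by have := ltn_ord j; lia.
  by rewrite (_ : (nat_of_ord j == i) = false) ?mulr0 //; exact/negbTE.
by move: fX; rewrite /free => /eqP ->; rewrite sX.
Qed.

End OneNormal.

(** After [D - i] steps the face has dimension [i] and all basis generators are still nonnegative.
    If [t] and [t'] gave the same face, each normal would be nonnegative on the basis of the other,
    and the last hypothesis excludes this. Towers are already told apart by their vertices. *)
Lemma many_faces (T : finType) (G : {set T}) (u : T -> 'cV[R]_D.+1)
    (w : T -> nat -> 'cV[R]_D.+1) (p : T -> nat -> I) :
  (forall t l, t \in G -> (l < D)%N -> dot (v (p t l)) (u t) = 0) ->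
  (forall t l m, t \in G -> (l < D)%N -> (m < D)%N ->
     dot (v (p t l)) (w t m) = (l == m)%:R) ->
  (forall t (x : V), t \in G -> dot x (u t) = 0 ->
     x = \sum_(l < D) dot x (w t l) *: v (p t l)) ->
  (forall t t', t \in G -> t' \in G ->
     (forall l, (l < D)%N -> 0 <= dot (v (p t l)) (u t')) ->
     (forall l, (l < D)%N -> 0 <= dot (v (p t' l)) (u t)) -> t = t') ->
  (forall i : 'I_D.+1, (#|G| <= num_faces i (zono v))%N) /\
  (#|G| <= num_towers (zono v))%N.
Proof.
move=> pu pw uperp sep.
pose F t (i : 'I_D.+1) := zface v (lexn (u t) (w t) (D - i)).
have Fi t t' i : t \in G -> t' \in G -> F t i = F t' i -> t = t'.
  have half t1 t2 l : t1 \in G -> F t1 i = F t2 i -> (l < D)%N ->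
      0 <= dot (v (p t1 l)) (u t2).
    move=> t1G e hl; rewrite leNgt; apply/negP => /(lexn_neg (w t2) (D - i)) h.
    have : 0 <= dot (v (p t1 l)) (lexn (u t1) (w t1) (D - i)).
      by apply: (@lexn_p_ge0 _ _ (p t1)); rewrite ?leq_subr //; auto.
    move/(zface_sub_ge (w := lexn (u t2) (w t2) (D - i))).
    by rewrite leNgt h => /(_ _)/negP[]//; rewrite -[X in X `<=` _]/(F t1 i) e.
  move=> tG t'G e; apply: sep => // l hl; first exact: half e hl.
  exact: half (esym e) hl.
have Fdim t (i : 'I_D.+1) : t \in G -> faces_of_dim (zono v) i (F t i).
  move=> tG; apply/faces_of_dim_zface; exists (lexn (u t) (w t) (D - i)) => //.
  rewrite (@lexn_dim _ _ (p t)) ?leq_subr //; try by auto.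
  by rewrite subKn // -ltnS.
split=> [i|].
  apply: (@card_set_ge _ _ _ _ (F ^~ i)).
  - exact: (num_faces_ub v i).1.
  - by move=> t t' tG t'G; exact: Fi.
  - by move=> t tG; exact: Fdim.
apply: (@card_set_ge _ _ _ _ F).
- exact: (num_towers_ub v).1.
- by move=> t t' tG t'G /(congr1 (fun f => f ord0)); exact: Fi.
- move=> t tG; split=> [i|i j ij]; first exact: Fdim.
  rewrite /F (_ : (D - i)%N = (j - i + (D - j))%N); first exact: lexn_subD.
  by have := ltn_ord j; lia.
Qed.

End LexFaces.

(** * Hyperplanes spanned by dominant lattice vectors *)

Lemma card_box (T : finType) (A : {set T}) (m W : nat) (f : T -> 'I_m -> int) :
  {in A &, forall x y, (forall i, f x i = f y i) -> x = y} ->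
  {in A, forall x i, `|f x i| <= W%:Z} -> (#|A| <= (2 * W + 1) ^ m)%N.
Proof.
move=> fi fb; pose g x := [ffun i => inord (absz (f x i + W%:Z)) : 'I_(2 * W).+1].
have gi : {in A &, injective g}.
  move=> x y xA yA /ffunP e; apply: fi => // i.
  have h1 := fb x xA i; have h2 := fb y yA i.
  have := e i; rewrite !ffunE => /(congr1 val) /=; rewrite !inordK; lia.
rewrite -(card_in_imset gi) (leq_trans (max_card _)) //.
by rewrite card_ffun !card_ord addn1.
Qed.

Section Emb.
Variables (R : realType).

Definition emb (d : nat) (a : 'rV[int]_d) : 'rV[R]_d := map_mx intr a.

Variable d : nat.
Implicit Types a b : 'rV[int]_d.

Lemma embE a i : emb a 0 i = (a 0 i)%:~R.
Proof. by rewrite mxE. Qed.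

Lemma emb0 : emb (0 : 'rV[int]_d) = 0.
Proof. by apply/rowP => i; rewrite !mxE. Qed.

Lemma embD a b : emb (a + b) = emb a + emb b.
Proof. by apply/rowP => i; rewrite !mxE intrD. Qed.

Lemma embB a b : emb (a - b) = emb a - emb b.
Proof. by apply/rowP => i; rewrite !mxE intrD intrN. Qed.

Lemma embMn a n : emb (a *+ n) = n%:R *: emb a.
Proof.
by apply/rowP => i; rewrite !mxE mulmxnE rmorphMn mulr_natl.
Qed.

Lemma embZ (z : int) a : emb (z *: a) = z%:~R *: emb a.
Proof. by apply/rowP => i; rewrite !mxE intrM. Qed.

Lemma emb_sum (I : Type) (r : seq I) (P : pred I) (F : I -> 'rV[int]_d) :
  emb (\sum_(i <- r | P i) F i) = \sum_(i <- r | P i) emb (F i).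
Proof. by apply: big_morph; [exact: embD|exact: emb0]. Qed.

Lemma emb_inj : injective (@emb d).
Proof. by move=> a b /rowP e; apply/rowP => i; have := e i; rewrite !embE => /intr_inj. Qed.

End Emb.

Lemma mulmx_col (R : pzRingType) m n p (A : 'M[R]_(m, n)) (B : 'M[R]_(n, p)) j :
  A *m col j B = col j (A *m B).
Proof. by rewrite !colE mulmxA. Qed.

Section Dominant.
Variables (R : realType) (D : nat).
Local Notation V := 'rV[R]_D.+1.
Local Notation wd := (widen_ord (leqnSn D)).

Definition dominant (j : 'I_D.+1) (a : V) := \sum_(i | i != j) `|a 0 i| < a 0 j.

Lemma dominant_dot j a (z : 'cV[R]_D.+1) : dominant j a ->
  (forall i, `|z i 0| <= z j 0) -> 0 < z j 0 -> 0 < dot a z.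
Proof.
move=> dom zb z0; rewrite dotE (bigD1 j) //=.
have h : `|\sum_(i | i != j) a 0 i * z i 0| <= (\sum_(i | i != j) `|a 0 i|) * z j 0.
  apply: le_trans (ler_norm_sum _ _ _) _; rewrite mulr_suml; apply: ler_sum => i _.
  by rewrite normrM ler_wpM2l.
have h2 : (\sum_(i | i != j) `|a 0 i|) * z j 0 < a 0 j * z j 0 by rewrite ltr_pM2r.
by move: (le_lt_trans h h2); rewrite ltr_norml => /andP[h3 _]; rewrite -ltrBlDl sub0r.
Qed.

Lemma argmax_norm (z : 'cV[R]_D.+1) : exists j, forall i, `|z i 0| <= `|z j 0|.
Proof.
by have [j _ h] := @arg_maxP _ R 'I_D.+1 ord0 xpredT (fun i => `|z i 0|) isT; exists j => i; exact: h.
Qed.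

Lemma ord_wd (i : 'I_D.+1) : i = ord_max \/ exists j, i = wd j.
Proof.
have [h|h] := ltnP i D; first by right; exists (Ordinal h); exact: val_inj.
by left; apply: val_inj; apply/eqP; rewrite eqn_leq h -ltnS ltn_ord.
Qed.

Lemma wd_max j : (wd j == ord_max) = false.
Proof. by apply/eqP => /(congr1 val) /= e; have := ltn_ord j; rewrite e ltnn. Qed.

Lemma wd_inj : injective wd.
Proof. by move=> i j /(congr1 val) /= /val_inj. Qed.

Lemma unitmx_ker n (A : 'M[R]_n) :
  (forall z : 'cV[R]_n, A *m z = 0 -> z = 0) -> A \in unitmx.
Proof.
move=> h; rewrite -unitmx_tr -row_free_unit -kermx_eq0; apply/eqP.
apply: trmx_inj; rewrite trmx0.
have e : A *m (kermx A^T)^T = 0 by rewrite -[A]trmxK -trmx_mul trmxK mulmx_ker trmx0.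
apply/matrixP => i j; have /matrixP/(_ i 0) : col j (kermx A^T)^T = 0.
  by apply: h; rewrite mulmx_col e col0.
by rewrite !mxE.
Qed.

(** The additional last row makes the matrix square and normalises [normal] to have last coordinate
    1. *)
Definition fullmx (X : 'I_D -> V) : 'M[R]_D.+1 :=
  \matrix_i (if insub (i : nat) is Some j then X j else delta_mx 0 ord_max).

Lemma row_fullmx X j : row (wd j) (fullmx X) = X j.
Proof.
rewrite rowK; case: insubP => [k _ e|]; last by rewrite /= ltn_ord.
by congr X; exact: val_inj.
Qed.

Lemma row_fullmx_max X : row ord_max (fullmx X) = delta_mx 0 ord_max.
Proof. by rewrite rowK insubF //= ltnn. Qed.

Variable X : 'I_D -> V.
Hypothesis domX : forall j, dominant (wd j) (X j).

Lemma fullmx_dot j (z : 'cV[R]_D.+1) : (fullmx X *m z) (wd j) 0 = dot (X j) z.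
Proof. by rewrite /dot -(row_fullmx X) -row_mul [RHS]mxE. Qed.

Lemma fullmx_dot_max (z : 'cV[R]_D.+1) : (fullmx X *m z) ord_max 0 = z ord_max 0.
Proof.
have := congr1 (fun A : 'M[R]_1 => A 0 0) (row_mul ord_max (fullmx X) z).
rewrite row_fullmx_max mxE => ->; rewrite mxE (bigD1 ord_max) //= mxE !eqxx mul1r.
by rewrite big1 ?addr0 // => i ne; rewrite mxE (negbTE ne) mul0r.
Qed.

(** The coordinate of [z] of largest modulus decides the sign of [dot] on a vector dominated by that
    coordinate. With [X' = X] this yields invertibility; with two tuples and [z] the difference of
    their normals it separates the normals. *)
Lemma dominant_sep (X' : 'I_D -> V) (z : 'cV[R]_D.+1) :
  (forall j, dominant (wd j) (X' j)) -> z ord_max 0 = 0 ->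
  (forall j, 0 <= dot (X j) z) -> (forall j, dot (X' j) z <= 0) -> z = 0.
Proof.
move=> domX' zm h1 h2; have [i hi] := argmax_norm z.
suff z0 : z i 0 = 0.
  by apply/colP => k; rewrite mxE; apply/eqP; rewrite -normr_le0 (le_trans (hi k)) // z0 normr0.
case: (ord_wd i) => [->//|[j e]]; subst i.
apply/eqP; case: (ltgtP (z (wd j) 0) 0) => // s.
  have : 0 < dot (X j) (- z).
    apply: dominant_dot (domX j) _ _; rewrite ?mxE ?oppr_gt0 // => k.
    by rewrite mxE normrN -(ltr0_norm s).
  by rewrite dotNr oppr_gt0 ltNge h1.
have : 0 < dot (X' j) z.
  by apply: dominant_dot (domX' j) _ _ => // k; rewrite -(gtr0_norm s).
by rewrite ltNge h2.
Qed.

Lemma fullmx_unit : fullmx X \in unitmx.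
Proof.
apply: unitmx_ker => z e; apply: (dominant_sep domX).
- by rewrite -fullmx_dot_max e mxE.
- by move=> j; rewrite -fullmx_dot e mxE.
- by move=> j; rewrite -fullmx_dot e mxE.
Qed.

Definition normal : 'cV[R]_D.+1 := col ord_max (invmx (fullmx X)).
Definition dualv (l : 'I_D) : 'cV[R]_D.+1 := col (wd l) (invmx (fullmx X)).

Lemma normal_dot j : dot (X j) normal = 0.
Proof.
rewrite -fullmx_dot /normal mulmx_col mulmxV ?fullmx_unit // !mxE.
by rewrite wd_max.
Qed.

Lemma normal_max : normal ord_max 0 = 1.
Proof.
by rewrite -fullmx_dot_max /normal mulmx_col mulmxV ?fullmx_unit // !mxE eqxx.
Qed.

Lemma dualv_dot j l : dot (X j) (dualv l) = (j == l)%:R.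
Proof.
rewrite -fullmx_dot /dualv mulmx_col mulmxV ?fullmx_unit // !mxE.
by rewrite (inj_eq wd_inj).
Qed.

Lemma fullmx_decomp (y : V) :
  y = \sum_l dot y (dualv l) *: X l + dot y normal *: delta_mx 0 ord_max.
Proof.
have dE k : dot y (col k (invmx (fullmx X))) = (y *m invmx (fullmx X)) 0 k.
  by rewrite /dot mulmx_col mxE.
rewrite -{1}(mulmxKV fullmx_unit y) mulmx_sum_row big_ord_recr /= row_fullmx_max.
rewrite /normal dE; congr (_ + _); apply: eq_bigr => l _.
rewrite -[in RHS]row_fullmx /dualv dE; congr (_ 0 _ *: row _ _); exact: val_inj.
Qed.

(** The largest coordinate must be the last one: at any other position [wd j] the vector [X j],
    dominated there, could not be orthogonal to the normal. *)
Lemma normal_le1 i : `|normal i 0| <= 1.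
Proof.
have := normal_dot; have := normal_max; move: normal => z zmax zdot.
have [k hk] := argmax_norm z; apply: le_trans (hk i) _.
case: (ord_wd k) => [->|[j e]]; first by rewrite zmax normr1.
subst k; case: (ltgtP (z (wd j) 0) 0) => s; last by rewrite s normr0 ler01.
  have : 0 < dot (X j) (- z).
    apply: dominant_dot (domX j) _ _; rewrite ?mxE ?oppr_gt0 // => k.
    by rewrite mxE normrN -(ltr0_norm s).
  by rewrite dotNr zdot oppr0 ltxx.
have : 0 < dot (X j) z.
  by apply: dominant_dot (domX j) _ _ => // k; rewrite -(gtr0_norm s).
by rewrite zdot ltxx.
Qed.

End Dominant.

(** * Denominators of normals and lattice points on a hyperplane *)

Section Packing.
Variables (R : realType) (D : nat).
Local Notation wd := (widen_ord (leqnSn D)).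
Implicit Types (x : 'cV[R]_D.+1) (m : nat).

Definition isden x m := (0 < m)%N && `[< forall i, m%:R * x i 0 \is a Num.int >].

Lemma isdenP x m :
  reflect ((0 < m)%N /\ forall i, m%:R * x i 0 \is a Num.int) (isden x m).
Proof.
by apply: (iffP andP) => -[h1 h2]; split=> //; apply/asboolP.
Qed.

Lemma dot_emb_int x m (r : 'rV[int]_D.+1) :
  (forall i, m%:R * x i 0 \is a Num.int) -> exists z : int, m%:R * dot (emb R r) x = z%:~R.
Proof.
move=> h; suff /intrP[z ->] : m%:R * dot (emb R r) x \is a Num.int by exists z.
rewrite dotE mulr_sumr; apply: rpred_sum => i _.
by rewrite embE mulrCA rpredM ?intr_int ?h.
Qed.

Lemma dot_delta x k : dot (delta_mx 0 k) x = x k 0.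
Proof.
rewrite dotE (bigD1 k) //= mxE !eqxx mul1r big1 ?addr0 // => i ne.
by rewrite mxE (negbTE ne) mul0r.
Qed.

Lemma emb_delta k : emb R (delta_mx 0 k : 'rV[int]_D.+1) = delta_mx 0 k.
Proof. by apply/rowP => i; rewrite !mxE; case: (_ && _). Qed.

(* The values of [dot _ x] on the lattice form the group generated by [e / m],
   and minimality of the denominator [m] forces [e = 1]. *)
Lemma bezout_normal x m : x ord_max 0 = 1 -> isden x m ->
  (forall m', isden x m' -> (m <= m')%N) ->
  exists r : 'rV[int]_D.+1, m%:R * dot (emb R r) x = 1.
Proof.
move=> xmax /isdenP[m0 mint] mmin.
pose S (e : nat) := (0 < e)%N &&
  `[< exists r : 'rV[int]_D.+1, m%:R * dot (emb R r) x = e%:R >].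
have Sm : exists e, S e.
  exists m; rewrite /S m0; apply/asboolP; exists (delta_mx 0 ord_max).
  by rewrite emb_delta dot_delta xmax mulr1.
case: (ex_minnP Sm) => e /andP[e0 /asboolP[r re]] emin.
have dvd (r' : 'rV[int]_D.+1) (z : int) : m%:R * dot (emb R r') x = z%:~R -> (e %| z)%Z.
  move=> hz; apply/dvdz_mod0P; apply/eqP; apply: contraT => nz.
  have e0z : (e : int) != 0 by lia.
  have ge0 := modz_ge0 z e0z; have lt := ltz_mod z e0z.
  have := emin (absz (z %% e)%Z); rewrite /S absz_gt0 nz /=.
  suff -> : `[< exists r0 : 'rV[int]_D.+1, m%:R * dot (emb R r0) x = `|(z %% e)%Z|%N%:R >].
    by move=> /(_ isT); lia.
  apply/asboolP; exists (r' - (z %/ e)%Z *: r).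
  rewrite embB embZ dotBl dotZl mulrBr mulrCA re hz.
  rewrite (_ : `|(z %% e)%Z|%N%:R = ((z %% e)%Z)%:~R :> R); last first.
    by rewrite -[in RHS](gez0_abs ge0).
  rewrite {1}(divz_eq z e) intrD intrM; ring.
have /dvdzP[q qE] : (e %| m%:Z)%Z.
  by apply: (dvd (delta_mx 0 ord_max)); rewrite emb_delta dot_delta xmax mulr1.
have q0 : (0 < q)%R by nia.
have : isden x (absz q).
  apply/isdenP; split; first by lia.
  move=> i; have [z hz] := dot_emb_int (delta_mx 0 i) mint.
  have /dvdzP[t tE] := dvd _ _ hz.
  suff -> : `|q|%N%:R * x i 0 = t%:~R by exact: intr_int.
  move: hz; rewrite emb_delta dot_delta tE intrM.
  have -> : m%:R = q%:~R * e%:R :> R by rewrite -[m%:R]/(m%:Z%:~R) qE intrM.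
  have -> : `|q|%N%:R = q%:~R :> R by rewrite -[in RHS](gtz0_abs q0).
  have e0' : (e%:R : R) != 0 by rewrite pnatr_eq0; lia.
  by move=> h; apply: (mulfI e0'); rewrite mulrCA mulrA h mulrC.
move/mmin => le; exists r; rewrite re.
suff -> : e = 1%N by [].
nia.
Qed.

Variables (X : 'I_D -> 'rV[int]_D.+1) (W : nat).
Hypothesis domX : forall j, dominant (wd j) (emb R (X j)).
Hypothesis bndX : forall j i, `|X j 0 i| <= W%:Z.
Hypothesis W0 : (0 < W)%N.
Let x := normal (fun j => emb R (X j)).

(** Subtracting integer parts leaves [D] coefficients in [0,1) on the vectors [X l] and one on the
    last unit vector, hence entries of at most D W + 1. *)
Lemma reduce_rep (r : 'rV[int]_D.+1) : 0 <= dot (emb R r) x < 1 ->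
  exists r' : 'rV[int]_D.+1, dot (emb R r') x = dot (emb R r) x /\
    forall i, `|r' 0 i| <= (D.+1 * W)%N%:Z.
Proof.
move=> rx; pose c l := dot (emb R r) (dualv (fun j => emb R (X j)) l).
exists (r - \sum_l Num.floor (c l) *: X l).
have rE := fullmx_decomp domX (emb R r).
have e : emb R (r - \sum_l Num.floor (c l) *: X l) =
    \sum_l (c l - (Num.floor (c l))%:~R) *: emb R (X l) +
    dot (emb R r) x *: delta_mx 0 ord_max.
  rewrite embB emb_sum {1}rE -/x addrAC; congr (_ + _); rewrite -sumrB; apply: eq_bigr => l _.
  by rewrite embZ scalerBl.
split.
  rewrite embB emb_sum dotBl dot_suml big1 ?subr0 // => l _.
  by rewrite embZ dotZl (normal_dot domX) mulr0.
move=> i; rewrite -(ler_int R) intr_norm -embE e mxE summxE.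
apply: le_trans (ler_normD _ _) _; rewrite mulSn addnC -[(_ + W)%N%:~R]/((_ + W)%N%:R) natrD.
apply: lerD.
  apply: le_trans (ler_norm_sum _ _ _) _.
  rewrite natrM mulr_natl -[X in _ *+ X]card_ord -sumr_const; apply: ler_sum => l _.
  rewrite !mxE normrM; have /andP[f1 f2] := floor_itv (c l).
  have b : `|(X l 0 i)%:~R : R| <= W%:R by rewrite -intr_norm -[W%:R]/(W%:Z%:~R) ler_int.
  rewrite -[W%:R]mul1r; apply: ler_pM => //.
  rewrite intrD in f2; rewrite ger0_norm; lra.
rewrite !mxE; case/andP: rx => r0 r1.
apply: (@le_trans _ _ 1); last by rewrite ler1n.
rewrite normrM ger0_norm // eqxx /=; case: (_ == _) => /=.
  by rewrite normr1 mulr1 ltW.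
by rewrite normr0 mulr0.
Qed.

(* [m] representatives [r i] with [dot (r i) x = i / m], reduced modulo the lattice
   of the [X j], translate the given points of [x^perp] into disjoint places. *)
Lemma packing (T : finType) (A : {set T}) (f : T -> 'rV[int]_D.+1) m :
  isden x m -> (forall m', isden x m' -> (m <= m')%N) ->
  {in A &, injective f} -> {in A, forall t, dot (emb R (f t)) x = 0} ->
  {in A, forall t i, `|f t 0 i| <= W%:Z} ->
  (m * #|A| <= (2 * (D.+2 * W) + 1) ^ D)%N.
Proof.
move=> mden mmin fi f0 fb.
have [m0 mint] := isdenP _ _ mden.
have xmax : x ord_max 0 = 1 by exact: normal_max.
have [r0 r0E] := bezout_normal xmax mden mmin.
have mR : (0 : R) < m%:R by rewrite ltr0n.
have /choice[r rP] : forall i : 'I_m, exists r : 'rV[int]_D.+1,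
    m%:R * dot (emb R r) x = i%:R /\ forall k, `|r 0 k| <= (D.+1 * W)%N%:Z.
  move=> i; have h : m%:R * dot (emb R (r0 *+ i)) x = i%:R.
    by rewrite embMn dotZl mulrCA r0E mulr1.
  have [|r [e b]] := @reduce_rep (r0 *+ i).
    rewrite -(pmulr_rge0 _ mR) h ler0n /= -(ltr_pM2l mR) h mulr1 ltr_nat; exact: ltn_ord.
  by exists r; rewrite e.
rewrite mulnC -{1}(card_ord m) -cardsT -cardsX.
apply: (@card_box _ _ _ _ (fun ti k => (f ti.1 + r ti.2) 0 (wd k))).
  move=> [t i] [t' i']; rewrite !finset.inE /= !andbT => tA t'A e.
  pose z := (f t + r i - (f t' + r i')) 0 ord_max.
  have dE : dot (emb R (f t + r i - (f t' + r i'))) x = z%:~R.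
    rewrite dotE big_ord_recr /= big1 ?add0r; first by rewrite xmax mulr1 embE.
    move=> k _; rewrite embE; have := e k.
    by move=> ek; rewrite !mxE in ek *; rewrite ek subrr mul0r.
  have : m%:R * z%:~R = i%:R - i'%:R :> R.
    by rewrite -dE embB !embD dotBl !dotDl !f0 // !add0r mulrBr !(rP _).1.
  (* The points are compared without their last coordinate, which gives the exponent [D]. Their
     difference has value [z] with m z = i - i' and |i - i'| < m, so [z] is 0. *)
  have z0 : z = 0.
    have iz : (m%:Z * z)%R = i%:Z - i'%:Z.
      apply: (@intr_inj R); rewrite intrM intrD intrN.
      by rewrite -dE embB !embD dotBl !dotDl !f0 // !add0r mulrBr !(rP _).1.
    have := ltn_ord i; have := ltn_ord i'; nia.
  rewrite z0 mulr0 => /esym/eqP; rewrite subr_eq0 eqr_nat => /eqP/val_inj ii'.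
  have ff : f t + r i - (f t' + r i') = 0.
    apply: (@emb_inj R); apply/rowP => k; rewrite emb0 embE [RHS]mxE.
    case: (ord_wd k) => [->|[j ->]]; first by rewrite -/z z0.
    by have ek := e j; rewrite !mxE in ek *; rewrite ek subrr.
  move: ff; rewrite ii' => /eqP; rewrite subr_eq0 => /eqP/addIr ff.
  by congr (_, _); exact: fi.
move=> [t i]; rewrite !finset.inE /= andbT => tA k; rewrite mxE.
have h1 := fb t tA (wd k); have h2 := (rP i).2 (wd k).
by rewrite mulSn PoszD (le_trans (ler_normD _ _)) // lerD.
Qed.

End Packing.

Lemma PoszMn (x n : nat) : x%:Z *+ n = (x * n)%N%:Z.
Proof. by rewrite -mulr_natr natz PoszM. Qed.

(** * Explicit dominant vectors and the number of distinct normals *)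

Section Hyperplanes.
Variables (R : realType) (D L : nat).
Local Notation wd := (widen_ord (leqnSn D)).
Local Notation Y := {ffun 'I_D.+1 -> 'I_L}.
Implicit Types (y : Y) (j : 'I_D).

(** Adding twice the coordinate sum at position [wd j] forces dominance there. The vector stays
    linear in the shifted coordinates [(y i).+1], so parallel vectors come from proportional
    coordinates. *)
Definition gen j y : 'rV[int]_D.+1 :=
  \row_i ((y i).+1 + (i == wd j) * (2 * \sum_l (y l).+1))%N%:Z.

Definition genW := ((2 * D + 3) * L)%N.

Lemma gen_gt0 j y i : 0 < gen j y 0 i.
Proof. by rewrite mxE; lia. Qed.

Lemma gen_le j y i : gen j y 0 i <= genW%:Z.
Proof.
rewrite mxE lez_nat /genW.
have h : (\sum_l (y l).+1 <= D.+1 * L)%N.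
  apply: (@leq_trans (\sum_(l < D.+1) L)); last by rewrite sum_nat_const card_ord.
  by apply: leq_sum => l _; exact: ltn_ord.
by have := ltn_ord (y i); case: (_ == _); lia.
Qed.

Lemma gen_bnd j y i : `|gen j y 0 i| <= genW%:Z.
Proof. by rewrite gtr0_norm ?gen_gt0 // gen_le. Qed.

Lemma sum_split_wd (F : 'I_D.+1 -> nat) j :
  (\sum_l F l = F (wd j) + \sum_(l | l != wd j) F l)%N.
Proof. by rewrite (bigD1 (wd j)). Qed.

Lemma gen_dom j y : dominant (wd j) (emb R (gen j y)).
Proof.
rewrite /dominant (eq_bigr (fun i => ((y i).+1%:R : R))); last first.
  by move=> i ne; rewrite !mxE (negbTE ne) mul0n addn0 -[_%:~R]/((y i).+1%:R) normr_nat.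
rewrite -natr_sum embE mxE eqxx mul1n -[_%:~R]/(_%:R) ltr_nat.
rewrite (sum_split_wd (fun l => (y l).+1) j) /=; set s := (bigop _ _ _); lia.
Qed.

Lemma gen_scale j y y' (a b : nat) : gen j y *+ a = gen j y' *+ b ->
  forall i, ((y i).+1 * a = (y' i).+1 * b)%N.
Proof.
move=> /rowP e.
have h i : i != wd j -> ((y i).+1 * a = (y' i).+1 * b)%N.
  move=> ne; have := e i; rewrite !mulmxnE !mxE (negbTE ne) !mul0n !addn0.
  by rewrite !PoszMn => -[].
move=> i; have [->|] := eqVneq i (wd j); last exact: h.
have := e (wd j); rewrite !mulmxnE !mxE eqxx !mul1n !PoszMn => -[].
rewrite (sum_split_wd (fun l => (y l).+1) j) (sum_split_wd (fun l => (y' l).+1) j) /=.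
have : (a * (\sum_(l | l != wd j) (y l).+1) = b * (\sum_(l | l != wd j) (y' l).+1))%N.
  by rewrite !big_distrr /=; apply: eq_bigr => l /h; rewrite mulnC [in RHS]mulnC.
set s := (bigop _ _ _); set s' := (bigop _ _ _).
move: (y (wd j) : nat) (y' (wd j) : nat) s s' => t t' s s' hs; lia.
Qed.

Lemma gen_inj j : injective (gen j).
Proof.
move=> y y' e; apply/ffunP => i; apply: val_inj.
have := @gen_scale j y y' 1 1; rewrite !mulr1n => /(_ e i); rewrite !muln1 => -[] //.
Qed.

(** Coprimality of two fixed coordinates already makes the shifted vector primitive, so distinct
    elements give non-parallel vectors. *)
Definition cop : {set Y} := [set y : Y | coprime (y ord0).+1 (y ord_max).+1].

Lemma cop_parallel j y y' (a b : nat) : (0 < a)%N -> (0 < b)%N ->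
  y \in cop -> y' \in cop -> gen j y *+ a = gen j y' *+ b -> y = y'.
Proof.
move=> a0 b0; rewrite !finset.inE => /eqP c1 /eqP c2 /gen_scale e.
have ab : a = b.
  have := muln_gcdl (y ord0).+1 (y ord_max).+1 a.
  by rewrite c1 !e -muln_gcdl c2 !mul1n.
apply/ffunP => i; apply: val_inj; have /eqP := e i.
by rewrite ab eqn_pmul2r // => /eqP[].
Qed.

(** From s = 3 on, 1/s^2 is at most 1/(s-1) - 1/s; with the first term 1/4 the total stays below
    3/4, which leaves the proportion 1/4 to coprime pairs. *)
Lemma sum_inv_sq m : \sum_(2 <= s < m.+3) ((s ^ 2)%:R : R)^-1 <= 3 / 4 - (m.+2%:R)^-1.
Proof.
elim: m => [|m IH]; first by rewrite big_nat1; lra.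
rewrite big_nat_recr //=; apply: le_trans (lerD IH (lexx _)) _.
rewrite -lerBrDl.
rewrite natrX -[m.+3%:R]natr1; move: (m.+2%:R) (ltr0Sn R m.+1) => x x0.
have x1 : 0 < x + 1 by rewrite addr_gt0.
have -> : 3 / 4 - (x + 1)^-1 - (3 / 4 - x^-1) = (x * (x + 1))^-1.
  by field; rewrite !gt_eqF.
rewrite expr2 lef_pV2 ?posrE ?mulr_gt0 // ler_pM2r //; lra.
Qed.

Lemma card_dvd_ord s : (0 < s)%N -> (#|[set a : 'I_L | (s %| a.+1)%N]%SET| * s <= L)%N.
Proof.
move=> s0; set A := finset _.
have -> : (#|A| * s = #|finset.setX (finset.setTfor 'I_s) A|)%N.
  by rewrite cardsX cardsT card_ord mulnC.
(* Each multiple of [s] owns the block of [s] integers that ends at it, and the blocks are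
   disjoint. *)
pose f (p : 'I_s * 'I_L) := (p.2 - p.1)%N.
have lt (p : 'I_s * 'I_L) : (f p < L)%N by rewrite /f (leq_ltn_trans (leq_subr _ _)).
rewrite -[L in (_ <= L)%N]card_ord.
apply: (@leq_card_in _ _ (fun p => Ordinal (lt p))).
move=> [i a] [i' a']; rewrite !finset.inE /= => /dvdnP[q qE] /dvdnP[q' qE'] [].
rewrite /f /= => e.
have hi := ltn_ord i; have hi' := ltn_ord i'.
have q0 : (0 < q)%N by case: q qE.
have q0' : (0 < q')%N by case: q' qE'.
have ia : (i <= a)%N by nia.
have ia' : (i' <= a')%N by nia.
have qq : q = q' by nia.
congr (_, _); apply: val_inj; rewrite /=; nia.
Qed.

(** Union bound over common divisors s >= 2 of the two coordinates, each having density at most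
    1/s^2. *)
Lemma card_cop : (0 < D)%N -> (0 < L)%N -> (L ^ D.+1 <= 4 * #|cop|)%N.
Proof.
move=> D0 L0.
have om : ord0 != ord_max :> 'I_D.+1 by rewrite -val_eqE /=; lia.
pose bad s : {set Y} := [set y : Y | (s %| (y ord0).+1)%N && (s %| (y ord_max).+1)%N]%SET.
have badc s : (0 < s)%N -> (#|bad s|%:R : R) <= L%:R ^+ D.+1 * ((s ^ 2)%:R)^-1.
  move=> s0; have sR : (0 : R) < (s ^ 2)%:R by rewrite ltr0n expn_gt0 s0.
  rewrite ler_pdivlMr // -natrX -natrM ler_nat.
  pose B i : {set 'I_L} := if (i == ord0) || (i == ord_max :> 'I_D.+1) then
    [set a : 'I_L | (s %| a.+1)%N]%SET else finset.setTfor _.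
  have -> : #|bad s| = #|family (fun i => mem (B i))|.
    apply: eq_card => y; rewrite finset.inE; apply/andP/familyP => [[h1 h2] i|h].
      rewrite /B; case: (eqVneq i ord0) => [->|_] /=; first by rewrite inE /= ?finset.inE.
      by case: (eqVneq i ord_max) => [->|_] /=; rewrite inE /= ?finset.inE.
    have := h ord0; have := h ord_max; rewrite /B !eqxx orbT /= !inE /= ?finset.inE.
    by [].
  have -> : #|family (fun i => mem (B i))| = (\prod_i #|B i|)%N.
    by rewrite card_family foldrE big_map big_enum; apply: eq_bigr => i _; exact: eq_card.
  rewrite (bigD1 ord0) //= (bigD1 ord_max) ?(eq_sym ord_max) //=.
  rewrite {1 2}/B !eqxx orbT /= (eq_bigr (fun _ => L)); last first.
    by move=> i /andP[/negbTE h1 /negbTE h2]; rewrite /B h1 h2 /= cardsT card_ord.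
  have -> : \prod_(i < D.+1 | (i != ord0) && (i != ord_max)) L = (L ^ D.-1)%N.
    rewrite prod_nat_const; congr (_ ^ _)%N.
    have := cardsC [set ord0; ord_max : 'I_D.+1]%SET; rewrite cards2 om card_ord.
    have -> : #|~: [set ord0; ord_max : 'I_D.+1]%SET| =
        #|(fun i : 'I_D.+1 => (i != ord0) && (i != ord_max))|.
      by apply: eq_card => i; rewrite !finset.inE negb_or.
    by move: #|_| => c; lia.
  have := card_dvd_ord s0; set c := #|_| => h.
  rewrite (_ : L ^ D.+1 = L * L * L ^ D.-1)%N; last by rewrite -mulnA -!expnS prednK.
  have h2 : (c * s * (c * s) <= L * L)%N by exact: leq_mul.
  have -> : (c * (c * L ^ D.-1) * s ^ 2 = c * s * (c * s) * L ^ D.-1)%N by rewrite -mulnn; ring.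
  by rewrite leq_mul2r h2 orbT.
have sub : (L ^ D.+1 <= #|cop| + \sum_(2 <= s < L.+1) #|bad s|)%N.
  have -> : (L ^ D.+1)%N = #|{: Y}| by rewrite card_ffun !card_ord.
  rewrite -cardsT -(finset.setUCr cop).
  apply: leq_trans (leq_card_setU _ _) _; rewrite leq_add2l.
  have : ~: cop \subset \bigcup_(s < L.+1 | (2 <= s)%N) bad s.
    apply/fintype.subsetP => y; rewrite !finset.inE /coprime => ne.
    have g0 : (0 < gcdn (y ord0).+1 (y ord_max).+1)%N by rewrite gcdn_gt0.
    have gL : (gcdn (y ord0).+1 (y ord_max).+1 < L.+1)%N.
      rewrite ltnS (leq_trans (dvdn_leq _ (dvdn_gcdl _ _))) //; exact: ltn_ord.
    apply/finset.bigcupP; exists (Ordinal gL) => /=.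
      by rewrite ltn_neqAle eq_sym ne g0.
    by rewrite finset.inE /= dvdn_gcdl dvdn_gcdr.
  move=> /subset_leq_card le; apply: leq_trans le _.
  rewrite -[X in (_ <= X)%N]/(\sum_(2 <= s < L.+1) #|bad s|)%N big_geq_mkord.
  elim/big_rec2: _ => [|i m A _ h]; first by rewrite cards0.
  by apply: leq_trans (leq_card_setU _ _) _; rewrite leq_add2l.
have : (L%:R ^+ D.+1 : R) <= #|cop|%:R + \sum_(2 <= s < L.+1) L%:R ^+ D.+1 * ((s ^ 2)%:R)^-1.
  rewrite -natrX; apply: (@le_trans _ _ (#|cop| + \sum_(2 <= s < L.+1) #|bad s|)%N%:R).
    by rewrite ler_nat.
  rewrite natrD natr_sum lerD2l natrX; apply: ler_sum_nat => s /andP[s2 _].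
  by apply: badc; lia.
rewrite -mulr_sumr.
have hs : \sum_(2 <= s < L.+1) ((s ^ 2)%:R : R)^-1 <= 3 / 4.
  case: L L0 => // -[|m] _; first by rewrite big_geq //; lra.
  apply: le_trans (sum_inv_sq m) _; rewrite gerBl invr_ge0; exact: ler0n.
have hL : (0 : R) <= L%:R ^+ D.+1 by rewrite exprn_ge0.
move=> h; rewrite -(ler_nat R) natrX natrM; nra.
Qed.

Local Notation Tup := {ffun 'I_D -> Y}.
Implicit Types tau : Tup.

Definition nrm tau : 'cV[R]_D.+1 := normal (fun j => emb R (gen j (tau j))).

(** Cramer's rule: the determinant of the integer matrix clears the denominators of its inverse. *)
Lemma ex_den tau : exists m, isden (nrm tau) m.
Proof.
pose Zm : 'M[int]_D.+1 :=
  \matrix_i (if insub (i : nat) is Some j then gen j (tau j) else delta_mx 0 ord_max).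
have e : fullmx (fun j => emb R (gen j (tau j))) = map_mx intr Zm.
  apply/matrixP => i k; rewrite !mxE; case: insubP => [j _ _|_]; first by rewrite mxE.
  by rewrite !mxE; case: (_ && _).
have u := fullmx_unit (fun j => gen_dom j (tau j)).
have nz : \det Zm != 0.
  by move: u; rewrite e unitmxE det_map_mx unitfE intr_eq0.
exists (absz (\det Zm)); apply/isdenP; split; first by rewrite absz_gt0.
move=> i; rewrite natr_absz intr_norm.
suff h : (\det Zm)%:~R * nrm tau i 0 \is a Num.int.
  by case: ger0P => _ //; rewrite mulNr rpredN.
rewrite /nrm /normal mxE /invmx u mxE e det_map_mx -map_mx_adj mulrA.
by rewrite mulfV ?intr_eq0 // mul1r mxE intr_int.
Qed.

Definition den tau : nat := ex_minn (ex_den tau).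

Lemma den_is tau : isden (nrm tau) (den tau).
Proof. by rewrite /den; case: ex_minnP. Qed.

Lemma den_min tau m : isden (nrm tau) m -> (den tau <= m)%N.
Proof. by move=> h; rewrite /den; case: ex_minnP => m' _; exact. Qed.

Definition packQ := ((2 * (D.+2 * genW) + 1) ^ D)%N.

(** Every entry of a tuple with this normal lies on one hyperplane, which by packing holds at most
    [packQ / den tau] of the points [gen j y]. *)
Lemma den_fiber tau : (0 < L)%N ->
  (den tau ^ D * #|[set t : Tup | nrm t == nrm tau]%SET| <= packQ ^ D)%N.
Proof.
move=> L0; pose A j : {set Y} := [set y : Y | dot (emb R (gen j y)) (nrm tau) == 0]%SET.
have hA j : (den tau * #|A j| <= packQ)%N.
  apply: (@packing R D (fun j => gen j (tau j)) genW _ _ _ _ (A j) (gen j)).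
  - by move=> i; exact: gen_dom.
  - by move=> i k; exact: gen_bnd.
  - by rewrite /genW muln_gt0 L0 andbT; lia.
  - exact: den_is.
  - exact: den_min.
  - by move=> y y' _ _; exact: gen_inj.
  - by move=> y; rewrite finset.inE => /eqP.
  - by move=> y _ k; exact: gen_bnd.
have sub : [set t : Tup | nrm t == nrm tau]%SET \subset family (fun j => mem (A j)).
  apply/fintype.subsetP => t; rewrite finset.inE => /eqP e; apply/familyP => j.
  rewrite inE /= ?finset.inE -e; apply/eqP.
  exact: (normal_dot (fun j => gen_dom j (t j))).
apply: (@leq_trans (den tau ^ D * \prod_j #|A j|)).
  rewrite leq_mul2l (leq_trans (subset_leq_card sub)) ?orbT //.
  by rewrite card_family foldrE big_map big_enum.
rewrite -{1}[D]card_ord -prod_nat_const -big_split /= -[X in (_ <= _ ^ X)%N]card_ord.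
by rewrite -prod_nat_const; apply: leq_prod.
Qed.

(** Normals of denominator m number at most (2m+1)^D, hence at most (3m)^D, and each carries at most
    (packQ/m)^D tuples: the powers of m cancel. *)
Lemma card_den m : (0 < L)%N -> (0 < m)%N ->
  (#|[set t : Tup | den t == m]%SET| <= (3 * packQ) ^ D)%N.
Proof.
move=> L0 m0; set S := finset _.
have int_of t i : exists z : int, t \in S -> m%:R * nrm t i 0 = z%:~R.
  have [tS|_] := boolP (t \in S); last by exists 0.
  have /isdenP[_ h] := den_is t; move: tS; rewrite finset.inE => /eqP e.
  by have /intrP[z hz] := h i; exists z; rewrite -e.
have /choice[z hz] : forall p : Tup * 'I_D.+1, exists z : int,
    p.1 \in S -> m%:R * nrm p.1 p.2 0 = z%:~R by move=> [t i]; exact: int_of.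
have mR : (0 : R) < m%:R by rewrite ltr0n.
have zb t i : t \in S -> `|z (t, i)| <= m%:Z.
  move=> tS; rewrite -(ler_int R) intr_norm -(hz (t, i) tS) normrM normr_nat.
  by rewrite ger_pMr //; exact: (normal_le1 (fun j => gen_dom j (t j))).
pose code t := [ffun i : 'I_D => inord (absz (z (t, wd i) + m%:Z)) : 'I_(2 * m).+1].
have codeP t t' : t \in S -> t' \in S -> code t = code t' -> nrm t = nrm t'.
  move=> tS t'S /ffunP e; apply/colP => i.
  case: (ord_wd i) => [->|[j ->]].
    by rewrite !(normal_max (fun j => gen_dom j (_ j))).
  have h1 := zb t (wd j) tS; have h2 := zb t' (wd j) t'S.
  have zz : z (t, wd j) = z (t', wd j).
    have := e j; rewrite !ffunE => /(congr1 val); move: h1 h2.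
    move: (z (t, wd j)) (z (t', wd j)) => a b h1 h2 /=; rewrite !inordK; lia.
  by apply: (mulfI (lt0r_neq0 mR)); rewrite (hz (t, wd j) tS) (hz (t', wd j) t'S) zz.
have -> : #|S| = (\sum_(c : {ffun 'I_D -> 'I_(2 * m).+1}) #|[set t in S | code t == c]%SET|)%N.
  rewrite -sum1_card (partition_big code xpredT) //=; apply: eq_bigr => c _.
  by rewrite -sum1_card; apply: eq_bigl => t; rewrite finset.inE.
rewrite -(@leq_pmul2l (m ^ D)) ?expn_gt0 ?m0 // big_distrr /=.
apply: (@leq_trans (\sum_(c : {ffun 'I_D -> 'I_(2 * m).+1}) packQ ^ D)).
  apply: leq_sum => c _; set F := finset _.
  have [->|/finset.set0Pn[t0]] := eqVneq F finset.set0; first by rewrite cards0 muln0.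
  rewrite finset.inE => /andP[t0S /eqP c0].
  apply: leq_trans (den_fiber t0 L0).
  move: (t0S); rewrite finset.inE => /eqP ->; rewrite leq_mul2l subset_leq_card ?orbT //.
  apply/fintype.subsetP => t; rewrite !finset.inE => /andP[tS /eqP tc].
  by apply/eqP; apply: codeP; [rewrite finset.inE|exact: t0S|rewrite tc c0].
rewrite sum_nat_const card_ffun !card_ord expnMn mulnA leq_mul2r -expnMn.
by apply/orP; right; case: (posnP D) => [->//|D0]; rewrite leq_exp2r //; lia.
Qed.

Lemma card_reps (T : finType) (U : eqType) (f : T -> U) (S : {set T}) :
  exists G : {set T}, [/\ G \subset S, {in G &, injective f} &
    forall c b, (forall t, t \in S -> c * #|[set t' in S | f t' == f t]%SET| <= b)%N ->
      (c * #|S| <= #|G| * b)%N].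
Proof.
pose rep t := odflt t [pick t' in S | f t' == f t].
have repP t : t \in S -> rep t \in S /\ f (rep t) = f t.
  move=> tS; rewrite /rep; case: pickP => [t' /andP[h1 /eqP h2]|/(_ t)].
    by [].
  by rewrite /= tS eqxx.
have repE t t' : t \in S -> t' \in S -> f t = f t' -> rep t = rep t'.
  move=> tS t'S e; rewrite /rep e; case: pickP => // /(_ t').
  by rewrite t'S eqxx.
exists [set rep t | t in S]%SET; split.
- by apply/fintype.subsetP => t /imsetP[t' t'S ->]; case: (repP _ t'S).
- move=> t t' /imsetP[s sS ->] /imsetP[s' s'S ->].
  by rewrite (repP _ sS).2 (repP _ s'S).2; exact: repE.
- move=> c b h.
  have -> : #|S| = (\sum_(g in [set rep t | t in S]%SET) #|[set t in S | rep t == g]%SET|)%N.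
    rewrite -sum1_card (partition_big rep (mem [set rep t | t in S]%SET)) /=; last first.
      by move=> t tS; exact: imset_f.
    by apply: eq_bigr => g _; rewrite -sum1_card; apply: eq_bigl => t; rewrite finset.inE.
  rewrite big_distrr -sum_nat_const /=; apply: leq_sum => g /imsetP[t0 t0S ->].
  have [rS fr] := repP _ t0S; apply: leq_trans (h _ rS).
  rewrite leq_mul2l subset_leq_card ?orbT //; apply/fintype.subsetP => t.
  rewrite !finset.inE => /andP[tS /eqP e]; rewrite tS /= fr -(repP _ tS).2 e fr.
  by [].
Qed.

(* Normals with a small denominator carry few tuples altogether, and a normal with
   a large denominator carries few tuples. *)
Lemma many_normals (E : 'I_D -> {set Y}) (Delta : nat) : (0 < L)%N ->
  exists G : {set Tup}, [/\ {in G, forall (t : Tup) j, t j \in E j}, {in G &, injective nrm} &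
    (Delta.+1 ^ D * (\prod_j #|E j| - Delta * (3 * packQ) ^ D) <= #|G| * packQ ^ D)%N].
Proof.
move=> L0.
pose famE : {set Tup} := [set t in family (fun j => mem (E j))]%SET.
pose S : {set Tup} := [set t in famE | (Delta < den t)%N]%SET.
have [G [GS Gi Gc]] := card_reps nrm S.
exists G; split=> //.
  move=> t /(fintype.subsetP GS); rewrite !finset.inE => /andP[/familyP h _] j.
  exact: h.
apply: (@leq_trans (Delta.+1 ^ D * #|S|)); last first.
  apply: Gc => t; rewrite !finset.inE => /andP[_ dt].
  apply: leq_trans (den_fiber t L0).
  apply: leq_mul; first by case: (posnP D) => [->//|D0]; rewrite leq_exp2r.
  by apply: subset_leq_card; apply/fintype.subsetP => t'; rewrite !finset.inE => /andP[].
rewrite leq_mul2l; apply/orP; right; rewrite leq_subLR.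
have -> : (\prod_j #|E j|)%N = #|famE|.
  by rewrite cardsE card_family foldrE big_map big_enum.
have sub : famE \subset S :|: \bigcup_(m < Delta.+1 | (0 < m)%N) [set t : Tup | den t == m]%SET.
  apply/fintype.subsetP => t tE; rewrite finset.inE.
  have [h|h] := leqP (den t) Delta; last by rewrite finset.inE tE h.
  apply/orP; right; apply/finset.bigcupP; exists (Ordinal (h : (den t < Delta.+1)%N)) => /=.
    by have /isdenP[] := den_is t.
  by rewrite finset.inE.
apply: leq_trans (subset_leq_card sub) _.
apply: leq_trans (leq_card_setU _ _) _; rewrite addnC leq_add2r.
have le : (#|\bigcup_(m < Delta.+1 | (0 < m)%N) [set t : Tup | den t == m]%SET| <=
    \sum_(m < Delta.+1 | (0 < m)%N) (3 * packQ) ^ D)%N.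
  elim/big_rec2: _ => [|m c A m0 h]; first by rewrite cards0.
  by apply: leq_trans (leq_card_setU _ _) _; apply: leq_add => //; exact: card_den.
apply: leq_trans le _; rewrite big_mkcond big_ord_recl /= add0n sum_nat_const card_ord.
by [].
Qed.

End Hyperplanes.

(** * Basic solutions and counts of multiplicity functions *)

Section BasicSolution.
Variables (R : realType) (q m : nat) (v : 'I_q -> 'rV[R]_m).
Implicit Type x : 'I_q -> R.

Definition fracs x : {set 'I_q} := [set i | 0 < x i < 1].

(** More than [m] vectors of an [m]-dimensional space are dependent; [x] moves along a relation
    among the fractional coordinates until one of them becomes integral. *)
Lemma basic_step x : (forall i, 0 <= x i <= 1) -> (m < #|fracs x|)%N ->
  exists x', [/\ forall i, 0 <= x' i <= 1, \sum_i x' i *: v i = \sum_i x i *: v i &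
    (#|fracs x'| < #|fracs x|)%N].
Proof.
move=> x01 mF; pose F := fracs x.
pose M : 'M[R]_(#|F|, m) := \matrix_k v (enum_val k).
have /rowV0Pn[y /sub_kermxP yM y0] : kermx M != 0.
  rewrite -mxrank_eq0 mxrank_ker -lt0n subn_gt0; exact: leq_ltn_trans (rank_leq_col _) mF.
pose z i := \sum_(k | enum_val k == i) y 0 k.
have zE k : z (enum_val k) = y 0 k.
  rewrite /z (bigD1 k) //= big1 ?addr0 // => l /andP[/eqP/enum_val_inj -> ].
  by rewrite eqxx.
have zF i : i \notin F -> z i = 0.
  move=> iF; rewrite /z big_pred0 // => k; apply/negP => /eqP e.
  by move: iF; rewrite -e enum_valP.
have zv : \sum_i z i *: v i = 0.
  transitivity (\sum_k y 0 k *: v (enum_val k)).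
    rewrite [RHS](partition_big (@enum_val _ (mem F)) xpredT) //=; apply: eq_bigr => i _.
    by rewrite /z scaler_suml; apply: eq_big => [k|k /eqP ->].
  transitivity (y *m M); last exact: yM.
  by rewrite mulmx_sum_row; apply: eq_bigr => k _; rewrite rowK.
have [k0 yk0] : exists k, y 0 k != 0.
  apply/existsP; apply: contra_neqT y0 => /existsPn h; apply/rowP => k; rewrite mxE.
  by apply/eqP; have := h k; rewrite negbK.
(* The time at which coordinate [i] reaches the wall, 0 or 1, towards which it moves. The smallest
   such time keeps all coordinates in [0,1]. *)
pose tt i := if 0 < z i then (1 - x i) / z i else - x i / z i.
have zk0 : z (enum_val k0) != 0 by rewrite zE.
have [i0 zi0 tmin] := @arg_minP _ R 'I_q (enum_val k0) (fun i => z i != 0) tt zk0.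
have tpos i : z i != 0 -> 0 < tt i.
  move=> zi; have : i \in F by apply: contraT => /zF; move/eqP: zi.
  rewrite finset.inE => /andP[xi0 xi1]; rewrite /tt; case: (ltgtP (z i) 0) zi => // s _.
    by rewrite -mulrNN opprK -invrN divr_gt0 // oppr_gt0.
  by rewrite divr_gt0 // subr_gt0.
pose t := tt i0; have t0 : 0 < t by exact: tpos.
pose x' i := x i + t * z i.
have x'F i : i \notin F -> x' i = x i by move=> iF; rewrite /x' zF // mulr0 addr0.
have x'01 i : 0 <= x' i <= 1.
  case: (eqVneq (z i) 0) => [zi|zi]; first by rewrite /x' zi mulr0 addr0.
  have := tmin i zi; rewrite -/t /tt /x'; case/andP: (x01 i) => xi0 xi1.
  case: (ltgtP (z i) 0) zi => // s _.
    rewrite -mulrNN opprK -invrN ler_pdivlMr ?oppr_gt0 // => h.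
    have : t * z i <= 0 by rewrite nmulr_lle0 // ltW.
    by move: h; rewrite mulrN; lra.
  rewrite ler_pdivlMr // => h; have : 0 <= t * z i by rewrite mulr_ge0 // ltW.
  lra.
exists x'; split=> //.
  under eq_bigr do rewrite /x' scalerDl -scalerA.
  by rewrite big_split /= -scaler_sumr zv scaler0 addr0.
have i0F : i0 \in F by apply: contraT => /zF e; rewrite e eqxx in zi0.
apply: proper_card; apply/properP; split.
  apply/fintype.subsetP => i; apply: contraTT => iF.
  by move: (iF); rewrite !finset.inE x'F.
exists i0 => //; rewrite finset.inE.
have : x' i0 = 0 \/ x' i0 = 1.
  rewrite /x' /t /tt; case: (ltgtP (z i0) 0) zi0 => // s _.
    by left; rewrite divfK ?lt_eqF // subrr.
  by right; rewrite divfK ?gt_eqF // addrC subrK.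
by case=> ->; rewrite ltxx ?andbF.
Qed.

Lemma basic_solution x0 : (forall i, 0 <= x0 i <= 1) ->
  exists x, [/\ forall i, 0 <= x i <= 1, \sum_i x i *: v i = \sum_i x0 i *: v i &
    (#|fracs x| <= m)%N].
Proof.
have [n] := ubnP #|fracs x0|; elim: n x0 => // n IH x0 hn x01.
have [le|lt] := leqP #|fracs x0| m; first by exists x0.
have [x1 [x11 e1 lt1]] := basic_step x01 lt.
have [|x [h1 h2 h3]] := IH x1 _ x11; first by rewrite (leq_trans lt1).
by exists x; split=> //; rewrite h2.
Qed.

End BasicSolution.

(** * Configurations of bounded mass on a set of generators *)

Section ConfCount.
Variables (R : realType) (I : finType) (b : nat).
Local Notation conf := {ffun I -> 'I_b.+1}.

Definition restr_conf (A : {set I}) (ell : I -> R) (M : R) : {set conf} :=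
  [set w : conf | [forall i, (i \in A) || (w i == ord0)] &&
     (\sum_i (w i)%:R * ell i <= M)].

Lemma geom_le (y : R) n : 0 <= y -> y < 1 -> \sum_(j < n) y ^+ j <= (1 - y)^-1.
Proof.
move=> y0 y1; have y1' : 0 < 1 - y by rewrite subr_gt0.
rewrite -[leRHS]mul1r ler_pdivlMr // mulrC -opprB mulNr -subrX1 opprB gerBl.
exact: exprn_ge0.
Qed.

(** Rankin's trick: each counted configuration has weight exp(t (M - mass)) >= 1, and the sum of all
    weights factors into geometric series, one for each generator in [A]. *)
Lemma restr_conf_count (A : {set I}) (ell : I -> R) (t M : R) :
  0 < t -> {in A, forall i, 0 < ell i} ->
  #|restr_conf A ell M|%:R <=
    expR (t * M + \sum_(i in A) (expR (t * ell i) - 1)^-1).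
Proof.
move=> t0 l0.
pose Q i : pred 'I_b.+1 := fun j => (i \in A) || (j == ord0).
pose y i := expR (- (t * ell i)).
have -> : #|restr_conf A ell M|%:R = \sum_(w in restr_conf A ell M) (1 : R).
  by rewrite sumr_const.
apply: (@le_trans _ _ (\sum_(w : conf | w \in family Q) expR (t * M) * \prod_i y i ^+ w i)).
  rewrite big_mkcond [leRHS]big_mkcond; apply: ler_sum => w _.
  rewrite finset.inE; have -> : (w \in family Q) = [forall i, (i \in A) || (w i == ord0)].
    by apply/familyP/forallP.
  case: (boolP [forall i, _]) => //= _; case: (leP (\sum_i _) M) => h; last first.
    by rewrite mulr_ge0 ?expR_ge0 //; apply: prodr_ge0 => i _; rewrite exprn_ge0 ?expR_ge0.
  have -> : \prod_i y i ^+ w i = expR (- (t * \sum_i (w i)%:R * ell i)).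
    rewrite mulr_sumr -sumrN expR_sum; apply: eq_bigr => i _.
    by rewrite /y -expRM_natl; congr expR; ring.
  by rewrite -expRD -[leLHS]expR0 ler_expR -mulrBr mulr_ge0 ?subr_ge0 // ltW.
rewrite -mulr_sumr expRD ler_pM2l ?expR_gt0 //.
have -> : \sum_(w : conf | w \in family Q) \prod_i y i ^+ w i =
    \prod_i \sum_(j < b.+1 | Q i j) y i ^+ j.
  by rewrite bigA_distr_big_dep.
rewrite expR_sum [leRHS]big_mkcond; apply: ler_prod => i _; apply/andP; split.
  by apply: sumr_ge0 => j _; rewrite exprn_ge0 ?expR_ge0.
rewrite /Q; case: (boolP (i \in A)) => iA /=; last by rewrite big_pred1_eq expr0.
have x0 : 0 < t * ell i by rewrite mulr_gt0 // l0.
have e1 : 1 < expR (t * ell i) by rewrite expR_gt1.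
have yE : y i = (expR (t * ell i))^-1 by rewrite /y expRN.
have y1 : y i < 1 by rewrite yE invf_lt1 ?expR_gt0.
apply: le_trans (@geom_le (y i) b.+1 (expR_ge0 _) y1) _.
(* With e = exp(t l), 1/(1 - 1/e) equals 1 + 1/(e - 1), at most the exponential of 1/(e - 1). *)
apply: le_trans (expR_ge1Dx _); rewrite yE; move: e1; move: (expR _) => e e1.
have e0 : 0 < e by lra.
have e2 : 0 < e - 1 by lra.
rewrite le_eqVlt; apply/orP; left; apply/eqP; field.
by rewrite !gt_eqF.
Qed.

End ConfCount.

(** * Sums of 1/(exp(t r) - 1) by layers of the radius *)

Section ClassSum.
Variables (R : realType).

Lemma abel_sum (h : nat -> R) (d m : nat) :
  \sum_(1 <= j < m.+1) (j%:R ^+ d) * (h j - h j.+1) + m%:R ^+ d * h m.+1 =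
  \sum_(1 <= j < m.+1) (j%:R ^+ d - j.-1%:R ^+ d) * h j + (0%N == d)%:R * h 1%N.
Proof.
elim: m => [|m IH].
  by rewrite !big_geq // !add0r expr0n eq_sym.
rewrite big_nat_recr //= [in RHS]big_nat_recr //= [RHS]addrAC -IH; ring.
Qed.

(** The decreasing [h] is written as a sum of its decrements; each decrement is weighted by a count,
    the counts are replaced by their bounds, and Abel summation puts [h] back. *)
Lemma layer_sum (I : finType) (X : {set I}) (r : I -> nat) (h : nat -> R) (al : R) d m :
  (0 < d)%N ->
  {in X, forall i, 0 < r i <= m}%N ->
  (forall j, (0 < j)%N -> h j.+1 <= h j) -> 0 <= h m.+1 ->
  (forall j, (0 < j)%N -> #|[set i in X | (r i <= j)%N]%SET|%:R <= al * j%:R ^+ d) ->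
  \sum_(i in X) h (r i) <= al * \sum_(1 <= j < m.+1) (j%:R ^+ d - j.-1%:R ^+ d) * h j.
Proof.
move=> d0 rX hdec hm cnt.
have hE i : i \in X -> h (r i) = \sum_(1 <= j < m.+1) (r i <= j)%N%:R * (h j - h j.+1) + h m.+1.
  move=> /rX/andP[r0 rm].
  rewrite (@big_cat_nat _ _ _ (r i)) //=; last by rewrite leqW.
  rewrite big_nat big1 ?add0r; last first.
    by move=> j /andP[_ jr]; rewrite leqNgt jr mul0r.
  rewrite (eq_big_nat _ _ (F2 := fun j => h j - h j.+1)); last first.
    by move=> j /andP[-> _]; rewrite mul1r.
  under eq_bigr do rewrite -opprB.
  by rewrite sumrN telescope_sumr ?leqW // opprB subrK.
rewrite (eq_bigr _ hE) big_split /= exchange_big /= sumr_const.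
have [m0|m0] := posnP m.
  have X0 : X = finset.set0.
    apply/finset.setP => i; rewrite finset.inE; apply/negP => /rX; rewrite m0.
    by case: (r i).
  by rewrite X0 cards0 mulr0n m0 !big_geq // mulr0 addr0.
apply: (@le_trans _ _ (\sum_(1 <= j < m.+1) al * j%:R ^+ d * (h j - h j.+1) +
    al * m%:R ^+ d * h m.+1)).
  apply: lerD.
    apply: ler_sum_nat => j /andP[j0 _]; rewrite -mulr_suml ler_wpM2r ?subr_ge0 ?hdec //.
    apply: le_trans (cnt j j0); rewrite -sumr_const.
    by rewrite big_mkcond [leRHS]big_mkcond; apply: ler_sum => i _; rewrite finset.inE; case: (_ \in X); case: (_ <= _)%N.
  rewrite -[leLHS]mulr_natl ler_wpM2r //; apply: le_trans (cnt m m0).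
  rewrite ler_nat subset_leq_card //; apply/fintype.subsetP => i iX.
  by rewrite finset.inE iX; case/andP: (rX i iX).
rewrite [X in X + _ <= _](eq_bigr (fun j => al * (j%:R ^+ d * (h j - h j.+1)))); last first.
  by move=> j _; rewrite mulrA.
rewrite -mulr_sumr -mulrA -mulrDr abel_sum (_ : (0%N == d) = false) ?mul0r ?addr0 //.
by rewrite eq_sym; apply/eqP => e; rewrite e in d0.
Qed.

(** The two terms come from cutting the sum near j = 1/t: below, 1/(exp x - 1) <= 1/x gives 2^D;
    above, the bound (D+2)!/x^(D+2) leaves a convergent sum of 1/j^2. *)
Definition sumC (D : nat) : R := D.+1%:R * (2 ^+ D + D.+2`!%:R).

Lemma subX_le (j D : nat) : (0 < j)%N ->
  (j%:R ^+ D.+1 - j.-1%:R ^+ D.+1 : R) <= D.+1%:R * j%:R ^+ D.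
Proof.
move=> j0; rewrite subrXX -natrB ?leq_pred // (_ : (j - j.-1)%N = 1%N); last by lia.
rewrite mul1r -[D.+1 in leRHS]card_ord mulr_natl -sumr_const; apply: ler_sum => i _.
have hi := ltn_ord i; have -> : (j%:R ^+ D : R) = j%:R ^+ (D - i) * j%:R ^+ i.
  by rewrite -exprD subnK.
apply: ler_wpM2l; first by rewrite exprn_ge0.
by rewrite lerXn2r ?nnegrE // ler_nat leq_pred.
Qed.

Lemma inv_sq_tail (J m : nat) : (0 < J)%N -> (J <= m)%N ->
  \sum_(J.+1 <= j < m.+1) (j%:R ^+ 2 : R)^-1 <= J%:R^-1 - m%:R^-1.
Proof.
move=> J0; elim: m => [|m IH]; first by case: J J0.
rewrite leq_eqVlt => /orP[/eqP ->|lt]; first by rewrite big_geq // subrr.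
rewrite big_nat_recr //=; apply: le_trans (lerD (IH lt) (lexx _)) _.
have m0 : (0 : R) < m%:R by rewrite ltr0n; lia.
rewrite -natr1; move: (m%:R) m0 => x x0; have x1 : 0 < x + 1 by lra.
suff : ((x + 1) ^+ 2)^-1 <= x^-1 - (x + 1)^-1 by lra.
have -> : x^-1 - (x + 1)^-1 = (x * (x + 1))^-1 by field; rewrite !gt_eqF.
by rewrite expr2 lef_pV2 ?posrE ?mulr_gt0 // ler_pM2r //; lra.
Qed.

Lemma bose_le (x : R) n : 0 < x -> (expR x - 1)^-1 <= n.+1`!%:R / x ^+ n.+1.
Proof.
move=> x0; have f0 : (0 : R) < n.+1`!%:R by rewrite ltr0n fact_gt0.
have := expR_ge1Dxn n (ltW x0) => h.
rewrite -[leRHS]invrK lef_pV2 ?posrE ?invf_div; last 2 first.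
- by rewrite subr_gt0 expR_gt1.
- by rewrite divr_gt0 ?exprn_gt0.
by rewrite lerBrDl.
Qed.

Lemma bose_sum (D m : nat) (t : R) : (0 < D)%N -> 0 < t <= 1 ->
  \sum_(1 <= j < m.+1) (j%:R ^+ D.+1 - j.-1%:R ^+ D.+1) * (expR (t * j%:R) - 1)^-1
  <= sumC D / t ^+ D.+1.
Proof.
move=> D0 /andP[t0 t1].
pose J := `|Num.ceil t^-1|%N.
have tV : 0 < t^-1 by rewrite invr_gt0.
have c0 : 0 <= Num.ceil t^-1.
  by rewrite -(ler_int R); apply: le_trans (ltW tV) _; exact: ceil_ge.
have JE : J%:R = (Num.ceil t^-1)%:~R :> R by rewrite /J natr_absz ger0_norm.
have J1 : t^-1 <= J%:R by rewrite JE; exact: ceil_ge.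
have J2 : J%:R <= 2 / t.
  have : J%:R < t^-1 + 1.
    by have /andP[h _] := ceil_itv t^-1; rewrite JE -ltrBlDr -[1]/(1%:~R) -intrB.
  have : 1 <= t^-1 by rewrite invf_ge1.
  by rewrite mulrC; lra.
have J0 : (0 < J)%N by rewrite -(ltr_nat R) (lt_le_trans tV).
have term j : (0 < j)%N ->
    (j%:R ^+ D.+1 - j.-1%:R ^+ D.+1) * (expR (t * j%:R) - 1)^-1 <=
      D.+1%:R * j%:R ^+ D * (expR (t * j%:R) - 1)^-1.
  move=> j0; apply: ler_wpM2r; last exact: subX_le.
  by rewrite invr_ge0 subr_ge0 -expR0 ler_expR mulr_ge0 // ltW.
have lo (m' : nat) : (m' <= J)%N -> \sum_(1 <= j < m'.+1)
    (j%:R ^+ D.+1 - j.-1%:R ^+ D.+1) * (expR (t * j%:R) - 1)^-1 <=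
    D.+1%:R * 2 ^+ D / t ^+ D.+1.
  move=> m'J; apply: (@le_trans _ _ (\sum_(1 <= j < m'.+1) D.+1%:R * J%:R ^+ D.-1 / t)).
    apply: ler_sum_nat => j /andP[j0 jm]; apply: le_trans (term j j0) _.
    have jR : (0 : R) < j%:R by rewrite ltr0n.
    have b := bose_le 0 (mulr_gt0 t0 jR).
    rewrite -!mulrA ler_wpM2l //.
    apply: le_trans (ler_wpM2l (exprn_ge0 _ (ltW jR)) b) _.
    rewrite (_ : 1`!%:R = 1 :> R) // expr1.
    rewrite (_ : j%:R ^+ D * _ = j%:R ^+ D.-1 / t); last first.
      rewrite -{1}(prednK D0) exprS; move: (j%:R ^+ D.-1) => a.
      by field; rewrite !gt_eqF.
    by rewrite (ler_wpM2r (ltW tV)) // lerXn2r ?nnegrE // ler_nat; lia.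
  rewrite sumr_const_nat subSS subn0 -[leLHS]mulr_natl.
  apply: (@le_trans _ _ (D.+1%:R * (J%:R ^+ D / t))).
    have -> : (J%:R ^+ D : R) = J%:R * J%:R ^+ D.-1 by rewrite -exprS prednK.
    rewrite -!mulrA mulrCA ler_wpM2l //.
    by rewrite ler_wpM2r ?ler_nat // mulr_ge0 ?exprn_ge0 //; exact: ltW.
  rewrite -!mulrA ler_wpM2l // exprS invfM [leLHS]mulrC mulrCA.
  rewrite (ler_wpM2l (ltW tV)) // -exprVn -exprMn lerXn2r ?nnegrE // mulr_ge0 //; exact: ltW.
have fac0 : 0 <= (D.+2`!%:R : R) by [].
have tD : 0 < t ^+ D.+1 by rewrite exprn_gt0.
have [mJ|Jm] := leqP m J.
  apply: le_trans (lo m mJ) _; rewrite ler_wpM2r ?invr_ge0 ?(ltW tD) // /sumC.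
  by rewrite ler_wpM2l // lerDl.
rewrite (@big_cat_nat _ _ _ J.+1) //=; last by rewrite ltnS ltnW.
rewrite /sumC mulrDr mulrDl; apply: lerD; first exact: lo.
apply: (@le_trans _ _ (\sum_(J.+1 <= j < m.+1)
    D.+1%:R * D.+2`!%:R / t ^+ D.+2 * (j%:R ^+ 2)^-1)).
  apply: ler_sum_nat => j /andP[j0 jm].
  have {}j0 : (0 < j)%N by lia.
  apply: le_trans (term j j0) _.
  have jR : (0 : R) < j%:R by rewrite ltr0n.
  have b := bose_le D.+1 (mulr_gt0 t0 jR).
  rewrite -!mulrA ler_wpM2l //.
  apply: le_trans (ler_wpM2l (exprn_ge0 _ (ltW jR)) b) _.
  rewrite le_eqVlt; apply/orP; left; apply/eqP.
  rewrite exprMn (_ : j%:R ^+ D.+2 = j%:R ^+ D * j%:R ^+ 2 :> R); last by rewrite -exprD addn2.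
  move: (j%:R ^+ D) (lt0r_neq0 (exprn_gt0 D jR)) => a a0.
  by field; rewrite a0 !gt_eqF // exprn_gt0.
rewrite -mulr_sumr.
apply: le_trans (ler_wpM2l _ (inv_sq_tail J0 (ltnW Jm))) _.
  by rewrite mulr_ge0 ?invr_ge0 ?exprn_ge0 // ltW.
apply: le_trans (ler_wpM2l _ (_ : _ <= t)) _.
- by rewrite mulr_ge0 ?invr_ge0 ?exprn_ge0 // ltW.
- apply: (@le_trans _ _ J%:R^-1); first by rewrite gerBl invr_ge0.
  by rewrite -[leRHS]invrK lef_pV2 ?posrE // ltr0n.
- rewrite exprSr; rewrite le_eqVlt; apply/orP; left; apply/eqP.
  by move: (t ^+ D.+1) tD => a a0; field; rewrite !gt_eqF.
Qed.

Lemma class_sum (I : finType) (X : {set I}) (r : I -> nat) (al t : R) D m :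
  (0 < D)%N -> 0 < t <= 1 -> 0 <= al ->
  {in X, forall i, 0 < r i <= m}%N ->
  (forall j, (0 < j)%N -> #|[set i in X | (r i <= j)%N]%SET|%:R <= al * j%:R ^+ D.+1) ->
  \sum_(i in X) (expR (t * (r i)%:R) - 1)^-1 <= al * (sumC D / t ^+ D.+1).
Proof.
move=> D0 t01 al0 rX cnt; have /andP[t0 _] := t01.
pose h j := (expR (t * j%:R) - 1)^-1.
have hp j : (0 < j)%N -> 0 < expR (t * j%:R) - 1.
  by move=> j0; rewrite subr_gt0 expR_gt1 mulr_gt0 // ltr0n.
apply: (@le_trans _ _ (al * \sum_(1 <= j < m.+1) (j%:R ^+ D.+1 - j.-1%:R ^+ D.+1) * h j)).
  apply: layer_sum => // [j j0|]; last by rewrite invr_ge0 ltW // hp.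
  rewrite lef_pV2 ?posrE ?hp // lerD2r ler_expR ler_pM2l // ler_nat //.
by rewrite ler_wpM2l // bose_sum.
Qed.

End ClassSum.

(** * Pointed cones *)

Section Cone.
Variables (R : realType) (d : nat) (C : set 'rV[R]_d).
Local Notation V := 'rV[R]_d.
Hypothesis C_cone : convex_cone C.

Lemma coneZ (t : R) x : 0 <= t -> C x -> C (t *: x).
Proof. by case: C_cone => _ _; apply. Qed.

Lemma cone0 : C 0.
Proof. by case: C_cone => -[x Cx] _ _; rewrite -(scale0r x); exact: coneZ. Qed.

Lemma coneD x y : C x -> C y -> C (x + y).
Proof.
move=> Cx Cy; case: C_cone => _ Cc _.
have h0 : 0 <= (2^-1 : R) by lra.
have h1 : (2^-1 : R) <= 1 by lra.
have := Cc x y (Itv01 h0 h1); rewrite !inE => /(_ Cx Cy) h.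
rewrite -[x + y]scale1r -(@divff R 2) // -scalerA; apply: coneZ => //.
move: h; rewrite /conv /=.
rewrite /unstable.onem (_ : 1 - 2^-1 = 2^-1 :> R); last by lra.
by rewrite -scalerDr.
Qed.

Lemma cone_sum (I : Type) (r : seq I) (P : pred I) (F : I -> V) :
  (forall i, P i -> C (F i)) -> C (\sum_(i <- r | P i) F i).
Proof.
by move=> h; elim/big_rec: _ => [|i x Pi Cx]; [exact: cone0|exact: coneD (h _ Pi) Cx].
Qed.

Hypothesis C_closed : closed C.
Hypothesis C_pointed : ~ contains_line C.

Lemma cone_pointed x : C x -> C (- x) -> x = 0.
Proof.
move=> Cx CNx; apply: contrapT => /eqP x0; apply: C_pointed; exists 0, x; split=> // t.
rewrite add0r; have [t0|t0] := leP 0 t; first exact: coneZ.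
by rewrite -[t *: x]opprK -scalerN -scaleNr; apply: coneZ; rewrite ?oppr_ge0 // ltW.
Qed.

Definition sqn (x : V) : R := \sum_i x 0 i ^+ 2.

Lemma norm_coord (x : V) i : `|x 0 i| <= `|x|.
Proof.
by rewrite [leRHS]/Num.Def.normr /= mx_normrE; apply/bigmax_geP; right => /=; exists (0, i).
Qed.

Lemma norm_le_coord (x : V) (r : R) : 0 <= r -> (forall i, `|x 0 i| <= r) -> `|x| <= r.
Proof.
move=> r0 h; rewrite [leLHS]/Num.Def.normr /= mx_normrE; apply/bigmax_leP; split=> // -[i j] _ /=.
by rewrite (ord1 i).
Qed.

Lemma continuous_sqn (a : V) : continuous (fun y : V => sqn (y + a)).
Proof.
rewrite /sqn => y; rewrite (_ : (fun y => _) = \sum_i (fun y : V => (y + a) 0 i ^+ 2)); last first.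
  by apply/funext => z; rewrite fct_sumE.
elim/big_rec: _ => [|i f _ cf]; first exact: cst_continuous.
apply: continuousD => //.
rewrite (_ : (fun y => _) = (fun y : V => (y 0 i + a 0 i)) \* (fun y : V => (y 0 i + a 0 i))); last first.
  by apply/funext => z; rewrite /= mxE.
have c : {for y, continuous (fun y : V => y 0 i + a 0 i)}.
  by apply: continuousD; [exact: coord_continuous|exact: cst_continuous].
exact: continuousM.
Qed.

Lemma continuous_dot (u : 'cV[R]_d) : continuous (fun y : V => dot y u).
Proof.
move=> y; rewrite (_ : (fun y => _) = \sum_i (fun y : V => y 0 i * u i 0)); last first.
  by apply/funext => z; rewrite fct_sumE dotE.
elim/big_rec: _ => [|i f _ cf]; first exact: cst_continuous.
apply: continuousD => //; apply: continuousM; first exact: coord_continuous.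
exact: cst_continuous.
Qed.

Lemma quad_ge0 (a b : R) : 0 <= b ->
  (forall s, 0 < s <= 1 -> 0 <= 2 * s * a + s ^+ 2 * b) -> 0 <= a.
Proof.
move=> b0 h; rewrite leNgt; apply/negP => a0.
have ba : 0 < b - a by lra.
(* For this [s] the factor 2 a + s b is below a, hence negative. *)
pose s := - a / (b - a).
have s0 : 0 < s by rewrite divr_gt0 // oppr_gt0.
have s1 : s <= 1 by rewrite ler_pdivrMr //; lra.
have := h s; rewrite s0 s1 => /(_ isT).
have sba : s * (b - a) = - a by rewrite divfK // gt_eqF.
nra.
Qed.

Lemma sqnD (x y : V) (s : R) :
  sqn (x + s *: y) = sqn x + 2 * s * dot y x^T + s ^+ 2 * sqn y.
Proof.
rewrite /sqn dotE !mulr_sumr -!big_split /=; apply: eq_bigr => i _; rewrite !mxE; ring.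
Qed.

Lemma sqn_ge0 x : 0 <= sqn x.
Proof. by apply: sumr_ge0 => i _; rewrite sqr_ge0. Qed.

(* Separation of [- x] from [C], by the point of [C] nearest to [- x]. *)
Lemma cone_separate x : C x -> x != 0 ->
  exists2 u : 'cV[R]_d, (forall y, C y -> 0 <= dot y u) & 0 < dot x u.
Proof.
move=> Cx x0.
(* Radius beyond which no point can compete with 0: a point [y] of larger sup norm has a coordinate
   of [y + x] of modulus at least d |x|, which exceeds the Euclidean norm of [x]. The minimum over
   the compact [A] is thus global on [C]. *)
pose r := (d%:R + 1) * `|x|.
have r0 : 0 <= r by rewrite mulr_ge0 // addr_ge0.
pose A := C `&` [set y | `|y| <= r].
have A0 : A !=set0 by exists 0; split; [exact: cone0|rewrite /= normr0].
have cA : compact A.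
  apply: bounded_closed_compact.
    exists r; split; first exact: num_real.
    by move=> M rM y [_ /= h]; rewrite (le_trans h) // ltW.
  apply: closedI => //.
  rewrite (_ : mkset _ = (fun y : V => `|y|) @^-1` [set z | z <= r]) //.
  by apply: preimage_closed; [move=> y _; exact: norm_continuous|exact: closed_le].
have cw : {within A, continuous (fun y : V => sqn (y + x))}.
  by apply: continuous_subspaceT; exact: continuous_sqn.
have [y0] := EVT_min_rV A0 cA cw; rewrite inE => -[Cy0 _] ymin.
have {}ymin y : C y -> sqn (y0 + x) <= sqn (y + x).
  move=> Cy; have [yr|yr] := leP `|y| r; first by apply: ymin; rewrite inE.
  have le0 : sqn (y0 + x) <= sqn (0 + x).
    by apply: ymin; rewrite inE; split; [exact: cone0|rewrite /= normr0].
  apply: le_trans le0 _; rewrite add0r.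
  have [i yi] : exists i, r < `|y 0 i|.
    apply: contrapT => /forallNP h; move: yr; rewrite ltNge => /negP; apply.
    by apply: norm_le_coord => // i; rewrite leNgt; apply/negP; exact: h.
  apply: (@le_trans _ _ ((y + x) 0 i ^+ 2)); last first.
    rewrite /sqn (bigD1 i) //= lerDl; apply: sumr_ge0 => j _; exact: sqr_ge0.
  have e1 : sqn x <= d%:R * `|x| ^+ 2.
    have -> : d%:R * `|x| ^+ 2 = \sum_(j < d) `|x| ^+ 2.
      by rewrite sumr_const card_ord mulr_natl.
    apply: ler_sum => j _.
    by rewrite -[leLHS]real_normK ?num_real // lerXn2r ?nnegrE // norm_coord.
  have e2 : d%:R * `|x| <= `|(y + x) 0 i|.
    rewrite mxE; have := lerB_normD (y 0 i) (x 0 i); have := norm_coord x i.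
    move: yi; rewrite /r mulrDl mul1r; lra.
  apply: le_trans e1 _; rewrite -[leRHS]real_normK ?num_real //.
  have d2 : (d%:R * `|x|) ^+ 2 <= `|(y + x) 0 i| ^+ 2 by rewrite lerXn2r ?nnegrE // mulr_ge0.
  apply: le_trans d2; rewrite exprMn ler_wpM2r ?exprn_ge0 // -natrX ler_nat.
  by rewrite -mulnn; case: (posnP d) => [->//|d0]; rewrite leq_pmulr.
pose z := y0 + x; exists z^T.
  move=> y Cy; apply: (@quad_ge0 _ (sqn y) (sqn_ge0 y)) => s /andP[s0 _].
  have := ymin (y0 + s *: y); rewrite addrAC sqnD -/z => h.
  by have := h (coneD Cy0 (coneZ (ltW s0) Cy)); lra.
have y0z : dot y0 z^T <= 0.
  rewrite -oppr_ge0; apply: (@quad_ge0 _ (sqn y0) (sqn_ge0 y0)) => s /andP[s0 s1].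
  have := ymin (y0 + (- s) *: y0); rewrite addrAC sqnD -/z => h.
  have C' : C (y0 + (- s) *: y0).
    by rewrite -[X in X + _]scale1r -scalerDl; apply: coneZ; rewrite ?subr_ge0.
  by have := h C'; rewrite sqrrN; lra.
have zz : dot z z^T = sqn z by rewrite dotE /sqn; apply: eq_bigr => i _; rewrite [z^T _ _]mxE expr2.
have z0 : 0 < sqn z.
  rewrite lt_neqAle sqn_ge0 andbT eq_sym; apply/eqP => /psumr_eq0P h.
  have {}h : z = 0.
    apply/rowP => i; rewrite [RHS]mxE; apply/eqP; rewrite -sqrf_eq0; apply/eqP.
    by apply: h => // j _; exact: sqr_ge0.
  (* If the nearest point were [- x] itself, [C] would contain both [x] and [- x], against
     pointedness. *)
  have e : - x = y0 by apply/eqP; rewrite eq_sym -addr_eq0; apply/eqP.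
  by move: x0; rewrite (cone_pointed Cx) ?eqxx // e.
have -> : dot x z^T = sqn z - dot y0 z^T by rewrite -zz -dotBl /z addrAC subrr add0r.
lra.
Qed.

Definition perpr (u : 'cV[R]_d) (W : {vspace V}) : {vspace V} :=
  (W :&: lker (linfun (mulmxr u : V -> 'M[R]_1)))%VS.

Lemma mem_perpr u W x : (x \in perpr u W) = (x \in W) && (dot x u == 0).
Proof.
rewrite memv_cap memv_ker lfunE /=; congr andb; apply/eqP/eqP => [e|e].
  by rewrite /dot e mxE.
by apply/matrixP => i j; rewrite !ord1 [RHS]mxE; exact: e.
Qed.

(* Adding separating functionals, the space spanned by the zero face of their sum
   shrinks until it is trivial. *)
Lemma cone_face0 m : exists (u : 'cV[R]_d) (W : {vspace V}),
  [/\ forall y, C y -> 0 <= dot y u, (\dim W <= d - m)%N &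
      forall y, C y -> dot y u = 0 -> y \in W].
Proof.
elim: m => [|m [u [W [u0 dW hW]]]].
  exists 0, fullv; split=> [y _|| y _ _]; rewrite ?dot0r ?memvf //.
  by rewrite subn0 dimvf /dim /= mul1n.
case: (pselect (exists x, [/\ C x, x != 0 & dot x u = 0])) => [[x [Cx x0 xu]]|nex].
  have [w w0 xw] := cone_separate Cx x0.
  exists (u + w), (perpr w W); split=> [y Cy||y Cy].
  - by rewrite dotDr addr_ge0 // ?u0 ?w0.
  - have lt : (\dim (perpr w W) < \dim W)%N.
      rewrite ltn_neqAle dimvS ?capvSl // andbT (dimv_leqif_eq (capvSl _ _)).
      apply/eqP => e; have := hW x Cx xu; rewrite -e mem_perpr => /andP[_ /eqP h].
      by move: xw; rewrite h ltxx.
    by rewrite subnS -ltnS (leq_trans lt) // (leq_trans dW) // leqSpred.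
  - rewrite dotDr => e; have h1 := u0 y Cy; have h2 := w0 y Cy.
    by rewrite mem_perpr hW //=; [apply/eqP; lra|lra].
exists u, 0%VS; split=> // [|y Cy yu]; first by rewrite dimv0.
by rewrite memv0; apply: contraPT nex => y0; apply; exists y; split.
Qed.

(** A functional positive on [C] outside 0 has a positive minimum on the compact set of unit vectors
    of [C]; dividing by this minimum gives domination of the norm. *)
Lemma cone_functional : exists u : 'cV[R]_d, forall x, C x -> `|x| <= dot x u.
Proof.
have [u [W [u0 dW hW]]] := cone_face0 d.
have {W dW hW} upos x : C x -> x != 0 -> 0 < dot x u.
  move=> Cx x0; rewrite lt_neqAle u0 // andbT eq_sym; apply: contra x0 => /eqP e.
  have := hW x Cx e; suff -> : W = 0%VS by rewrite memv0.
  by apply/eqP; rewrite -dimv_eq0 -leqn0 (leq_trans dW) // subnn.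
pose K := C `&` [set y | `|y| = 1].
case: (eqVneq K set0) => [K0|/set0P K0].
  exists 0 => x Cx; rewrite dot0r; suff -> : x = 0 by rewrite normr0.
  apply: contrapT => /eqP x0; suff : K (`|x|^-1 *: x) by rewrite K0.
  split; first by apply: coneZ; rewrite ?invr_ge0.
  by rewrite /= normrZ normfV normr_id mulVf // normr_eq0.
have cK : compact K.
  apply: bounded_closed_compact.
    exists 1; split; first exact: num_real.
    by move=> M rM y [_ /= ->]; rewrite ltW.
  apply: closedI => //.
  rewrite (_ : mkset _ = (fun y : V => `|y|) @^-1` [set 1]) //.
  by apply: preimage_closed; [move=> y _; exact: norm_continuous|exact: closed_eq].
have cw : {within K, continuous (fun y : V => dot y u)}.
  by apply: continuous_subspaceT; exact: continuous_dot.
have [y0] := EVT_min_rV K0 cK cw; rewrite inE => -[Cy0 /= y01] ymin.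
have m0 : 0 < dot y0 u.
  by apply: upos => //; rewrite -normr_eq0 y01 oner_eq0.
exists ((dot y0 u)^-1 *: u) => x Cx; rewrite dotZr.
have [->|x0] := eqVneq x 0; first by rewrite normr0 dot0l mulr0.
have nx : 0 < `|x| by rewrite normr_gt0.
have := ymin (`|x|^-1 *: x); rewrite inE => /(_ _)/wrap[].
  split; first by apply: coneZ; rewrite ?invr_ge0.
  by rewrite /= normrZ normfV normr_id mulVf // normr_eq0.
by rewrite dotZl !ler_pdivlMl // mulrC.
Qed.

Lemma cone_interior k : C° k ->
  exists2 rho : R, 0 < rho & forall y : V, `|y| <= rho -> C (k + y).
Proof.
move=> /nbhs_ballP[e /= e0 h]; exists (e / 2); first by rewrite divr_gt0.
move=> y ye; apply: h; rewrite -ball_normE /= opprD addrA subrr add0r normrN.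
by apply: le_lt_trans ye _; rewrite ltr_pdivrMr // ltr_pMr // ltr1n.
Qed.

End Cone.

(** * Uniqueness of the primitive decomposition *)

Lemma int_mulrn (x : int) n : x *+ n = x * n%:Z.
Proof. by rewrite -mulr_natr natz. Qed.

Section Primitive.
Variable d : nat.
Implicit Types (p q z : 'rV[int]_d).

Definition primitive p := p != 0 /\ forall q (g : nat), p = q *+ g -> g = 1%N.

Lemma rV_neq0 z : z != 0 -> exists i, z 0 i != 0.
Proof.
move=> z0; apply/existsP; apply: contra_neqT z0 => /existsPn h; apply/rowP => i.
by rewrite mxE; apply/eqP; have := h i; rewrite negbK.
Qed.

Lemma primitive_decomp z : z != 0 ->
  exists p (g : nat), [/\ primitive p, (0 < g)%N & z = p *+ g].
Proof.
move=> z0; have [i zi] := rV_neq0 z0.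
pose S g := `[< exists q, z = q *+ g >].
have S1 : exists g, S g by exists 1%N; apply/asboolP; exists z; rewrite mulr1n.
have Sb g : S g -> (g <= absz (z 0%R i))%N.
  move=> /asboolP[q e]; apply: dvdn_leq; first by rewrite absz_gt0.
  by rewrite e mulmxnE int_mulrn abszM absz_nat dvdn_mull.
case: (ex_maxnP S1 Sb) => g /asboolP[p e] gmax.
have g0 : (0 < g)%N by rewrite lt0n; apply: contra z0 => /eqP g0; rewrite e g0 mulr0n.
exists p, g; split=> //; split; first by apply: contra z0 => /eqP p0; rewrite e p0 mul0rn.
move=> q h eh.
have h0 : (0 < h)%N by rewrite lt0n; apply: contra z0 => /eqP h0; rewrite e eh h0 mulr0n mul0rn.
have /gmax : S (h * g)%N by apply/asboolP; exists q; rewrite mulrnA -eh.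
by rewrite -[X in (_ <= X)%N]mul1n leq_pmul2r // => h1; apply/eqP; rewrite eqn_leq h1 h0.
Qed.

Lemma primitive_dvd p q (a b : nat) : coprime a b -> primitive p ->
  p *+ a = q *+ b -> b = 1%N.
Proof.
move=> cab [_ prim] e.
have dvd i : (b %| absz (p 0%R i))%N.
  have /(congr1 (fun z : 'rV[int]_d => absz (z 0 i))) := e.
  rewrite !mulmxnE !int_mulrn !abszM !absz_nat => h.
  by rewrite -(@Gauss_dvdl _ _ a) 1?coprime_sym // h dvdn_mull.
apply: (prim (\row_i (p 0%R i %/ b)%Z) b); apply/rowP => i; rewrite mulmxnE mxE int_mulrn.
by rewrite divzK // dvdzE absz_nat dvd.
Qed.

Lemma primitive_unique p q (a b : nat) : primitive p -> primitive q ->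
  (0 < a)%N -> (0 < b)%N -> p *+ a = q *+ b -> p = q.
Proof.
move=> pp pq a0 b0 e.
have [a' [b' [g [g0 aE bE cop]]]] : exists a' b' g : nat,
    [/\ (0 < g)%N, a = (a' * g)%N, b = (b' * g)%N & coprime a' b'].
  have g0 : (0 < gcdn a b)%N by rewrite gcdn_gt0 a0.
  have aE : a = (a %/ gcdn a b * gcdn a b)%N by rewrite divnK // dvdn_gcdl.
  have bE : b = (b %/ gcdn a b * gcdn a b)%N by rewrite divnK // dvdn_gcdr.
  exists (a %/ gcdn a b)%N, (b %/ gcdn a b)%N, (gcdn a b); split=> //.
  have := muln_gcdl (a %/ gcdn a b)%N (b %/ gcdn a b)%N (gcdn a b); rewrite -aE -bE => h.
  by rewrite /coprime -(eqn_pmul2r g0) h mul1n.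
subst a b.
have e' : p *+ a' = q *+ b'.
  apply/rowP => i; have := congr1 (fun z : 'rV[int]_d => z 0 i) e.
  rewrite !mulrnA !mulmxnE => /eqP; rewrite eqrMn2r eqn0Ngt g0.
  by move/eqP.
have b1 := primitive_dvd cop pp e'.
have a1 : a' = 1%N by apply: (@primitive_dvd q p b' a') => //; rewrite coprime_sym.
by move: e'; rewrite a1 b1 !mulr1n.
Qed.

Lemma emb_parallel (R : realType) p q (t : R) : p != 0 -> 0 < t -> emb R p = t *: emb R q ->
  exists a b : nat, [/\ (0 < a)%N, (0 < b)%N & p *+ a = q *+ b].
Proof.
move=> p0 t0 e; have [i pi] := rV_neq0 p0.
have ej j : (p 0 j)%:~R = t * (q 0 j)%:~R :> R by rewrite -!embE e mxE.
have qi : q 0 i != 0.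
  by apply: contra_neqN pi => /eqP h; apply: (@intr_inj R); rewrite ej h mulr0.
exists (absz (q 0 i)), (absz (p 0 i)); split; rewrite ?absz_gt0 //.
apply/rowP => j; rewrite !mulmxnE !int_mulrn; apply: (@intr_inj R).
rewrite !intrM !abszE !intr_norm !ej normrM (gtr0_norm t0); ring.
Qed.

End Primitive.

Section GenericPerp.
Variables (R : realType) (d : nat).
Local Notation V := 'rV[R]_d.

Lemma perp_nonparallel (p q : V) : p != 0 -> (forall t, q != t *: p) ->
  exists2 u : 'cV[R]_d, dot p u = 0 & dot q u != 0.
Proof.
move=> p0 npar; pose pp := dot p p^T.
have sq0 (x : V) : x != 0 -> dot x x^T != 0.
  move=> x0; apply: contra x0 => /eqP; rewrite dotE => /psumr_eq0P h.
  apply/eqP/rowP => i; rewrite [RHS]mxE; apply/eqP; rewrite -sqrf_eq0 expr2; apply/eqP.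
  transitivity (x 0 i * x^T i 0); first by rewrite [x^T _ _]mxE.
  by apply: h => // j _; rewrite [x^T _ _]mxE -expr2 sqr_ge0.
pose w : V := pp *: q - dot q p^T *: p.
have dC (x y : V) : dot x y^T = dot y x^T.
  by rewrite !dotE; apply: eq_bigr => i _; rewrite !mxE mulrC.
have pw : dot p w^T = 0 by rewrite dC dotBl !dotZl mulrC -/pp subrr.
exists w^T => //.
have w0 : w != 0.
  have pp0 : pp != 0 by exact: sq0.
  rewrite /w subr_eq0; apply/eqP => h; case/eqP: (npar (pp^-1 * dot q p^T)).
  by rewrite -scalerA -h scalerA mulVf // scale1r.
have : dot w w^T != 0 by exact: sq0.
by apply: contraNneq => h; rewrite {1}/w dotBl !dotZl h pw !mulr0 subrr.
Qed.

(** The directions are treated one at a time: a small perturbation inside the orthogonal of [p]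
    makes the new value non-zero and keeps the signs of the earlier ones. *)
Lemma generic_perp (I : finType) (v : I -> V) (p : V) (S : {set I}) : p != 0 ->
  {in S, forall i t, v i != t *: p} ->
  exists2 u : 'cV[R]_d, dot p u = 0 & {in S, forall i, dot (v i) u != 0}.
Proof.
move=> p0 npar.
suff : forall s : seq I, {subset s <= S} ->
    exists2 u : 'cV[R]_d, dot p u = 0 & {in s, forall i, dot (v i) u != 0}.
  case/(_ (enum S)) => [i|u pu h]; first by rewrite mem_enum.
  by exists u => // i iS; apply: h; rewrite mem_enum.
elim=> [|i s IH] sub; first by exists 0 => //; rewrite dot0r.
have [|u pu us] := IH; first by move=> j js; apply: sub; rewrite inE js orbT.
have [w pw iw] := perp_nonparallel p0 (npar i (sub i (mem_head _ _))).
have [e e0 he] := perturb v u w; exists (u + e *: w).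
  by rewrite dotDr dotZr pu pw mulr0 addr0.
move=> j; rewrite inE => hj; rewrite -sgr_eq0 he.
case: ifP => [/eqP ju|/negbT ju]; last by rewrite sgr_eq0.
case/orP: hj => [/eqP ->|js]; first by rewrite sgr_eq0.
by have := us j js; rewrite ju eqxx.
Qed.

End GenericPerp.

(** * A zonotope determines its multiplicities *)

Section ZonoUnique.
Variables (R : realType) (d : nat) (I : finType) (g : I -> 'rV[R]_d).

Definition wzono (w : I -> nat) := zono (fun i => (w i)%:R *: g i).

Hypothesis g0 : forall i, g i != 0.
Hypothesis npar : forall i j t, j != i -> g j != t *: g i.

Lemma supp_fun_eq (v v' : I -> 'rV[R]_d) u :
  zono v = zono v' -> supp_fun v u = supp_fun v' u.
Proof.
move=> e.
have half (a b : I -> 'rV[R]_d) : zono a = zono b -> supp_fun a u <= supp_fun b u.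
  move=> ab; have := zbase_face a u; rewrite zfaceE ab => -[zb /= <-].
  exact: zono_le_supp.
by apply/eqP; rewrite eq_le !half.
Qed.

(** For [u] orthogonal to [g i] and to no other generator, the face is a translate of the segment
    spanned by [w i] copies of [g i]; equal zonotopes have equal faces, hence segments of equal
    length. *)
Lemma wzono_inj w w' : wzono w = wzono w' -> w = w'.
Proof.
suff half w1 w2 i : wzono w1 = wzono w2 -> (w2 i <= w1 i)%N.
  by move=> e; apply/funext => i; apply/eqP; rewrite eqn_leq !half.
move=> e; pose v1 j := (w1 j)%:R *: g j; pose v2 j := (w2 j)%:R *: g j.
have [|u iu ju] := @generic_perp R d I g (g i) [set~ i]%SET (g0 i).
  by move=> j hj t; apply: npar; move: hj; rewrite !finset.inE.
have fe : zface v1 u = zface v2 u by rewrite !zfaceE -!/(wzono _) e (supp_fun_eq u e).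
have iu2 : dot (v2 i) u = 0 by rewrite dotZl iu mulr0.
have := zbase_add iu2; have := zbase_face v2 u; rewrite -fe.
move=> [a [a01 ap an ea]] [b [b01 bp bn eb]].
(* Two points of the face of the second zonotope are expressed in the first, where every coefficient
   other than the [i]-th is forced by [u]. *)
have : v2 i = (b i - a i) *: v1 i.
  have -> : v2 i = zbase v2 u + v2 i - zbase v2 u by rewrite addrAC subrr add0r.
  rewrite eb ea -sumrB (bigD1 i) //= big1 ?addr0; first by rewrite scalerBl.
  move=> j ji; rewrite -scalerBl; have [w0|w0] := posnP (w1 j).
    by rewrite /v1 w0 scale0r scaler0.
  have : dot (g j) u != 0 by apply: ju; rewrite !finset.inE.
  have dj : dot (v1 j) u = (w1 j)%:R * dot (g j) u by rewrite dotZl.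
  have wj : (0 : R) < (w1 j)%:R by rewrite ltr0n.
  case: (ltgtP (dot (g j) u) 0) => // h _.
    by rewrite an ?bn ?subrr ?scale0r // dj pmulr_rlt0.
  by rewrite ap ?bp ?subrr ?scale0r // dj mulr_gt0.
rewrite /v2 /v1 scalerA => /eqP; rewrite -subr_eq0 -scalerBl scaler_eq0 (negbTE (g0 i)) orbF.
rewrite subr_eq0 => /eqP h; rewrite -(ler_nat R) h -[leRHS]mul1r ler_wpM2r //.
by case/andP: (a01 i) => a0 a1; case/andP: (b01 i) => b0 b1; lra.
Qed.

Lemma zono_merge (J : finType) (pi : J -> I) (c : J -> nat) :
  zono (fun j => (c j)%:R *: g (pi j)) = wzono (fun i => \sum_(j | pi j == i) c j)%N.
Proof.
apply/seteqP; split=> x [a [a01 ->]]; last first.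
  exists (fun j => a (pi j)); split=> //.
  rewrite [RHS](partition_big pi xpredT) //=; apply: eq_bigr => i _.
  rewrite natr_sum scaler_suml scaler_sumr; apply: eq_bigr => j /eqP ->.
  by [].
pose W i := (\sum_(j | pi j == i) c j)%N.
(* Weighted mean of the coefficients over the fibre of [i]; for a fibre of total weight 0 the
   quotient is 0, and so is the contribution. *)
pose b i := (\sum_(j | pi j == i) a j * (c j)%:R) / (W i)%:R.
have s0 i : 0 <= \sum_(j | pi j == i) a j * (c j)%:R.
  by apply: sumr_ge0 => j _; rewrite mulr_ge0 //; case/andP: (a01 j).
have sW i : \sum_(j | pi j == i) a j * (c j)%:R <= (W i)%:R.
  by rewrite natr_sum; apply: ler_sum => j _; rewrite ler_piMl //; case/andP: (a01 j).
exists b; split=> [i|].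
  rewrite /b divr_ge0 //=; have [->|W0] := posnP (W i); first by rewrite invr0 mulr0 ler01.
  by rewrite ler_pdivrMr ?ltr0n // mul1r.
rewrite [LHS](partition_big pi xpredT) //=; apply: eq_bigr => i _.
rewrite scalerA -/(W i).
have -> : b i * (W i)%:R = \sum_(j | pi j == i) a j * (c j)%:R.
  rewrite /b; have [W0|W0] := posnP (W i); last by rewrite divfK // pnatr_eq0 -lt0n.
  by rewrite W0 mulr0; apply/esym/eqP; rewrite eq_le s0 andbT -[leRHS](_ : (W i)%:R = 0) ?sW // W0.
by rewrite scaler_suml; apply: eq_bigr => j /eqP ->; rewrite scalerA.
Qed.

End ZonoUnique.

(** * Switching *)

Lemma card_dep_le (S T : finType) (Z : {set S * T}) (N : nat) :
  (forall s, #|[set t | (s, t) \in Z]%SET| <= N)%N -> (#|Z| <= #|S| * N)%N.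
Proof.
move=> h; have -> : #|Z| = (\sum_(s : S) #|[set t | (s, t) \in Z]%SET|)%N.
  rewrite -sum1_card (partition_big (fun st => st.1) xpredT) //=; apply: eq_bigr => s _.
  rewrite -sum1_card (reindex_onto (fun t => (s, t)) (fun st => st.2)) /=; last first.
    by move=> [a b] /= /andP[_ /eqP ->].
  by apply: eq_bigl => t; rewrite !eqxx !andbT finset.inE.
by rewrite -sum_nat_const; apply: leq_sum => s _.
Qed.

Lemma card_dep_ge (S T : finType) (A : {set S}) (Z : {set S * T}) (N : nat) :
  {in A, forall s, N <= #|[set t | (s, t) \in Z]%SET|}%N -> (#|A| * N <= #|Z|)%N.
Proof.
move=> h; have -> : #|Z| = (\sum_(s : S) #|[set t | (s, t) \in Z]%SET|)%N.
  rewrite -sum1_card (partition_big (fun st => st.1) xpredT) //=; apply: eq_bigr => s _.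
  rewrite -sum1_card (reindex_onto (fun t => (s, t)) (fun st => st.2)) /=; last first.
    by move=> [a b] /= /andP[_ /eqP ->].
  by apply: eq_bigl => t; rewrite !eqxx !andbT finset.inE.
rewrite -sum_nat_const [X in (_ <= X)%N](bigID (mem A)) /= -[X in (X <= _)%N]addn0 leq_add //.
by apply: leq_sum => s; exact: h.
Qed.

Section Switching.
Variables (R : realType) (D : nat) (C : set 'rV[R]_D.+1) (th : 'cV[R]_D.+1).
Hypothesis C_cone : convex_cone C.
Hypothesis thP : forall x, C x -> `|x| <= dot x th.
Variables (I : finType) (vec : I -> 'rV[int]_D.+1).
Hypothesis vecC : forall i, C (emb R (vec i)).
Hypothesis vec0 : forall i, vec i != 0.
Variables (e : 'rV[int]_D.+1) (b : nat).
Local Notation M := (dot (emb R e) th).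
Hypothesis bM : M < b.+1%:R.
Hypothesis fill_ex : forall f, C (emb R f) -> dot (emb R f) th <= M ->
  exists phi : I -> nat, \sum_i vec i *+ phi i = f.
Local Notation conf := {ffun I -> 'I_b.+1}.

Definition ell i := dot (emb R (vec i)) th.

Definition confs : {set conf} := [set w : conf | \sum_i vec i *+ w i == e].

Lemma thP_ge0 x : C x -> 0 <= dot x th.
Proof. by move=> Cx; apply: le_trans (thP Cx). Qed.

Lemma ell_ge1 i : 1 <= ell i.
Proof.
apply: le_trans (thP (vecC i)); have [j vj] := rV_neq0 (vec0 i).
apply: le_trans (norm_coord _ j); rewrite embE -intr_norm -[1]/(1%:~R) ler_int.
by rewrite -gtz0_ge1 normr_gt0.
Qed.

Lemma ell_ge0 i : 0 <= ell i.
Proof. by apply: le_trans (ell_ge1 i). Qed.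

Lemma mass_sum (w : I -> nat) :
  \sum_i (w i)%:R * ell i = dot (emb R (\sum_i vec i *+ w i)) th.
Proof.
by rewrite emb_sum dot_suml; apply: eq_bigr => i _; rewrite embMn dotZl.
Qed.

Lemma conf_bound (w : I -> nat) i : \sum_i vec i *+ w i = e -> (w i < b.+1)%N.
Proof.
move=> se; rewrite -(ltr_nat R); apply: le_lt_trans bM; rewrite -se -mass_sum.
rewrite (bigD1 i) //=; apply: (@le_trans _ _ ((w i)%:R * ell i)).
  by rewrite ler_peMr // ell_ge1.
by rewrite lerDl; apply: sumr_ge0 => j _; rewrite mulr_ge0 // ell_ge0.
Qed.

Variables (q : nat) (cl : I -> 'I_q) (kap : R).
Hypothesis kap01 : 0 <= kap <= 1.

Definition class (F : {set 'I_q}) : {set I} := [set i | cl i \in F].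

Lemma in_class F i : (i \in class F) = (cl i \in F).
Proof. by rewrite finset.inE. Qed.

Definition csum (w : conf) (F : {set 'I_q}) : 'rV[int]_D.+1 :=
  \sum_(i in class F) vec i *+ w i.

(** The constant solution [kap] is replaced by a basic one. [F1] collects the classes with value 1
    and [F2] the fractional ones; emptying both frees at least what [kap] times the endpoint asks
    for, up to an element of [C]. *)
Lemma switching_classes (w : conf) : w \in confs -> exists F1 F2 : {set 'I_q},
  [/\ #|F1|%:R <= kap * q%:R, (#|F2| <= D.+2)%N,
      dot (emb R (csum w F1)) th <= kap * M &
      C (emb R (csum w (F1 :|: F2)) - kap *: emb R e)].
Proof.
rewrite finset.inE => /eqP we; case/andP: kap01 => kap0 kap1.
pose r c := emb R (csum w [set c]%SET).
have csumE F : emb R (csum w F) = \sum_(c in F) r c.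
  rewrite /csum emb_sum (partition_big cl (mem F)) /=; last by move=> i; rewrite finset.inE.
  apply: eq_bigr => c cF; rewrite /r emb_sum; apply: eq_bigl => i; rewrite !finset.inE.
  by case: eqP => [->|_]; rewrite ?cF ?andbF.
have rC c : C (r c).
  rewrite /r emb_sum; apply: (cone_sum C_cone) => i _; rewrite embMn.
  by apply: (coneZ C_cone).
have rT : \sum_c r c = emb R e.
  have := csumE (finset.setTfor _); rewrite (eq_bigl _ _ (fun c => finset.in_setT c)) => <-.
  by rewrite -we; congr emb; apply: eq_bigl => i; rewrite !finset.inE.
(* The extra coordinate 1 preserves the sum of the [x c], equal to kap q, and so bounds the size of
   [F1]. It also makes [D.+2] the number of constraints, hence the bound on fractional values. *)
pose v c : 'rV[R]_(D.+1 + 1) := row_mx (r c) (1%:M).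
have [x [x01 xv xfrac]] := @basic_solution R q _ v (fun _ => kap) (fun _ => kap01).
have lE (y : 'I_q -> R) : lsubmx (\sum_c y c *: v c) = \sum_c y c *: r c.
  apply/rowP => j; rewrite mxE !summxE; apply: eq_bigr => c _.
  by rewrite [LHS]mxE [RHS]mxE /v row_mxEl.
have rE (y : 'I_q -> R) : (\sum_c y c *: v c) 0 (rshift D.+1 0) = \sum_c y c.
  by rewrite summxE; apply: eq_bigr => c _; rewrite mxE /v row_mxEr mxE eqxx mulr1.
have xr := congr1 lsubmx xv; rewrite !lE -scaler_sumr rT in xr.
have xs := congr1 (fun a : 'rV[R]_(D.+1 + 1) => a 0 (rshift D.+1 0)) xv.
rewrite !rE sumr_const card_ord in xs.
pose F1 : {set 'I_q} := [set c | x c == 1]%SET.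
exists F1, (fracs x); split.
- rewrite -mulr_natr in xs; rewrite -xs -sum1_card natr_sum big_mkcond; apply: ler_sum => c _.
  by rewrite finset.inE; case: eqP => [->//|_]; case/andP: (x01 c).
- by rewrite (leq_trans xfrac) // addn1.
- rewrite csumE -dotZl -xr !dot_suml big_mkcond; apply: ler_sum => c _.
  rewrite finset.inE dotZl; case: eqP => [->|_]; first by rewrite mul1r.
  by rewrite mulr_ge0 ?thP_ge0 //; case/andP: (x01 c).
(* The excess is the sum of (1 - x c) r c over the emptied classes. *)
- rewrite csumE -xr [X in X - _]big_mkcond -sumrB.
  apply: (cone_sum C_cone) => c _; case/andP: (x01 c) => x0 x1.
  rewrite !finset.inE; case: ifP => h.
    by rewrite -[X in X - _]scale1r -scalerBl; apply: (coneZ C_cone); rewrite ?subr_ge0.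
  suff -> : x c = 0 by rewrite scale0r subr0; exact: cone0.
  apply/eqP; rewrite eq_le x0 andbT leNgt; apply/negP => xp.
  move: h; rewrite xp /=; case: eqP => //= /eqP xn1.
  by rewrite lt_neqAle xn1 x1.
Qed.

Variable A : {set I}.
Hypothesis AC : forall B : {set I}, B \subset A ->
  C (kap *: emb R e - emb R (\sum_(i in B) vec i)).
Variable e0 : nat.

Definition asupp (w : conf) : {set I} := [set i in A | w i != ord0].

Definition bad : {set conf} := [set w in confs | (#|asupp w| <= e0)%N].

Definition subs_le : {set {set I}} := [set E : {set I} | (E \subset A) && (#|E| <= e0)%N].

Variables N1 N2 : nat.
Hypothesis N1P : forall F : {set 'I_q}, #|F|%:R <= kap * q%:R ->
  (#|restr_conf b (class F) ell (kap * M)| <= N1)%N.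
Hypothesis N2P : forall F : {set 'I_q}, (#|F| <= D.+2)%N ->
  (#|restr_conf b (class F) ell M| <= N2)%N.

(** Double counting of pairs of a bad [w] and a subset [B] of the part of [A] that [w] leaves at 0.
    A bad [w] has at least 2^(|A| - e0) such subsets, and a pair is recovered from its code. *)
Lemma switching_card :
  (#|bad| * 2 ^ (#|A| - e0) <=
   #|confs| * (2 ^ q * 2 ^ q * (N1 * N2)) * (2 * b + 1) ^ D.+1 * #|subs_le|)%N.
Proof.
have /choice[Fs FsP] : forall w : conf, exists F : {set 'I_q} * {set 'I_q}, w \in confs ->
  [/\ #|F.1|%:R <= kap * q%:R, (#|F.2| <= D.+2)%N,
      dot (emb R (csum w F.1)) th <= kap * M &
      C (emb R (csum w (F.1 :|: F.2)) - kap *: emb R e)].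
  move=> w; have [wO|_] := boolP (w \in confs); last by exists (finset.set0, finset.set0).
  by have [F1 [F2 h]] := switching_classes wO; exists (F1, F2).
have /choice[fill fillP] : forall f, exists phi : I -> nat,
    C (emb R f) -> dot (emb R f) th <= M -> \sum_i vec i *+ phi i = f.
  move=> f; case: (pselect (C (emb R f) /\ dot (emb R f) th <= M)) => [[h1 h2]|h].
    by have [phi hphi] := fill_ex h1 h2; exists phi.
  by exists (fun=> 0%N) => h1 h2; case: h.
pose S w := (Fs w).1 :|: (Fs w).2.
(* What remains of the freed mass after spending [B]. It lies in [C], so [fill] can return it and
   restore the endpoint. *)
pose f (wB : conf * {set I}) : 'rV[int]_D.+1 := csum wB.1 (S wB.1) - \sum_(i in wB.2) vec i.
pose nw (wB : conf * {set I}) i := ((cl i \notin S wB.1) * wB.1 i + (i \in wB.2) + fill (f wB) i)%N.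
pose nwc wB : conf := [ffun i => inord (nw wB i)].
pose rho (w : conf) (F : {set 'I_q}) : conf := [ffun i => if cl i \in F then w i else ord0].
pose Pr : {set conf * {set I}} :=
  [set wB : conf * {set I} | (wB.1 \in bad) && (wB.2 \subset A :\: asupp wB.1)]%SET.
have le1 : (#|bad| * 2 ^ (#|A| - e0) <= #|Pr|)%N.
  apply: card_dep_ge => w wb; rewrite (_ : finset _ = powerset (A :\: asupp w)); last first.
    by apply/finset.setP => B; rewrite [LHS]finset.inE [LHS]finset.inE [RHS]finset.inE /= wb.
  rewrite card_powerset leq_exp2l // cardsD.
  have -> : A :&: asupp w = asupp w.
    by apply/finset.setIidPr; apply/fintype.subsetP => i; rewrite finset.inE => /andP[].
  by apply: leq_sub2l; move: wb; rewrite finset.inE => /andP[].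
apply: leq_trans le1 _.
pose Z : {set ({set 'I_q} * {set 'I_q}) * (conf * conf)} :=
  [set z : ({set 'I_q} * {set 'I_q}) * (conf * conf) | [&& (#|z.1.1|%:R <= kap * q%:R), (#|z.1.2| <= D.+2)%N,
    z.2.1 \in restr_conf b (class z.1.1) ell (kap * M) &
    z.2.2 \in restr_conf b (class z.1.2) ell M]]%SET.
have cZ : (#|Z| <= 2 ^ q * 2 ^ q * (N1 * N2))%N.
  apply: (@leq_trans (#|{: {set 'I_q} * {set 'I_q}}| * (N1 * N2))).
    apply: card_dep_le => -[F1 F2].
    have [h1|h1] := boolP (#|F1|%:R <= kap * q%:R); last first.
      rewrite (_ : finset _ = finset.set0) ?cards0 //; apply/finset.setP => z.
      by rewrite !finset.inE /= (negbTE h1).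
    have [h2|h2] := boolP (#|F2| <= D.+2)%N; last first.
      rewrite (_ : finset _ = finset.set0) ?cards0 //; apply/finset.setP => z.
      by rewrite !finset.inE /= (negbTE h2) andbF.
    apply: (@leq_trans #|finset.setX (restr_conf b (class F1) ell (kap * M)) (restr_conf b (class F2) ell M)|).
      apply: subset_leq_card; apply/fintype.subsetP => -[z1 z2].
      rewrite finset.in_setX; move=> hz; move: hz; rewrite finset.inE finset.inE /=.
      by case/and4P => _ _ -> ->.
    by rewrite cardsX leq_mul // ?N1P ?N2P.
  have cs : #|{: {set 'I_q}}| = (2 ^ q)%N.
    by rewrite -cardsT -finset.powersetT card_powerset cardsT card_ord.
  by rewrite card_prod cs.
have wO (wB : conf * {set I}) : wB \in Pr -> wB.1 \in confs.
  by rewrite !finset.inE => /andP[/andP[]].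
have BA (wB : conf * {set I}) : wB \in Pr -> wB.2 \subset A.
  by rewrite finset.inE => /andP[_] /fintype.subset_trans; apply; exact: finset.subsetDl.
have we (wB : conf * {set I}) : wB \in Pr -> \sum_i vec i *+ wB.1 i = e.
  by move/wO; rewrite finset.inE => /eqP.
have restE (wB : conf * {set I}) : wB \in Pr ->
    \sum_i vec i *+ ((cl i \notin S wB.1) * wB.1 i) = e - csum wB.1 (S wB.1).
  move=> h; rewrite -(we _ h) /csum [X in _ - X]big_mkcond -sumrB; apply: eq_bigr => i _.
  by rewrite in_class; case: (_ \in S _); rewrite ?mul0n ?mul1n ?mulr0n ?subrr ?subr0.
have BE (B : {set I}) : \sum_i vec i *+ (i \in B) = \sum_(i in B) vec i.
  by rewrite [RHS]big_mkcond; apply: eq_bigr => i _; case: (i \in B).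
have fC wB : wB \in Pr -> C (emb R (f wB)).
  move=> h; have [_ _ _ hC] := FsP _ (wO _ h).
  have := coneD C_cone hC (AC (BA _ h)); rewrite addrA subrK -embB; exact.
have fM wB : wB \in Pr -> dot (emb R (f wB)) th <= M.
  move=> h; rewrite -subr_ge0 -dotBl -embB; apply: thP_ge0.
  have -> : e - f wB = \sum_i vec i *+ ((cl i \notin S wB.1) * wB.1 i) + \sum_(i in wB.2) vec i.
    by rewrite restE // /f opprB addrA addrAC.
  rewrite embD !emb_sum; apply: (coneD C_cone); apply: (cone_sum C_cone) => i _ //.
  by rewrite embMn; exact: (coneZ C_cone).
have nwE wB : wB \in Pr -> \sum_i vec i *+ nw wB i = e.
  move=> h; rewrite /nw; under eq_bigr do rewrite !mulrnDr.
  rewrite !big_split /= restE // BE fillP; [|exact: fC|exact: fM].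
  by rewrite /f -addrA [X in _ + X]addrC !subrK.
have nwcE wB i : wB \in Pr -> nwc wB i = nw wB i :> nat.
  by move=> h; rewrite ffunE inordK //; exact: conf_bound (nwE _ h).
have rhoS w F : dot (emb R (csum w F)) th = \sum_i ((rho w F i : nat)%:R) * ell i.
  rewrite mass_sum; congr (dot (emb R _) th); rewrite /csum big_mkcond; apply: eq_bigr => i _.
  by rewrite ffunE finset.inE; case: ifP.
have rhoP w F (m : R) : dot (emb R (csum w F)) th <= m ->
    rho w F \in restr_conf b (class F) ell m.
  rewrite rhoS finset.inE => ->; rewrite andbT; apply/forallP => i.
  by rewrite ffunE finset.inE; case: ifP.
pose Fb : {set {ffun 'I_D.+1 -> 'I_(2 * b).+1}} := finset.setTfor _.
pose fb wB : {ffun 'I_D.+1 -> 'I_(2 * b).+1} :=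
  [ffun j => inord (absz (f wB 0 j + b%:Z))].
have fbnd wB j : wB \in Pr -> `|f wB 0 j| <= b%:Z.
  move=> h; rewrite -ltzD1 -(ltr_int R) intr_norm -embE addrC -[(1 + _)%:~R]/(b.+1%:R).
  apply: le_lt_trans bM; apply: le_trans (fM _ h); apply: le_trans (thP (fC _ h)).
  exact: norm_coord.
have fbI wB wB' : wB \in Pr -> wB' \in Pr -> fb wB = fb wB' -> f wB = f wB'.
  move=> h h' /ffunP ef; apply/rowP => j.
  have h1 := fbnd wB j h; have h2 := fbnd wB' j h'; have := ef j; rewrite !ffunE.
  move: (f wB 0 j) (f wB' 0 j) h1 h2 => x y h1 h2 /(congr1 val) /=; rewrite !inordK; lia.
(* The new configuration, the emptied classes with the old values on them, the filled vector and the
   old support in [A]: together they undo the switch. *)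
pose code (wB : conf * {set I}) := (nwc wB, (Fs wB.1, (rho wB.1 (Fs wB.1).1, rho wB.1 (Fs wB.1).2)), fb wB, asupp wB.1).
pose Cd := finset.setX (finset.setX (finset.setX confs Z) Fb) subs_le.
have codeC : {in Pr, forall wB, code wB \in Cd}.
  move=> wB h; have [h1 h2 h3 _] := FsP _ (wO _ h).
  rewrite !finset.in_setX; apply/andP; split; first apply/andP; first split; first apply/andP; first split.
  - rewrite finset.inE -(nwE _ h); apply/eqP; apply: eq_bigr => i _; by rewrite nwcE.
  - rewrite finset.inE /= h1 h2 !rhoP //.
    rewrite -subr_ge0 -dotBl -embB; apply: thP_ge0.
    rewrite -(we _ h) /csum [X in _ - X]big_mkcond -sumrB emb_sum.
    apply: (cone_sum C_cone) => i _; case: ifP => _; first by rewrite subrr emb0; exact: cone0.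
    by rewrite subr0 embMn; exact: (coneZ C_cone).
  - by rewrite finset.in_setT.
  - rewrite finset.inE; apply/andP; split; last by move: h; rewrite !finset.inE => /andP[/andP[]].
    by apply/fintype.subsetP => i; rewrite finset.inE => /andP[].
have codeI : {in Pr &, injective code}.
  move=> [w B] [w' B'] h h' E.
  have /= e1 := congr1 (fun c => c.1.1.1) E.
  have /= FE := congr1 (fun c => c.1.1.2.1) E.
  have /= e4 := congr1 (fun c => c.1.1.2.2.1) E.
  have /= e5 := congr1 (fun c => c.1.1.2.2.2) E.
  have /= e6 := congr1 (fun c => c.1.2) E.
  have /= e7 := congr1 (fun c => c.2) E.
  have fE := fbI _ _ h h' e6.
  have key i : ((cl i \notin S w) * w i + (i \in B) = (cl i \notin S w') * w' i + (i \in B'))%N.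
    have := congr1 (fun g : conf => (g i : nat)) e1; rewrite !nwcE // /nw fE /=.
    exact: addIn.
  have SE : S w = S w' by rewrite /S FE.
  have Bsub (wB : conf * {set I}) i : wB \in Pr -> i \in wB.2 -> i \in A /\ wB.1 i = ord0.
    rewrite finset.inE => /andP[_ /fintype.subsetP hs] /hs; rewrite !finset.inE => /andP[h1 iA].
    by rewrite iA /= negbK in h1; split=> //; apply/eqP.
  have wA i : i \in A -> (w i == ord0) = (w' i == ord0).
    by move=> iA; have /finset.setP/(_ i) := e7; rewrite !finset.inE iA /= => /negb_inj.
  (* On [A] the recorded support tells where [w] vanishes, and only there can [B] have added a
     unit. *)
  have BB : B = B'.
    apply/finset.setP => i; apply/idP/idP => iB.
      have [iA /= w0] := Bsub _ i h iB.
      have w0' : w' i = ord0 by apply/eqP; rewrite -wA // w0.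
      by have := key i; rewrite w0 w0' iB /= !muln0; case: (i \in B').
    have [iA /= w0'] := Bsub _ i h' iB.
    have w0 : w i = ord0 by apply/eqP; rewrite wA // w0'.
    by have := key i; rewrite w0 w0' iB /= !muln0; case: (i \in B).
  subst B'; congr (_, _); apply/ffunP => i; apply: val_inj.
  have k := key i; move/addIn: k; rewrite -SE.
  have [iS _|iS /=] := boolP (cl i \in S w); last by rewrite !mul1n.
  move: iS; rewrite /S finset.inE => /orP[iF|iF].
    have := congr1 (fun g : conf => (g i : nat)) e4; rewrite !ffunE iF.
    by rewrite -FE iF.
  have := congr1 (fun g : conf => (g i : nat)) e5; rewrite !ffunE iF.
  by rewrite -FE iF.
rewrite -(card_in_imset codeI).
apply: (@leq_trans #|Cd|).
  by apply: subset_leq_card; apply/fintype.subsetP => c /imsetP[wB h ->]; exact: codeC.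
rewrite !cardsX leq_mul2r; apply/orP; right.
rewrite leq_mul //; first by rewrite leq_mul2l cZ orbT.
by rewrite cardsT card_ffun !card_ord addn1.
Qed.

End Switching.

(** * Residue classes of primitive vectors and their density *)

Section ClassCount.
Variables (R : realType) (D : nat) (I : finType) (vec : I -> 'rV[int]_D.+1).
Hypothesis vec_inj : injective vec.
Hypothesis vec0 : forall i, vec i != 0.

Definition rad (z : 'rV[int]_D.+1) : nat := (\max_j absz (z 0%R j))%N.

Lemma rad_leP (z : 'rV[int]_D.+1) (m : nat) : reflect (forall j, (absz (z 0%R j) <= m)%N) (rad z <= m)%N.
Proof. by apply: (iffP (bigmax_leqP _ _ _)) => h j; [exact: h|move=> _; exact: h]. Qed.

Lemma rad_norm (z : 'rV[int]_D.+1) : (rad z)%:R <= `|emb R z|.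
Proof.
have [|j e] := @bigop.eq_bigmax 'I_D.+1 (fun j => absz (z 0%R j)); first by rewrite card_ord.
rewrite /rad e; apply: le_trans (norm_coord _ j).
by rewrite embE natr_absz intr_norm.
Qed.

Lemma rad_gt0 (z : 'rV[int]_D.+1) : z != 0 -> (0 < rad z)%N.
Proof.
by move=> /rV_neq0[j zj]; apply: leq_trans (leq_bigmax j); rewrite absz_gt0.
Qed.

Lemma card_rad_le (m : nat) : (#|[set i | (rad (vec i) <= m)%N]%SET| <= (2 * m + 1) ^ D.+1)%N.
Proof.
apply: (@card_box _ _ _ _ (fun i j => vec i 0 j)).
  by move=> i i' _ _ h; apply: vec_inj; apply/rowP => j; exact: h.
by move=> i; rewrite finset.inE => /rad_leP h j; have := h j; lia.
Qed.

Variable q : nat.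

(** Residues of the first coordinate are spread evenly in every box of radius at least [q.+1], so
    one partition serves all scales. *)
Definition rescl (i : I) : 'I_q.+1 := inord (absz ((vec i 0%R ord0) %% q.+1%:Z)%Z).

(** A vector is determined by its class, the quotient of its first coordinate and its other
    coordinates. Quotients take at most 5 m / (q+1) values because m >= q+1, each other coordinate
    at most 3 m. *)
Lemma card_class_rad (F : {set 'I_q.+1}) (m : nat) : (q.+1 <= m)%N ->
  #|[set i | (rescl i \in F) && (rad (vec i) <= m)%N]%SET|%:R <=
    #|F|%:R * (5 * 3 ^+ D / q.+1%:R) * m%:R ^+ D.+1 :> R.
Proof.
move=> qm; set X := finset _; pose w := (m %/ q.+1).+1.
pose co i := (rescl i, [ffun j : 'I_D => inord (absz (vec i 0 (lift ord0 j) + m%:Z)) : 'I_(2 * m).+1],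
  inord (absz (((vec i 0%R ord0) %/ q.+1%:Z)%Z + w%:Z)) : 'I_(2 * w).+1).
have bw i : i \in X -> `|((vec i 0%R ord0) %/ q.+1%:Z)%Z| <= w%:Z.
  rewrite finset.inE => /andP[_ /rad_leP/(_ ord0)].
  have := divz_eq (vec i 0 ord0) q.+1%:Z.
  have := modz_ge0 (vec i 0 ord0) (_ : q.+1%:Z != 0) => /(_ isT).
  have := ltz_mod (vec i 0 ord0) (_ : q.+1%:Z != 0) => /(_ isT).
  have := divn_eq m q.+1; have := ltn_pmod m (isT : (0 < q.+1)%N); rewrite /w.
  move: (vec i 0 ord0) (divz _ _) (modz _ _) (m %/ q.+1)%N (m %% q.+1)%N => x a c s r.
  move=> hr hm h1 h2 hx hxm.
  have u1 : (a < s.+1%:Z + 1)%R by nia.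
  have u2 : (- (s.+1%:Z) - 1 < a)%R by nia.
  lia.
have coI : {in X &, injective co}.
  move=> i i' iX iX' [e1 /ffunP e2 e3].
  have qe : ((vec i 0%R ord0) %/ q.+1%:Z)%Z = ((vec i' 0%R ord0) %/ q.+1%:Z)%Z.
    have h1 := bw i iX; have h2 := bw i' iX'.
    move: (divz _ _) (divz _ _) e3 h1 h2 => x y /(congr1 val) /=.
    by move=> e3 h1 h2; move: e3; rewrite !inordK; lia.
  have re : ((vec i 0%R ord0) %% q.+1%:Z)%Z = ((vec i' 0%R ord0) %% q.+1%:Z)%Z.
    have g1 := modz_ge0 (vec i 0 ord0) (isT : q.+1%:Z != 0).
    have g2 := modz_ge0 (vec i' 0 ord0) (isT : q.+1%:Z != 0).
    have l1 := ltz_mod (vec i 0 ord0) (isT : q.+1%:Z != 0).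
    have l2 := ltz_mod (vec i' 0 ord0) (isT : q.+1%:Z != 0).
    move: e1; rewrite /rescl => /(congr1 val) /=.
    move: (modz _ _) (modz _ _) g1 g2 l1 l2 => x y g1 g2 l1 l2.
    rewrite !inordK; lia.
  apply: vec_inj; apply/rowP => j; have [k ->|->] := unliftP ord0 j; last first.
    by rewrite (divz_eq (vec i 0 ord0) q.+1%:Z) qe re -divz_eq.
  move: iX iX'; rewrite !finset.inE => /andP[_ /rad_leP/(_ (lift ord0 k)) h1].
  move=> /andP[_ /rad_leP/(_ (lift ord0 k)) h2].
  have := e2 k; rewrite !ffunE => /(congr1 val) /=.
  move: (vec i 0 (lift ord0 k)) (vec i' 0 (lift ord0 k)) h1 h2 => x y h1 h2.
  rewrite !inordK; lia.
pose Y := finset.setX (finset.setX F (finset.setTfor {ffun 'I_D -> 'I_(2 * m).+1}))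
  (finset.setTfor 'I_(2 * w).+1).
have : (#|X| <= #|F| * (2 * m).+1 ^ D * (2 * w).+1)%N.
  rewrite -(card_in_imset coI); apply: (@leq_trans #|Y|).
    apply: subset_leq_card; apply/fintype.subsetP => c /imsetP[i iX ->].
    rewrite !finset.in_setX !finset.in_setT !andbT; move: iX; rewrite finset.inE.
    by case/andP.
  by rewrite !cardsX !cardsT card_ffun !card_ord.
rewrite -(ler_nat R) => h; apply: le_trans h _; rewrite !natrM -!mulrA ler_wpM2l //.
have mR : (1 : R) <= m%:R by rewrite ler1n; lia.
have qR : (0 : R) < q.+1%:R by rewrite ltr0n.
have hw : (2 * w).+1%:R <= 5 * m%:R / q.+1%:R :> R.
  rewrite ler_pdivlMr // -!natrM ler_nat.
  have := leq_trunc_div m q.+1; rewrite /w; move: (m %/ q.+1)%N => s; nia.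
have hm : (2 * m).+1%:R ^+ D <= 3 ^+ D * m%:R ^+ D :> R.
  by rewrite -exprMn lerXn2r ?nnegrE // -natrM ler_nat; lia.
rewrite natrX; apply: (@le_trans _ _ (3 ^+ D * m%:R ^+ D * (5 * m%:R / q.+1%:R))).
  by apply: ler_pM => //; rewrite exprn_ge0.
by rewrite exprS le_eqVlt; apply/orP; left; apply/eqP; ring.
Qed.

Definition c5 : R := 5 * 3 ^+ D * sumC R D.

Lemma sumC_ge0 : 0 <= sumC R D.
Proof. by rewrite mulr_ge0 // addr_ge0 // exprn_ge0. Qed.

Lemma c5_ge0 : 0 <= c5.
Proof. by rewrite !mulr_ge0 ?sumC_ge0 // exprn_ge0. Qed.

(** The first term covers the vectors of radius at most [q.+1], where classes need not be evenly
    filled: there each summand is bounded by 1/t and all vectors are counted. *)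
Lemma class_bose (F : {set 'I_q.+1}) (ll : I -> R) (t : R) : (0 < D)%N -> 0 < t <= 1 ->
  (forall i, (rad (vec i))%:R <= ll i) ->
  \sum_(i in [set i | rescl i \in F]%SET) (expR (t * ll i) - 1)^-1 <=
    (2 * q.+1 + 1)%:R ^+ D.+1 / t + #|F|%:R * (c5 / q.+1%:R) / t ^+ D.+1.
Proof.
move=> D0 t01 rl; have /andP[t0 t1] := t01.
have tV : 0 < t^-1 by rewrite invr_gt0.
have r0 i : (0 < rad (vec i))%N by exact: rad_gt0.
have ll1 i : 1 <= ll i by apply: le_trans (rl i); rewrite ler1n.
have ex0 (x : R) : 0 < x -> 0 < expR (t * x) - 1.
  by move=> x0; rewrite subr_gt0 expR_gt1 mulr_gt0.
rewrite (bigID (fun i => (q.+1 <= rad (vec i))%N)) /= addrC; apply: lerD.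
  apply: (@le_trans _ _ (\sum_(i in [set i | (rad (vec i) <= q.+1)%N]%SET) t^-1)).
    rewrite big_mkcond [leRHS]big_mkcond; apply: ler_sum => i _; rewrite !finset.inE.
    case: ifP => [/andP[_ h]|_]; last by case: ifP => // _; rewrite ltW.
    rewrite leqNgt ltnS leqNgt ltnNge in h *; rewrite (_ : (_ <= q.+1)%N); last by lia.
    rewrite lef_pV2 ?posrE ?ex0 //; last exact: lt_le_trans (ll1 i).
    apply: (@le_trans _ _ (t * ll i)); first by rewrite ler_peMr // ltW.
    by rewrite lerBrDl expR_ge1Dx.
  rewrite sumr_const -[leLHS]mulr_natl ler_wpM2r ?(ltW tV) //.
  by rewrite -natrX ler_nat card_rad_le.
pose X : {set I} := [set i | (rescl i \in F) && (q.+1 <= rad (vec i))%N]%SET.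
apply: (@le_trans _ _ (\sum_(i in X) (expR (t * (rad (vec i))%:R) - 1)^-1)).
  rewrite big_mkcond [leRHS]big_mkcond; apply: ler_sum => i _; rewrite !finset.inE.
  case: ifP => // _; rewrite lef_pV2 ?posrE ?ex0 ?ltr0n //; last exact: lt_le_trans (ll1 i).
  by rewrite lerD2r ler_expR ler_pM2l.
have qR : (0 : R) < q.+1%:R by rewrite ltr0n.
have -> : #|F|%:R * (c5 / q.+1%:R) / t ^+ D.+1 =
    #|F|%:R * (5 * 3 ^+ D / q.+1%:R) * (sumC R D / t ^+ D.+1) by rewrite /c5; ring.
apply: (@class_sum _ _ _ _ _ _ _ (\max_i rad (vec i))) => //.
  by move=> i _; rewrite r0 /=; exact: (leq_bigmax i).
move=> m m0; have [mq|qm] := ltnP m q.+1.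
  rewrite (_ : finset _ = finset.set0) ?cards0.
    by rewrite !mulr_ge0 ?exprn_ge0 ?invr_ge0.
  by apply/finset.setP => i; rewrite !finset.inE; apply/negP => /andP[/andP[_ h1] h2]; lia.
apply: le_trans (card_class_rad F qm); rewrite ler_nat; apply: subset_leq_card.
apply/fintype.subsetP => i; rewrite !finset.inE => /andP[/andP[-> _] h].
exact: h.
Qed.

End ClassCount.

(** * Few small subsets: the gain of the switching *)

Lemma card_subs_le (I : finType) (A : {set I}) (e : nat) :
  (#|subs_le A e| * 16 ^ #|A| <= 16 ^ e * 17 ^ #|A|)%N.
Proof.
pose a := #|A|.
have cE (k : nat) : #|[set E : {set I} | (E \subset A) && (#|E| == k)]%SET| = 'C(a, k).
  exact: cards_draws.
have -> : #|subs_le A e| = (\sum_(k < a.+1 | (k <= e)%N) 'C(a, k))%N.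
  rewrite -sum1_card (partition_big (fun E : {set I} => inord #|E| : 'I_a.+1)
    (fun k : 'I_a.+1 => (k <= e)%N)) /=; last first.
    move=> E; rewrite finset.inE => /andP[EA Ee].
    by rewrite inordK // ltnS subset_leq_card.
  apply: eq_bigr => k ke; rewrite -cE -sum1_card; apply: eq_bigl => E; rewrite !finset.inE.
  have [EA|] //= := boolP (E \subset A).
  rewrite -val_eqE /= inordK ?ltnS ?subset_leq_card //.
  by case: eqP => [->|]; rewrite ?ke ?andbF.
have -> : (17 ^ a = \sum_(k < a.+1) 'C(a, k) * 16 ^ (a - k))%N.
  rewrite (_ : 17 = 16 + 1)%N // expnDn; apply: eq_bigr => k _.
  by rewrite exp1n muln1.
rewrite big_distrl big_distrr /= big_mkcond; apply: leq_sum => k _; case: ifP => // ke.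
rewrite mulnCA leq_mul2l; apply/orP; right.
have ka : (k <= a)%N by rewrite -ltnS.
have -> : (16 ^ #|A| = 16 ^ k * 16 ^ (a - k))%N by rewrite -expnD subnKC.
by rewrite leq_mul2r leq_exp2l // ke orbT.
Qed.

Lemma expR_half_lt2 (R : realType) : expR (2^-1 : R) <= 2.
Proof.
have h := @expR_ge1Dx R (- 2^-1).
rewrite -[expR 2^-1]invrK -expRN -[leRHS]invrK lef_pV2 ?posrE ?expR_gt0 ?invr_gt0 //.
by lra.
Qed.

(** With e <= a/16, the margin (a - 5e)/2 >= 11a/32 left in 2^(a - e) beyond 16^e covers both a/16,
    from (17/16)^a, and the announced a/4. *)
Lemma subs_gain (R : realType) (I : finType) (A : {set I}) :
  (#|subs_le A (#|A| %/ 16)|%:R : R) <= 2 ^+ (#|A| - #|A| %/ 16) * expR (- #|A|%:R / 4).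
Proof.
move: (card_subs_le A (#|A| %/ 16)); set s := #|subs_le A _|; set a := #|A|.
set e := (a %/ 16)%N; rewrite -(ler_nat R) !natrM !natrX => h.
have ea : (16 * e <= a)%N by rewrite mulnC leq_trunc_div.
have p16 : (0 : R) < 16 ^+ a by rewrite exprn_gt0.
rewrite -(ler_pM2r p16); apply: le_trans h _.
have e17 : (17 : R) ^+ a <= 16 ^+ a * expR (a%:R / 16).
  have -> : expR (a%:R / 16) = expR (16^-1 : R) ^+ a by rewrite -expRM_natl.
  rewrite -exprMn lerXn2r ?nnegrE ?mulr_ge0 ?expR_ge0 //.
  by have := @expR_ge1Dx R 16^-1; lra.
apply: le_trans (ler_wpM2l _ e17) _; first by rewrite exprn_ge0.
rewrite mulrCA mulrC; rewrite [leRHS]mulrC [leRHS]mulrC ler_wpM2r ?(ltW p16) //.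
have l2 (m : nat) : expR (m%:R / 2) <= 2 ^+ m :> R.
  have -> : expR (m%:R / 2) = expR (2^-1 : R) ^+ m by rewrite -expRM_natl.
  by rewrite lerXn2r ?nnegrE ?expR_ge0 // expR_half_lt2.
have -> : (16 : R) ^+ e = 2 ^+ (4 * e).
  by rewrite exprM; congr (_ ^+ _); rewrite -!natrX.
rewrite (_ : (a - e = 4 * e + (a - 5 * e))%N); last by lia.
rewrite exprD -mulrA ler_wpM2l ?exprn_ge0 //.
apply: le_trans (ler_wpM2r _ (l2 _)); rewrite ?expR_ge0 // -expRD ler_expR.
rewrite natrB; last by lia.
have : (16 * e)%:R <= a%:R :> R by rewrite ler_nat.
rewrite !natrM; have : (0 : R) <= a%:R by []; move: (a%:R) (e%:R) => x y; lra.
Qed.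

(** * Zonotopes as multiplicity functions *)

Section Configurations.
Variables (R : realType) (D : nat) (C : set 'rV[R]_D.+1) (kz : 'rV[int]_D.+1).
Hypothesis C_cone : convex_cone C.
Hypothesis C_pointed : ~ contains_line C.
Variable th : 'cV[R]_D.+1.
Hypothesis thP : forall x, C x -> `|x| <= dot x th.
Hypothesis kC : C (emb R kz).
Variable n : nat.
Local Notation K := (dot (emb R kz) th).
Local Notation V := 'rV[R]_D.+1.

(** The bound on [th] makes the set finite, and every primitive direction of a zonotope with
    endpoint n k satisfies it. *)
Definition prims : set 'rV[int]_D.+1 :=
  [set p | [/\ primitive p, C (emb R p) & dot (emb R p) th <= n%:R * K]].

Lemma K_ge0 : 0 <= K.
Proof. by apply: le_trans (thP kC). Qed.

Lemma prims_fin : finite_set prims.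
Proof.
pose W := `|Num.floor (n%:R * K)|%N.
pose f (y : {ffun 'I_D.+1 -> 'I_(2 * W).+1}) : 'rV[int]_D.+1 := \row_j ((y j : nat)%:Z - W%:Z).
apply: (@sub_finite_set _ _ [set` [seq f y | y <- enum {ffun 'I_D.+1 -> 'I_(2 * W).+1}]]); last first.
  exact: finite_seq.
move=> p [_ pC pK] /=; apply/mapP.
have b j : `|p 0 j| <= W%:Z.
  rewrite /W gez0_abs ?floor_ge0 ?mulr_ge0 ?K_ge0 // floor_ge_int intr_norm -embE.
  by apply: le_trans pK; apply: le_trans (thP pC); exact: norm_coord.
exists [ffun j => inord (absz (p 0 j + W%:Z))]; first by rewrite mem_enum.
by apply/rowP => j; rewrite mxE ffunE; have := b j; move: (p 0 j) => x hx; rewrite inordK; lia.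
Qed.

Definition Pn : {fset 'rV[int]_D.+1} := fset_set prims.

Definition pvec (i : Pn) : 'rV[int]_D.+1 := val i.

Lemma pvecP i : prims (pvec i).
Proof. by have := valP i; rewrite in_fset_set ?inE //; exact: prims_fin. Qed.

Lemma prims_ex p : prims p -> exists i, pvec i = p.
Proof.
move=> hp; have h : p \in Pn by rewrite in_fset_set ?inE //; exact: prims_fin.
by exists [` h]%fset.
Qed.

Lemma pvec_inj : injective pvec.
Proof. exact: val_inj. Qed.

Lemma pvec0 i : pvec i != 0.
Proof. by case: (pvecP i) => -[]. Qed.

Lemma pvecC i : C (emb R (pvec i)).
Proof. by case: (pvecP i). Qed.

Lemma endpE : dot (emb R (kz *+ n)) th = n%:R * K.
Proof. by rewrite embMn dotZl. Qed.

(** No multiplicity can exceed this value, since [th] is at least 1 on non-zero lattice vectors of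
    [C]; multiplicity functions thus form a finite type. *)
Definition bn : nat := `|Num.floor (n%:R * K)|%N.

Lemma bnP : dot (emb R (kz *+ n)) th < bn.+1%:R.
Proof.
rewrite endpE /bn -natr1 natr_absz ger0_norm ?floor_ge0 ?mulr_ge0 ?K_ge0 //.
have := floorD1_gt (n%:R * K); by rewrite intrD.
Qed.

Lemma bn_le : bn%:R <= n%:R * K.
Proof.
by rewrite /bn natr_absz ger0_norm ?floor_ge0 ?mulr_ge0 ?K_ge0 // floor_le.
Qed.

Lemma fill_exists f : C (emb R f) -> dot (emb R f) th <= dot (emb R (kz *+ n)) th ->
  exists phi : Pn -> nat, \sum_i pvec i *+ phi i = f.
Proof.
rewrite endpE => fC fM; have [->|f0] := eqVneq f 0.
  by exists (fun=> 0%N); rewrite big1.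
have [p [g [pp g0 e]]] := primitive_decomp f0.
have gR : (0 : R) < g%:R by rewrite ltr0n.
have pE : emb R p = g%:R^-1 *: emb R f.
  by rewrite e embMn scalerA mulVf ?gt_eqF // scale1r.
have pC : C (emb R p) by rewrite pE; apply: (coneZ C_cone) => //; rewrite invr_ge0 ltW.
have [|i iE] := @prims_ex p.
  split=> //; apply: le_trans fM; rewrite e embMn dotZl ler_peMl ?ler1n //.
  by apply: le_trans (thP pC).
exists (fun j => if j == i then g else 0%N); rewrite (bigD1 i) //= eqxx iE big1 ?addr0 //.
by move=> j /negbTE ->.
Qed.

Local Notation conf := {ffun Pn -> 'I_bn.+1}.

Definition Om : {set conf} := confs pvec (kz *+ n) bn.

Lemma Om_neq0 : (0 < #|Om|)%N.
Proof.
have [||phi e] := @fill_exists (kz *+ n); rewrite ?lexx //.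
  by rewrite embMn; exact: (coneZ C_cone).
apply/card_gt0P; exists [ffun i => inord (phi i)]; rewrite finset.inE -[X in _ == X]e; apply/eqP.
apply: eq_bigr => i _; rewrite ffunE inordK //.
exact: (conf_bound thP pvecC pvec0 bnP i e).
Qed.

Definition Phi (w : conf) : set V := wzono (fun i => emb R (pvec i)) (fun i => w i : nat).

(** Negative ratios are excluded by pointedness, positive ones by primitivity. *)
Lemma pvec_npar i j t : j != i -> emb R (pvec j) != t *: emb R (pvec i).
Proof.
move=> ji; apply/eqP => e; have [pj Cj _] := pvecP j; have [pi Ci _] := pvecP i.
have [t0|t0|t0] := ltgtP t 0.
- have : emb R (pvec j) = 0.
    apply: (cone_pointed C_cone C_pointed Cj).
    by rewrite e -scaleNr; apply: (coneZ C_cone) => //; rewrite oppr_ge0 ltW.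
  rewrite -(emb0 R) => /emb_inj z; by have := pvec0 j; rewrite z eqxx.
- have [a [b [a0 b0 ab]]] := emb_parallel (pvec0 j) t0 e.
  by case/eqP: ji; apply: pvec_inj; exact: primitive_unique ab.
- move: e; rewrite t0 scale0r -(emb0 R) => /emb_inj z.
  by have := pvec0 j; rewrite z eqxx.
Qed.

Lemma emb_pvec0 i : emb R (pvec i) != 0.
Proof.
apply: contraNneq (pvec0 i); rewrite -(emb0 R) => /emb_inj z; exact/eqP.
Qed.

Lemma Phi_inj : injective Phi.
Proof.
move=> w w' /(wzono_inj emb_pvec0 pvec_npar) e; apply/ffunP => i; apply: val_inj.
exact: (congr1 (fun f => f i) e).
Qed.

Lemma lattice_emb (x : V) : x \is a mxOver Num.int -> exists z, x = emb R z.
Proof.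
move=> /mxOverP h; exists (\row_j Num.floor (x 0 j)); apply/rowP => j; rewrite !mxE.
by rewrite floorK.
Qed.

Lemma emb_lattice z : emb R (z : 'rV[int]_D.+1) \is a mxOver Num.int.
Proof. by apply/mxOverP => i j; rewrite mxE intr_int. Qed.

Lemma zono_reindex (I : finType) (v : I -> V) :
  zonotope (fun i : 'I_#|I| => v (enum_val i)) = zono v.
Proof.
apply/seteqP; split=> x [a [a01 ->]].
  exists (fun i => a (enum_rank i)); split=> //.
  rewrite [RHS](reindex (@enum_val I I)) /=; last exact: onW_bij (enum_val_bij I).
  by apply: eq_bigr => i _; rewrite enum_valK.
exists (fun i => a (enum_val i)); split=> //.
by rewrite (reindex (@enum_val I I)) //=; exact: onW_bij (enum_val_bij I).
Qed.

Lemma zono_endpoint (I : finType) (v : I -> V) (x : V) :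
  (forall i, lattice_points C (v i)) -> \sum_i v i = x ->
  zonotopes_with_endpoint C x (zono v).
Proof.
move=> vL <-; exists #|I|, (fun i => v (enum_val i)); split=> //.
- by rewrite [RHS](reindex (@enum_val I I)) //=; exact: onW_bij (enum_val_bij I).
- by rewrite zono_reindex.
Qed.

Lemma zonotopesE : zonotopes_with_endpoint C (n%:R *: emb R kz) = [set Phi w | w in [set w | w \in Om]].
Proof.
apply/seteqP; split=> T.
  case=> m [v [vL vs ->]].
  have /choice[z zE] : forall i, exists z, v i = emb R z.
    by move=> i; apply: lattice_emb; case: (vL i).
  have zs : \sum_i z i = kz *+ n.
    apply: (@emb_inj R); rewrite embMn -vs emb_sum; apply: eq_bigr => i _; exact/esym.
  have zC i : C (emb R (z i)) by rewrite -zE; case: (vL i).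
  have zK i : dot (emb R (z i)) th <= n%:R * K.
    rewrite -endpE -zs (bigD1 i) //= embD dotDl lerDl.
    rewrite emb_sum dot_suml; apply: sumr_ge0 => j _; exact: le_trans (thP (zC j)).
  (* If all generators vanish, [Pn] may be empty and offers no index to which zero vectors could be
     assigned; this case is treated apart. *)
  have [i0|ne] := pselect (exists i, z i != 0); last first.
    have z0 i : z i = 0 by apply/eqP; apply: contra_notT ne => h; exists i.
    have w0 : (finfun (fun=> ord0) : conf) \in Om.
      rewrite finset.inE -zs [X in _ == X]big1 // big1 // => i _.
      by rewrite ffunE mulr0n.
    exists (finfun (fun=> ord0)) => //; apply/seteqP; split=> x [a [_ ->]].
      exists (fun=> 0); split=> [i|]; first by rewrite lexx ler01.
      rewrite !big1 // => i _; rewrite ?scale0r //.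
      by rewrite ffunE scale0r scaler0.
    exists (fun=> 0); split=> [i|]; first by rewrite lexx ler01.
    rewrite !big1 // => i _; rewrite ?scale0r //.
    by rewrite zE z0 emb0 scaler0.
  have [i0' _] : exists i : Pn, True.
    case: i0 => i zi; have [p [g [pp g0 e]]] := primitive_decomp zi.
    have gR : (0 : R) < g%:R by rewrite ltr0n.
    have pE : emb R p = g%:R^-1 *: emb R (z i).
      by rewrite e embMn scalerA mulVf ?gt_eqF // scale1r.
    have pC : C (emb R p) by rewrite pE; apply: (coneZ C_cone) => //; rewrite invr_ge0 ltW.
    have [|j _] := @prims_ex p; last by exists j.
    split=> //; apply: le_trans (zK i); rewrite e embMn dotZl ler_peMl ?ler1n //.
    by apply: le_trans (thP pC).
  have /choice[pg pgE] : forall i, exists pg : Pn * nat, z i = pvec pg.1 *+ pg.2.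
    move=> i; have [zi|zi] := eqVneq (z i) 0; first by exists (i0', 0%N); rewrite mulr0n.
    have [p [g [pp g0 e]]] := primitive_decomp zi.
    have gR : (0 : R) < g%:R by rewrite ltr0n.
    have pE : emb R p = g%:R^-1 *: emb R (z i).
      by rewrite e embMn scalerA mulVf ?gt_eqF // scale1r.
    have pC : C (emb R p) by rewrite pE; apply: (coneZ C_cone) => //; rewrite invr_ge0 ltW.
    have [|j jE] := @prims_ex p; last by exists (j, g); rewrite jE.
    split=> //; apply: le_trans (zK i); rewrite e embMn dotZl ler_peMl ?ler1n //.
    by apply: le_trans (thP pC).
  pose W i := (\sum_(j | (pg j).1 == i) (pg j).2)%N.
  have We : \sum_i pvec i *+ W i = kz *+ n.
    rewrite -zs [RHS](partition_big (fun j => (pg j).1) xpredT) //=; apply: eq_bigr => i _.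
    rewrite /W -sumrMnr; apply: eq_bigr => j /eqP ji.
    by rewrite pgE ji.
  pose w : conf := [ffun i => inord (W i)].
  have wE i : w i = W i :> nat.
    by rewrite ffunE inordK //; exact: (conf_bound thP pvecC pvec0 bnP i We).
  exists w.
    rewrite /= finset.inE -[X in _ == X]We; apply/eqP.
    by apply: eq_bigr => i _; rewrite wE.
  rewrite /Phi (_ : (fun i => w i : nat) = W); last by apply/funext => i; rewrite wE.
  rewrite -zono_merge; congr zono; apply/funext => j.
  by rewrite zE pgE embMn.
case=> w /=; rewrite finset.inE => /eqP we <-.
apply: zono_endpoint => [i|].
  split; first by apply: (coneZ C_cone) => //; exact: pvecC.
  by rewrite /= -embMn emb_lattice.
by rewrite -embMn -we emb_sum; apply: eq_bigr => i _; rewrite embMn.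
Qed.

Lemma zonotopes_card (B : {set conf}) : B \subset Om ->
  finite_set [set Phi w | w in [set w | w \in B]] /\
  card_set [set Phi w | w in [set w | w \in B]] = #|B|.
Proof.
move=> BO; have [|fin le] := @card_set_cover _ _ (enum B) [set Phi w | w in [set w | w \in B]] Phi.
  by move=> T [w wB <-]; exists w => //; rewrite mem_enum.
split=> //; apply/eqP; rewrite eqn_leq -{1}(cardE B) in le *.
rewrite (leq_trans le) //=.
apply: (@card_set_ge _ _ _ _ Phi) => //; first by move=> w w' _ _; exact: Phi_inj.
by move=> w wB; exists w.
Qed.

Lemma unif_prob_bounds (B : {set conf}) (S : set (set V)) :
  (forall w, w \in Om -> w \notin B -> S (Phi w)) ->
  1 - #|B|%:R / #|Om|%:R <= unif_prob R (zonotopes_with_endpoint C (n%:R *: emb R kz)) S <= 1.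
Proof.
move=> h; have [fO cO] := zonotopes_card (fintype.subxx Om).
rewrite /unif_prob zonotopesE cO.
have O0 : (0 : R) < #|Om|%:R by rewrite ltr0n Om_neq0.
rewrite -[X in X - _](@divff R #|Om|%:R) ?gt_eqF // -mulrBl.
have fOS : finite_set ([set Phi w | w in [set w | w \in Om]] `&` S).
  by apply: sub_finite_set fO => T [].
rewrite ler_pM2r ?invr_gt0 // ler_pdivrMr // mul1r ler_nat; apply/andP; split; last first.
  rewrite -cO /card_set; apply: fsubset_leq_card; by rewrite -fset_set_sub.
have [fB cB] := zonotopes_card (finset.subsetDl Om B).
rewrite lerBlDr -natrD ler_nat.
apply: (@leq_trans (#|Om :\: B| + #|B|)).
  by rewrite -(cardsID B Om) addnC leq_add2l subset_leq_card // finset.subsetIr.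
rewrite leq_add2r -cB /card_set; apply: fsubset_leq_card; rewrite -fset_set_sub //.
move=> T [w /=]; rewrite finset.inE => /andP[wB wO] <-; split; first by exists w.
exact: h.
Qed.

End Configurations.

(** * Typical multiplicity functions *)

Section LatticeFrame.
Variables (R : realType) (D : nat) (C : set 'rV[R]_D.+1) (kz : 'rV[int]_D.+1).
Hypothesis C_cone : convex_cone C.
Variable rho : R.
Hypothesis rho0 : 0 < rho.
Hypothesis rhoP : forall y, `|y| <= rho -> C (emb R kz + y).

(** The ball of radius [rho] around k, scaled by [s], still lies in [C]. *)
Lemma cone_absorb (s : R) (x : 'rV[R]_D.+1) : 0 <= s -> `|x| <= rho * s ->
  C (s *: emb R kz - x).
Proof.
rewrite le_eqVlt => /orP[/eqP <-|s0] h.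
  have -> : x = 0 by apply/eqP; rewrite -normr_le0 (le_trans h) // mulr0.
  by rewrite scale0r subr0; exact: cone0.
have -> : s *: emb R kz - x = s *: (emb R kz + - (s^-1 *: x)).
  by rewrite scalerDr scalerN scalerA divff ?gt_eqF // scale1r.
apply: (coneZ C_cone); first exact: ltW.
by apply: rhoP; rewrite normrN normrZ gtr0_norm ?invr_gt0 // mulrC ler_pdivrMr.
Qed.

(* The rows are [m kz + e_l]: for large [m] they lie in [C], and a relation between
   them forces [1 + m * (sum of kz) = 0], impossible for [m >= 2]. *)
Lemma cone_frame : exists (Bz : 'M[int]_D.+1) (Bm : nat),
  [/\ forall l, C (emb R (row l Bz)), map_mx intr Bz \in unitmx (R := R),
      (0 < Bm)%N & forall l c, `|Bz l c| <= Bm%:Z].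
Proof.
pose m := (`|Num.ceil rho^-1|%N + 2)%N.
have mR : rho^-1 <= m%:R.
  rewrite /m natrD natr_absz; apply: le_trans (ceil_ge _) _.
  apply: (@le_trans _ _ (`|Num.ceil rho^-1|%:~R)); last by rewrite lerDl.
  by rewrite ler_int ler_norm.
have m0 : (0 : R) < m%:R by rewrite ltr0n /m addn2.
pose Bz : 'M[int]_D.+1 := \matrix_(l, c) (kz 0 c *+ m + (l == c)%:Z).
exists Bz, (\sum_l \sum_c absz (Bz l c) + 1)%N; split; last first.
- move=> l c; rewrite -abszE lez_nat (bigD1 l) //= (bigD1 c) //=.
  by rewrite -!addnA leq_addr.
- by rewrite addn1.
- apply: unitmx_ker => z hz.
  pose s := \sum_c (kz 0 c)%:~R * z c 0.
  have zl l : z l 0 = - (m%:R * s).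
    have /matrixP/(_ l 0) := hz; rewrite !mxE.
    under eq_bigr => c _ do rewrite !mxE intrD int_mulrn intrM mulrDl.
    rewrite big_split /= [X in _ + X](bigD1 l) //= eqxx mul1r [X in _ + (_ + X)]big1 ?addr0; last first.
      by move=> c cl; rewrite eq_sym (negbTE cl) mul0r.
    under eq_bigr => c _ do rewrite mulrAC mulrC.
    by rewrite -mulr_sumr -/s => /eqP; rewrite addrC addr_eq0 => /eqP.
  pose sg := \sum_c kz 0 c.
  have hs : s * (1 + m%:Z * sg)%:~R = 0.
    have : s = - (m%:R * s) * sg%:~R.
      rewrite {1}/s /sg rmorph_sum /= mulr_sumr; apply: eq_bigr => c _.
      by rewrite zl mulrC.
    rewrite intrD intrM => h; rewrite mulrDr mulr1 {1}h; ring.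
  have nz : (1 + m%:Z * sg)%:~R != 0 :> R.
    have key (a : nat) (b : int) : 1 + (a + 2)%N%:Z * b != 0.
      apply/eqP; have [h|h|->] := ltgtP b 0; last by rewrite mulr0.
        have : 0 <= (a + 2)%N%:Z * (- 1 - b) by rewrite mulr_ge0 //; lia.
        lia.
      have : 0 <= (a + 2)%N%:Z * (b - 1) by rewrite mulr_ge0 //; lia.
      lia.
    by rewrite intr_eq0; exact: key.
  move/eqP: hs; rewrite mulf_eq0 (negbTE nz) orbF => /eqP s0.
  by apply/colP => l; rewrite zl s0 mulr0 oppr0 mxE.
- move=> l; have -> : emb R (row l Bz) = m%:R *: (emb R kz + m%:R^-1 *: delta_mx 0 l).
    apply/rowP => c; rewrite !mxE eqxx /= intrD int_mulrn intrM [c == l]eq_sym.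
    rewrite [RHS]mulrDr [X in _ = _ + X]mulrA divff ?(lt0r_neq0 m0) // mul1r [X in X + _]mulrC.
    by case: (l == c).
  apply: (coneZ C_cone); first exact: ltW.
  apply: rhoP; rewrite normrZ gtr0_norm ?invr_gt0 //.
  apply: (@le_trans _ _ m%:R^-1); last by rewrite -[leRHS]invrK lef_pV2 ?posrE // invr_gt0.
  rewrite ler_piMr ?invr_ge0 //; apply: norm_le_coord => // c; rewrite mxE.
  by case: (_ && _); rewrite ?normr0 ?normr1.
Qed.

End LatticeFrame.

(** * Rare configurations and faces of the others, at a fixed n *)

Section Counting.
Variables (R : realType) (D : nat) (C : set 'rV[R]_D.+1) (kz : 'rV[int]_D.+1).
Hypothesis D0 : (0 < D)%N.
Hypothesis C_cone : convex_cone C.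
Variable th : 'cV[R]_D.+1.
Hypothesis thP : forall x, C x -> `|x| <= dot x th.
Variable rho : R.
Hypothesis rho0 : 0 < rho.
Hypothesis rhoP : forall y, `|y| <= rho -> C (emb R kz + y).
Variables (Bz : 'M[int]_D.+1) (Bm : nat).
Hypothesis BC : forall l, C (emb R (row l Bz)).
Hypothesis Bunit : map_mx intr Bz \in unitmx (R := R).
Hypothesis Bbnd : forall l c, `|Bz l c| <= Bm%:Z.
Local Notation K := (dot (emb R kz) th).
Local Notation V := 'rV[R]_D.+1.

Lemma kzC : C (emb R kz).
Proof. by rewrite -[emb R kz]addr0; apply: rhoP; rewrite normr0 ltW. Qed.

Variables (n L : nat) (kap : R).
Hypothesis L0 : (0 < L)%N.
Hypothesis kap0 : 0 < kap.
Hypothesis kap1 : kap <= 1.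
Definition zbnd := (D.+1 * genW D L * Bm)%N.
(** This makes the sum of any part of an [Aj] affordable: at most L^(D+1) vectors of norm at most
    [zbnd], against the mass kap n k. *)
Hypothesis Lkap : (L ^ D.+1 * zbnd)%:R <= rho * (kap * n%:R).
Local Notation Y := {ffun 'I_D.+1 -> 'I_L}.
Local Notation I := (Pn C kz th n).
Local Notation vec := (@pvec R D C kz th n).
Local Notation conf := {ffun I -> 'I_(bn kz th n).+1}.
Local Notation Omn := (Om C kz th n).

Let vecC := pvecC thP kzC (n := n).
Let vec0 := pvec0 thP kzC (n := n).

Definition zv (j : 'I_D) (y : Y) : 'rV[int]_D.+1 := gen j y *m Bz.

Lemma emb_zv j y : emb R (zv j y) = emb R (gen j y) *m map_mx intr Bz.
Proof. by rewrite /emb /zv map_mxM. Qed.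

Lemma zvC j y : C (emb R (zv j y)).
Proof.
rewrite emb_zv mulmx_sum_row; apply: (cone_sum C_cone) => l _; rewrite -map_row.
apply: (coneZ C_cone); last exact: BC.
by rewrite embE ler0z; exact: ltW (gen_gt0 _ _ _).
Qed.

Lemma zv_le j y : `|emb R (zv j y)| <= zbnd%:R.
Proof.
apply: norm_le_coord => // c; rewrite embE -intr_norm -[_%:R]/(_%:Z%:~R) ler_int mxE.
apply: le_trans (ler_norm_sum _ _ _) _; rewrite /zbnd -mulnA PoszM.
rewrite -[D.+1%:Z]natz mulr_natl -[X in _ *+ X]card_ord -sumr_const; apply: ler_sum => l _.
by rewrite normrM PoszM ler_pM // gen_bnd.
Qed.

Lemma zv_neq0 j y : zv j y != 0.
Proof.
apply/eqP => h; have := gen_gt0 j y ord0.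
suff -> : gen j y = 0 by rewrite mxE ltxx.
apply: (@emb_inj R); rewrite emb0 -(mulmxK Bunit (emb R (gen j y))) -emb_zv h emb0.
by rewrite mul0mx.
Qed.

Lemma small_dot x : C x -> `|x| <= rho * (kap * n%:R) -> dot x th <= n%:R * K.
Proof.
move=> Cx xs; have kn : 0 <= kap * n%:R by rewrite mulr_ge0 // ltW.
have := thP_ge0 thP (cone_absorb C_cone rhoP kn xs); rewrite dotBl dotZl subr_ge0 => h.
apply: le_trans h _; rewrite -mulrA ler_piMl // mulr_ge0 //.
exact: (thP_ge0 thP kzC).
Qed.

Lemma zbnd_small : zbnd%:R <= rho * (kap * n%:R).
Proof.
apply: le_trans Lkap; rewrite ler_nat -{1}[zbnd]mul1n leq_mul2r expn_gt0 L0 orbT.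
by [].
Qed.

Lemma dir_ex (jy : 'I_D * Y) : exists ig : I * nat,
  (0 < ig.2)%N /\ zv jy.1 jy.2 = vec ig.1 *+ ig.2.
Proof.
case: jy => j y /=; have [p [g [pp g0 e]]] := primitive_decomp (zv_neq0 j y).
have gR : (0 : R) < g%:R by rewrite ltr0n.
have pE : emb R p = g%:R^-1 *: emb R (zv j y).
  by rewrite e embMn scalerA mulVf ?gt_eqF // scale1r.
have pC : C (emb R p).
  by rewrite pE; apply: (coneZ C_cone); [rewrite invr_ge0 ltW|exact: zvC].
have [|i iE] := @prims_ex R D C kz th thP kzC n p; last by exists (i, g); rewrite /= iE.
split=> //; apply: small_dot => //; apply: le_trans zbnd_small.
apply: le_trans (zv_le j y); rewrite pE normrZ gtr0_norm ?invr_gt0 //.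
by rewrite ler_piMl // invf_le1 // ler1n.
Qed.

Definition dirg jy := projT1 (cid (dir_ex jy)).
Definition dir j y : I := (dirg (j, y)).1.
Definition dmul j y : nat := (dirg (j, y)).2.

Lemma dmul_gt0 j y : (0 < dmul j y)%N.
Proof. by rewrite /dmul /dirg; case: cid => ig []. Qed.

Lemma zv_dir j y : zv j y = vec (dir j y) *+ dmul j y.
Proof. by rewrite /dmul /dir /dirg; case: cid => ig []. Qed.

(** The frame is invertible, so equal directions in [C] come from parallel [gen] vectors, and these
    coincide on [cop]. *)
Lemma dir_inj j : {in cop D L &, injective (dir j)}.
Proof.
move=> y y' yc yc' e.
apply: (@cop_parallel D L j y y' (dmul j y') (dmul j y)); rewrite ?dmul_gt0 //.
apply: (@emb_inj R); rewrite -[LHS](mulmxK Bunit) -[RHS](mulmxK Bunit); congr (_ *m _).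
rewrite !embMn -!scalemxAl -!emb_zv !zv_dir e !embMn !scalerA; congr (_ *: _).
by rewrite mulrC.
Qed.

Definition Aj j : {set I} := [set dir j y | y in cop D L].

Lemma card_Aj j : #|Aj j| = #|cop D L|.
Proof. by rewrite card_in_imset //; exact: dir_inj. Qed.

Lemma vec_Aj j i : i \in Aj j -> `|emb R (vec i)| <= zbnd%:R.
Proof.
move=> /imsetP[y _ ->]; apply: le_trans (zv_le j y); rewrite zv_dir embMn normrZ normr_nat.
by rewrite ler_peMl // ler1n dmul_gt0.
Qed.

Lemma Aj_absorb j (B : {set I}) : B \subset Aj j ->
  C (kap *: emb R (kz *+ n) - emb R (\sum_(i in B) vec i)).
Proof.
move=> BA; rewrite embMn scalerA; apply: (cone_absorb C_cone rhoP).
  by rewrite mulr_ge0 // ltW.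
apply: le_trans Lkap; rewrite emb_sum; apply: le_trans (ler_norm_sum _ _ _) _.
apply: (@le_trans _ _ (\sum_(i in B) zbnd%:R)).
  by apply: ler_sum => i iB; apply: (@vec_Aj j); exact: (fintype.subsetP BA).
rewrite sumr_const -[leLHS]mulr_natl natrM ler_wpM2r // ler_nat.
apply: leq_trans (subset_leq_card BA) _; rewrite card_Aj (leq_trans (max_card _)) //.
by rewrite card_ffun !card_ord.
Qed.

Local Notation ll := (ell th vec).

Definition badj j : {set conf} :=
  bad vec (kz *+ n) (bn kz th n) (Aj j) (#|Aj j| %/ 16)%N.

Lemma rad_ell i : (rad (vec i))%:R <= ll i.
Proof. by apply: le_trans (rad_norm _ _) _; apply: thP; exact: vecC. Qed.

Section BadRatio.
Variables (N : R) (q : nat).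
Hypothesis N1 : 1 <= N.
Hypothesis Nn : N ^+ D.+2 = n%:R.
Hypothesis hq : D.+2%:R <= kap ^+ D.+2 * q.+1%:R.

Let Bq : R := (2 * q.+1 + 1)%:R ^+ D.+1.
Let X1 := expR (kap * (K + c5 R D) * N ^+ D.+1 + Bq * N).
Let X2 := expR (kap * (K + c5 R D) * N ^+ D.+1 + Bq * (N / kap)).

Let N0 : 0 < N.
Proof. exact: lt_le_trans N1. Qed.

Let massE (t : R) : t / N * dot (emb R (kz *+ n)) th = t * K * N ^+ D.+1.
Proof. by rewrite endpE -Nn exprSr; field; rewrite gt_eqF. Qed.

(** At t = 1/N both the mass term and the density term are of order kap N^(D+1): the mass is kap n K
    and the classes have density at most kap. *)
Let full_count (F : {set 'I_q.+1}) : #|F|%:R <= kap * q.+1%:R ->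
  #|restr_conf (bn kz th n) (class (rescl vec q) F) ll (kap * dot (emb R (kz *+ n)) th)|%:R <= X1.
Proof.
move=> hF.
have t0 : 0 < N^-1 by rewrite invr_gt0.
apply: le_trans (@restr_conf_count _ _ _ _ ll N^-1 _ t0 _) _.
  by move=> i _; apply: lt_le_trans (ell_ge1 thP vecC vec0 i).
rewrite ler_expR.
have t1 : 0 < N^-1 <= 1 by rewrite t0 invf_le1.
have cb := class_bose (@pvec_inj R D C kz th n) vec0 F D0 t1 rad_ell.
apply: le_trans (lerD (lexx _) cb) _.
have -> : N^-1 * (kap * dot (emb R (kz *+ n)) th) = kap * K * N ^+ D.+1.
  by rewrite -massE; ring.
have hc : #|F|%:R * (c5 R D / q.+1%:R) <= kap * c5 R D.
  rewrite mulrA mulrAC ler_wpM2r ?c5_ge0 //.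
  by rewrite ler_pdivrMr.
have ND : 0 <= N ^+ D.+1 by rewrite exprn_ge0 // ltW.
have := ler_wpM2r ND hc; rewrite invrK -exprVn invrK -/Bq.
move: (N ^+ D.+1) (#|F|%:R * _) (Bq * N) => x y z; lra.
Qed.

(** Here the mass is not small, so t is lowered to kap/N. The density term then gains a factor
    kap^-(D+1), which [hq] compensates because only [D.+2] classes are involved. *)
Let frac_count (F : {set 'I_q.+1}) : (#|F| <= D.+2)%N ->
  #|restr_conf (bn kz th n) (class (rescl vec q) F) ll (dot (emb R (kz *+ n)) th)|%:R <= X2.
Proof.
move=> hF.
have t0 : 0 < kap / N by rewrite divr_gt0.
apply: le_trans (@restr_conf_count _ _ _ _ ll (kap / N) _ t0 _) _.
  by move=> i _; apply: lt_le_trans (ell_ge1 thP vecC vec0 i).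
rewrite ler_expR massE.
have t1 : 0 < kap / N <= 1.
  by rewrite t0 ler_pdivrMr // mul1r (le_trans kap1).
have cb := class_bose (@pvec_inj R D C kz th n) vec0 F D0 t1 rad_ell.
apply: le_trans (lerD (lexx _) cb) _.
rewrite -/Bq invf_div.
have -> : kap * (K + c5 R D) * N ^+ D.+1 + Bq * (N / kap) =
    kap * K * N ^+ D.+1 + (Bq * (N / kap) + kap * c5 R D * N ^+ D.+1) by ring.
rewrite !lerD2l expr_div_n.
have kD : 0 < kap ^+ D.+1 by rewrite exprn_gt0.
have ND : 0 < N ^+ D.+1 by rewrite exprn_gt0.
have -> : #|F|%:R * (c5 R D / q.+1%:R) / (kap ^+ D.+1 / N ^+ D.+1) =
    #|F|%:R / (kap ^+ D.+1 * q.+1%:R) * (c5 R D * N ^+ D.+1).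
  by field; rewrite !gt_eqF.
rewrite -[leRHS]mulrA ler_wpM2r //; first by rewrite mulr_ge0 ?c5_ge0 // ltW.
rewrite ler_pdivrMr ?mulr_gt0 // mulrA -exprS; apply: le_trans hq.
by rewrite ler_nat.
Qed.

(** The power of 4 pays for two sets of classes, the polynomial factor for the filled vector, and
    the negative exponent is the net gain of [subs_gain]. *)
Lemma bad_ratio j : #|badj j|%:R <= #|Omn|%:R * (4 ^+ q.+1 * (2 * (n%:R * K) + 1) ^+ D.+1 *
  expR (2 * kap * (K + c5 R D) * N ^+ D.+1 + Bq * N * (1 + kap^-1) - #|cop D L|%:R / 4)).
Proof.
have nat_le (X : R) (m : nat) : m%:R <= X -> (m <= `|Num.floor X|)%N.
  move=> h; have X0 : 0 <= X by apply: le_trans h.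
  by rewrite -lez_nat gez0_abs ?floor_ge0 // floor_ge_int.
have le_nat (X : R) : 0 <= X -> `|Num.floor X|%N%:R <= X.
  by move=> X0; rewrite natr_absz ger0_norm ?floor_ge0 // floor_le.
have kap01 : 0 <= kap <= 1 by rewrite ltW.
have h := @switching_card R D C th C_cone thP I vec vecC vec0 (kz *+ n) (bn kz th n)
  (bnP thP kzC n) (@fill_exists R D C kz C_cone th thP kzC n) q.+1 (rescl vec q) kap kap01 (Aj j)
  (@Aj_absorb j) (#|Aj j| %/ 16)%N `|Num.floor X1|%N `|Num.floor X2|%N
  (fun F hF => nat_le _ _ (full_count hF)) (fun F hF => nat_le _ _ (frac_count hF)).
move: h; rewrite -/(badj j) -/Omn -(ler_nat R) !natrM !natrX => h.
have p2 : (0 : R) < 2 ^+ (#|Aj j| - #|Aj j| %/ 16) by rewrite exprn_gt0.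
rewrite -(ler_pM2r p2); apply: le_trans h _.
have b1 : (2 * bn kz th n + 1)%:R <= 2 * (n%:R * K) + 1 :> R.
  by rewrite natrD natrM lerD2r ler_pM2l // (bn_le thP kzC).
have n0 : 0 <= 2 * (n%:R * K) + 1 :> R by apply: le_trans b1.
have s1 := @subs_gain R _ (Aj j).
apply: (@le_trans _ _ (#|Omn|%:R * (2 ^+ q.+1 * 2 ^+ q.+1 * (X1 * X2)) *
    (2 * (n%:R * K) + 1) ^+ D.+1 *
    (2 ^+ (#|Aj j| - #|Aj j| %/ 16) * expR (- #|Aj j|%:R / 4)))).
  apply: ler_pM; [|by []| |exact: s1]; first by rewrite ?(mulr_ge0, exprn_ge0).
  apply: ler_pM; [|by rewrite exprn_ge0| |by rewrite lerXn2r ?nnegrE].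
    by rewrite ?(mulr_ge0, exprn_ge0).
  apply: ler_wpM2l => //; apply: ler_wpM2l; first by rewrite ?(mulr_ge0, exprn_ge0).
  by apply: ler_pM => //; rewrite le_nat ?expR_ge0.
rewrite card_Aj le_eqVlt; apply/orP; left; apply/eqP.
have f4 : (4 : R) ^+ q.+1 = 2 ^+ q.+1 * 2 ^+ q.+1 by rewrite -exprMn -natrM.
have -> : expR (2 * kap * (K + c5 R D) * N ^+ D.+1 + Bq * N * (1 + kap^-1) - #|cop D L|%:R / 4) =
    X1 * X2 * expR (- #|cop D L|%:R / 4).
  by rewrite /X1 /X2 -!expRD; congr expR; ring.
rewrite f4; move: (2 ^+ q.+1) (2 ^+ (_ - _)) (_ ^+ D.+1) (expR _) X1 X2 => a1 a2 a3 a4 a5 a6.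
ring.
Qed.

(** Generators of radius at most N are counted in a box; each further one uses at least N of the
    total mass n K = K N^(D+2). *)
Lemma nz_bound (w : conf) : w \in Omn ->
  #|nzgen (fun i => (w i)%:R *: emb R (vec i))|%:R <= (3 ^+ D.+1 + K) * N ^+ D.+1.
Proof.
rewrite finset.inE => /eqP we; set S := nzgen _; pose J := `|Num.floor N|%N.
have JN : J%:R <= N by rewrite /J natr_absz ger0_norm ?floor_ge0 ?(ltW N0) // floor_le.
have NJ : N < J.+1%:R.
  rewrite /J -natr1 natr_absz ger0_norm ?floor_ge0 ?(ltW N0) //.
  by have := floorD1_gt N; rewrite intrD.
pose S1 : {set I} := [set i | (rad (vec i) <= J)%N]%SET.
have c1 : #|S1|%:R <= 3 ^+ D.+1 * N ^+ D.+1.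
  apply: (@le_trans _ _ ((2 * J + 1) ^ D.+1)%:R).
    by rewrite ler_nat card_rad_le //; exact: pvec_inj.
  rewrite natrX -exprMn lerXn2r ?nnegrE ?mulr_ge0 ?(ltW N0) // natrD natrM.
  by move: (J%:R) JN => x JN; have h1 := N1; lra.
have c2 : #|S :\: S1|%:R <= K * N ^+ D.+1.
  rewrite -(ler_pM2r N0) -mulrA -exprSr Nn [leRHS]mulrC -endpE -we -mass_sum.
  apply: (@le_trans _ _ (\sum_(i in S :\: S1) (w i)%:R * ll i)).
    rewrite mulr_natl -sumr_const; apply: ler_sum => i.
    rewrite !finset.inE -ltnNge => /andP[rJ nz].
    have w1 : (1 : R) <= (w i)%:R.
      by rewrite ler1n lt0n; apply: contraNneq nz => ->; rewrite scale0r.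
    apply: (@le_trans _ _ (ll i)); last by rewrite ler_peMl // (ell_ge0 thP vecC vec0).
    by apply: le_trans (rad_ell i); apply: le_trans (ltW NJ) _; rewrite ler_nat.
  rewrite big_mkcond; apply: ler_sum => i _; case: ifP => // _.
  by rewrite mulr_ge0 // (ell_ge0 thP vecC vec0).
apply: (@le_trans _ _ (#|S1|%:R + #|S :\: S1|%:R)); last by rewrite mulrDl lerD.
rewrite -natrD ler_nat -(cardsID S1 S) leq_add2r subset_leq_card //.
exact: finset.subsetIr.
Qed.

End BadRatio.

Section Lower.
Variable w : conf.
Hypothesis wO : w \in Omn.
Hypothesis wgood : forall j, w \notin badj j.

Definition Ej j : {set Y} := [set y in cop D L | w (dir j y) != ord0].

(** 64 is 4 from the density of [cop] times 16 from the definition of bad. *)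
Lemma card_Ej j : (L ^ D.+1 <= 64 * #|Ej j|)%N.
Proof.
have := wgood j; rewrite finset.inE wO /= -ltnNge => h.
have le : (#|asupp (Aj j) w| <= #|Ej j|)%N.
  apply: (@leq_trans #|[set dir j y | y in Ej j]%SET|); last exact: leq_imset_card.
  apply: subset_leq_card; apply/fintype.subsetP => i; rewrite finset.inE => /andP[/imsetP[y yc ->] nz].
  by apply/imsetP; exists y => //; rewrite finset.inE yc.
have {h le} := leq_trans h le.
have := card_cop R D0 L0; rewrite -(card_Aj j).
have := ltn_ceil #|Aj j| (isT : (0 < 16)%N).
move: (L ^ D.+1)%N #|Ej j| #|Aj j| (#|Aj j| %/ 16)%N => a b c e; lia.
Qed.

Let BR : 'M[R]_D.+1 := map_mx intr Bz.

Let dotK (x : V) (u : 'cV[R]_D.+1) : dot (x *m BR) (invmx BR *m u) = dot x u.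
Proof. by rewrite /dot mulmxA mulmxK. Qed.

Let o (l : nat) : 'I_D := insubd (Ordinal D0) l.

Let oE (l : nat) : (l < D)%N -> o l = l :> nat.
Proof. by move=> h; rewrite /o val_insubd h. Qed.

Let oK (l : 'I_D) : o l = l.
Proof. by apply: val_inj; exact: oE. Qed.

Local Notation Tup := {ffun 'I_D -> Y}.
Let X (t : Tup) (j : 'I_D) : V := emb R (gen j (t j)).
Let domX (t : Tup) (j : 'I_D) := gen_dom R j (t j).
Let vg (i : I) : V := (w i)%:R *: emb R (vec i).
Let cc (t : Tup) (j : 'I_D) : R := (w (dir j (t j)))%:R / (dmul j (t j))%:R.

Let vgE (t : Tup) j : vg (dir j (t j)) = cc t j *: (X t j *m BR).
Proof.
have g0 : (dmul j (t j))%:R != 0 :> R by rewrite pnatr_eq0 -lt0n dmul_gt0.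
by rewrite -emb_zv zv_dir embMn /vg scalerA divfK.
Qed.

Lemma faces_lower (Delta : nat) : exists g : nat,
  [/\ forall i : 'I_D.+1, (g <= num_faces i (Phi w))%N, (g <= num_towers (Phi w))%N &
    (Delta.+1 ^ D * (\prod_j #|Ej j| - Delta * (3 * packQ D L) ^ D) <= g * packQ D L ^ D)%N].
Proof.
have [G [GE Ginj Gc]] := @many_normals R D L Ej Delta L0.
exists #|G|.
have ccp t j : t \in G -> 0 < cc t j.
  move=> tG; rewrite divr_gt0 ?ltr0n ?dmul_gt0 //.
  by have := GE t tG j; rewrite finset.inE => /andP[_]; rewrite lt0n.
have dE (y : V) (l : 'I_D) (t : Tup) : dot (y *m BR)
    ((cc t l)^-1 *: (invmx BR *m dualv (X t) l)) = (cc t l)^-1 * dot y (dualv (X t) l).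
  by rewrite dotZr dotK.
(* Normals and dual vectors are built in frame coordinates and transported by the inverse frame;
   dividing by [cc] makes the duals match the generators with their multiplicities. *)
have [||||h1 h2] := @many_faces R D I vg _ G (fun t => invmx BR *m nrm R t)
  (fun t l => (cc t (o l))^-1 *: (invmx BR *m dualv (X t) (o l)))
  (fun t l => dir (o l) (t (o l))).
- move=> t l tG _; rewrite vgE dotZl dotK (_ : dot _ _ = 0) ?mulr0 //.
  exact: (normal_dot (domX t)).
- move=> t l m tG lD mD; rewrite vgE dotZl dE (dualv_dot (domX t)).
  rewrite -val_eqE /= !oE //; case: (eqVneq l m) => [->|_]; last by rewrite !mulr0.
  by rewrite mulr1 divff // gt_eqF // ccp.
- move=> t x tG; rewrite -{1}(mulmxKV Bunit x) dotK => x0.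
  rewrite -{1}(mulmxKV Bunit x) {1}(fullmx_decomp (domX t) (x *m invmx BR)).
  rewrite -/(nrm R t) x0 scale0r addr0 mulmx_suml; apply: eq_bigr => l _.
  rewrite oK vgE -scalemxAl -[in RHS](mulmxKV Bunit x) dE scalerA; congr (_ *: _).
  by rewrite mulrC mulrA divff ?mul1r // gt_eqF // ccp.
(* Both normals have last coordinate 1, so their difference satisfies [dominant_sep] and vanishes;
   [Ginj] concludes. *)
- move=> t t' tG t'G p1 p2; apply: (Ginj) => //; apply/esym/eqP; rewrite -subr_eq0; apply/eqP.
  apply: (dominant_sep (domX t) (domX t')).
  + have nm s : nrm R s ord_max 0 = 1 := normal_max (domX s).
    by rewrite [LHS]mxE [(- nrm R t) _ _]mxE !nm subrr.
  + move=> j; rewrite dotDr dotNr (normal_dot (domX t)) subr0.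
    have := p1 j (ltn_ord j); rewrite oK vgE dotZl dotK pmulr_rge0 //; exact: ccp.
  + move=> j; rewrite dotDr dotNr (normal_dot (domX t')) sub0r oppr_le0.
    have := p2 j (ltn_ord j); rewrite oK vgE dotZl dotK pmulr_rge0 //; exact: ccp.
by split.
Qed.

End Lower.

Lemma good_configurations (N : R) (q : nat) :
  1 <= N -> N ^+ D.+2 = n%:R -> D.+2%:R <= kap ^+ D.+2 * q.+1%:R ->
  exists Bd : {set conf},
    #|Bd|%:R <= D%:R * (#|Omn|%:R * (4 ^+ q.+1 * (2 * (n%:R * K) + 1) ^+ D.+1 *
      expR (2 * kap * (K + c5 R D) * N ^+ D.+1 +
        (2 * q.+1 + 1)%:R ^+ D.+1 * N * (1 + kap^-1) - #|cop D L|%:R / 4))) /\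
    forall w, w \in Omn -> w \notin Bd -> forall Delta : nat, exists (g : nat) (E : 'I_D -> nat),
      [/\ forall j, (L ^ D.+1 <= 64 * E j)%N,
          forall i : 'I_D.+1, (g <= num_faces i (Phi w))%N, (g <= num_towers (Phi w))%N &
          (Delta.+1 ^ D * (\prod_j E j - Delta * (3 * packQ D L) ^ D) <= g * packQ D L ^ D)%N].
Proof.
move=> N1 Nn hq; exists (\bigcup_j badj j)%SET; split.
  have le : (#|(\bigcup_j badj j)%SET| <= \sum_j #|badj j|)%N.
    elim/big_rec2: _ => [|j m A _ h]; first by rewrite cards0.
    by apply: leq_trans (leq_card_setU _ _) _; rewrite leq_add2l.
  rewrite -(ler_nat R) natr_sum in le; apply: le_trans le _.
  rewrite mulr_natl -[X in _ *+ X]card_ord -sumr_const; apply: ler_sum => j _.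
  exact: bad_ratio.
move=> w wO wB Delta.
have wg j : w \notin badj j.
  by apply: contra wB => h; apply/finset.bigcupP; exists j.
have [g [h1 h2 h3]] := faces_lower w Delta.
by exists g, (fun j => #|Ej w j|); split=> // j; exact: card_Ej.
Qed.

End Counting.

(** * Asymptotics *)

Section Asymptotics.
Variable R : realType.

(** The product is of order l^((D+1)D), [Delta] of order l^D and packQ^D of order l^(D D), so powers
    from [Delta] and [packQ] cancel. The constant [dl] makes the subtracted tuples at most half of
    the product bound. *)
Lemma lower_estimate (D L Delta g : nat) (E : 'I_D -> nat) (l c10 dl : R) :
  (0 < L)%N -> l = L%:R -> c10 = (2 * (D.+2 * (2 * D + 3)) + 1)%:R ->
  dl = (64 ^+ D * 2 * (3 ^+ D * c10 ^+ (D * D)))^-1 ->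
  Delta = `|Num.floor (dl * l ^+ D)|%N ->
  (forall j, (L ^ D.+1 <= 64 * E j)%N) ->
  (Delta.+1 ^ D * (\prod_j E j - Delta * (3 * packQ D L) ^ D) <= g * packQ D L ^ D)%N ->
  dl ^+ D / (64 ^+ D * 2 * c10 ^+ (D * D)) * l ^+ (D.+1 * D) <= g%:R.
Proof.
move=> L0 lE cE dE De hE hg.
have l1 : 1 <= l by rewrite lE ler1n.
have l0 : 0 < l by lra.
have c0 : 0 < c10 by rewrite cE ltr0n addn1.
have p64 : (0 : R) < 64 ^+ D by rewrite exprn_gt0.
have p3 : (0 : R) < 3 ^+ D by rewrite exprn_gt0.
have cD : 0 < c10 ^+ (D * D) by rewrite exprn_gt0.
have dl0 : 0 < dl by rewrite dE invr_gt0 !mulr_gt0.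
have lD : 0 < l ^+ D by rewrite exprn_gt0.
have x0 : 0 <= dl * l ^+ D by rewrite mulr_ge0 // ltW.
have De1 : Delta%:R <= dl * l ^+ D.
  by rewrite De natr_absz ger0_norm ?floor_ge0 // floor_le.
have De2 : dl * l ^+ D <= Delta.+1%:R.
  rewrite De -natr1 natr_absz ger0_norm ?floor_ge0 //.
  by have := floorD1_gt (dl * l ^+ D); rewrite intrD => /ltW.
have Q1 : (packQ D L)%:R <= (c10 * l) ^+ D.
  rewrite /packQ natrX lerXn2r ?nnegrE ?mulr_ge0 ?(ltW c0) ?(ltW l0) //.
  by rewrite cE lE -natrM ler_nat /genW; nia.
have Q0 : 0 <= (packQ D L)%:R :> R by [].
have QD : (packQ D L)%:R ^+ D <= c10 ^+ (D * D) * l ^+ (D * D).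
  rewrite -exprMn exprM lerXn2r ?nnegrE // exprn_ge0 // mulr_ge0 ?(ltW c0) ?(ltW l0) //.
have ll : l ^+ (D.+1 * D) = l ^+ D * l ^+ (D * D) by rewrite -exprD mulSn.
have prodE : 64 ^- D * l ^+ (D.+1 * D) <= (\prod_j E j)%:R.
  rewrite natr_prod exprM -exprVn -exprMn -[X in _ ^+ X]card_ord -prodr_const.
  apply: ler_prod => j _; rewrite mulr_ge0 ?exprn_ge0 ?(ltW l0) //=.
  by rewrite mulrC ler_pdivrMr // lE -natrX mulrC -natrM ler_nat.
have subE : (Delta * (3 * packQ D L) ^ D)%:R <= 64 ^- D / 2 * l ^+ (D.+1 * D).
  rewrite natrM natrX natrM exprMn.
  apply: (@le_trans _ _ (dl * l ^+ D * (3 ^+ D * (c10 ^+ (D * D) * l ^+ (D * D))))).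
    by apply: ler_pM => //; rewrite ler_pM2l.
  rewrite ll dE le_eqVlt; apply/orP; left; apply/eqP.
  by field; rewrite !gt_eqF.
have diff : 64 ^- D / 2 * l ^+ (D.+1 * D) <=
    (\prod_j E j - Delta * (3 * packQ D L) ^ D)%N%:R.
  apply: (@le_trans _ _ ((\prod_j E j)%:R - (Delta * (3 * packQ D L) ^ D)%:R)).
    move: prodE subE; move: (l ^+ _) (64 ^- D) (\prod_j _)%:R (_ * _)%:R => a b c e; lra.
  by rewrite lerBlDr -natrD ler_nat addnC -leq_subLR.
have {}hg : Delta.+1%:R ^+ D * (\prod_j E j - Delta * (3 * packQ D L) ^ D)%N%:R <=
    g%:R * (packQ D L)%:R ^+ D :> R by rewrite -!natrX -!natrM ler_nat.
have lDD : 0 < l ^+ (D * D) by rewrite exprn_gt0.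
have main : (dl * l ^+ D) ^+ D * (64 ^- D / 2 * l ^+ (D.+1 * D)) <=
    g%:R * (c10 ^+ (D * D) * l ^+ (D * D)).
  apply: (@le_trans _ _ (g%:R * (packQ D L)%:R ^+ D)); last by rewrite ler_wpM2l.
  apply: le_trans hg; apply: ler_pM => //.
  - by rewrite exprn_ge0.
  - by rewrite !mulr_ge0 ?invr_ge0 ?exprn_ge0 ?(ltW l0).
  - by rewrite lerXn2r ?nnegrE.
move: main; rewrite -ler_pdivrMr ?mulr_gt0 // => main; apply: le_trans main.
rewrite exprMn -exprM le_eqVlt; apply/orP; left; apply/eqP.
have := lt0r_neq0 lDD; move: (l ^+ (D * D)) (l ^+ (D.+1 * D)) (dl ^+ D) => a b c a0.
by field; rewrite a0 !gt_eqF.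
Qed.

(** Since D > 0, x^(D+1) beats be x and leaves exp(-x), which is at most (m+1)!/x^(m+1); [m] is the
    degree of the polynomial factor. *)
Lemma decay (a be c6 K : R) (D : nat) : (0 < D)%N -> 0 <= a -> 0 <= be -> 0 < c6 -> 0 <= K ->
  exists c x0 : R, [/\ 0 <= c, 1 <= x0 & forall x, x0 <= x ->
    a * (2 * (x ^+ D.+2 * K) + 1) ^+ D.+1 * expR (be * x - c6 * x ^+ D.+1) <= c / x].
Proof.
move=> D0 a0 be0 c60 K0; pose m := (D.+2 * D.+1)%N.
exists (a * (2 * K + 1) ^+ D.+1 * m.+1`!%:R), (1 + (be + 1) / c6); split.
- by rewrite !mulr_ge0 // exprn_ge0 // addr_ge0 // mulr_ge0.
- by rewrite lerDl divr_ge0 ?(ltW c60) // addr_ge0.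
move=> x xx.
have b1 : 0 <= (be + 1) / c6 by rewrite divr_ge0 ?(ltW c60) // addr_ge0.
have x1 : 1 <= x by lra.
have x0 : 0 < x by lra.
have p1 : (2 * (x ^+ D.+2 * K) + 1) ^+ D.+1 <= (2 * K + 1) ^+ D.+1 * x ^+ m.
  have xD : 1 <= x ^+ D.+2 by rewrite exprn_ege1.
  have q1 : 0 <= x ^+ D.+2 * K by rewrite mulr_ge0 // (le_trans _ xD).
  have q2 : 0 <= (2 * K + 1) * x ^+ D.+2.
    by rewrite mulr_ge0 ?(le_trans _ xD) // addr_ge0 // mulr_ge0.
  have q3 : 0 <= 2 * (x ^+ D.+2 * K) + 1 by lra.
  rewrite /m exprM -exprMn lerXn2r ?nnegrE //.
  by move: (x ^+ D.+2) xD => y y1; nra.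
have p2 : expR (be * x - c6 * x ^+ D.+1) <= expR (- x).
  rewrite ler_expR.
  have h1 : be + 1 <= c6 * x.
    have : (be + 1) / c6 <= x by lra.
    by rewrite ler_pdivrMr // mulrC.
  have h2 : x * x <= x ^+ D.+1.
    by rewrite exprS ler_pM2l // ler_eXnr.
  have h3 : c6 * (x * x) <= c6 * x ^+ D.+1 by rewrite ler_pM2l.
  nra.
have p3 : expR (- x) <= m.+1`!%:R / x ^+ m.+1.
  have f0 : (0 : R) < m.+1`!%:R by rewrite ltr0n fact_gt0.
  rewrite expRN -[leRHS]invrK lef_pV2 ?posrE ?expR_gt0 ?invr_gt0 ?divr_gt0 ?exprn_gt0 //.
  rewrite invf_div; have := expR_ge1Dxn m (ltW x0); lra.
apply: (@le_trans _ _ (a * ((2 * K + 1) ^+ D.+1 * x ^+ m) * (m.+1`!%:R / x ^+ m.+1))).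
  have xD : 0 <= x ^+ D.+2 by rewrite exprn_ge0 // ltW.
  have q0 : 0 <= (2 * (x ^+ D.+2 * K) + 1) ^+ D.+1.
    by rewrite exprn_ge0 // addr_ge0 // mulr_ge0 // mulr_ge0.
  apply: ler_pM; [exact: mulr_ge0|exact: expR_ge0|exact: ler_wpM2l|exact: le_trans p2 p3].
rewrite [x ^+ m.+1]exprS le_eqVlt; apply/orP; left; apply/eqP.
have xm : x ^+ m != 0 by rewrite lt0r_neq0 // exprn_gt0.
move: (x ^+ m) ((2 * K + 1) ^+ D.+1) (m.+1`!%:R) xm => y b c y0; field.
by rewrite y0 gt_eqF.
Qed.

Definition scale (D n : nat) : R := n%:R `^ (D.+2%:R^-1).

Lemma scaleX D n : scale D n ^+ D.+2 = n%:R.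
Proof.
by rewrite /scale -powR_mulrn ?powR_ge0 // -powRrM mulVf ?pnatr_eq0 // powRr1.
Qed.

Lemma growthE D n : growth R D.+1 n = scale D n ^+ (D.+1 * D).
Proof.
rewrite /growth /scale -powR_mulrn ?powR_ge0 // -powRrM subn1 /= addn1.
by rewrite mulrC.
Qed.

Lemma scale_ge D n (x : R) : 0 <= x -> x ^+ D.+2 <= n%:R -> x <= scale D n.
Proof.
move=> x0 h; rewrite leNgt; apply/negP => lt.
have : scale D n ^+ D.+2 < x ^+ D.+2 by rewrite ltrXn2r ?nnegrE ?powR_ge0.
by rewrite scaleX ltNge h.
Qed.

End Asymptotics.

Lemma scale_squeeze (R : realType) (D : nat) (f : nat -> R) (cc x1 : R) : 0 <= cc ->
  (forall n, x1 <= scale R D n -> 1 - cc / scale R D n <= f n <= 1) ->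
  f @ \oo --> (1 : R).
Proof.
move=> cc0 h; apply/cvgrPdist_le => e e0.
pose X := `|x1| + cc / e + 1.
have X0 : 0 < X by rewrite ltr_wpDl // addr_ge0 // divr_ge0 // ltW.
pose n0 := `|Num.ceil (X ^+ D.+2)|%N.
have n0P : X ^+ D.+2 <= n0%:R.
  rewrite /n0 natr_absz; apply: le_trans (ceil_ge _) _.
  by rewrite ler_int ler_norm.
apply: filterS (nbhs_infty_ge n0) => n /= n0n.
have XN : X <= scale R D n.
  by apply: scale_ge; rewrite ?(ltW X0) //; apply: le_trans n0P _; rewrite ler_nat.
have x1N : x1 <= scale R D n.
  have c1 : 0 <= cc / e by rewrite divr_ge0 // ltW.
  by apply: le_trans XN; rewrite /X; have := ler_norm x1; lra.
have N0 : 0 < scale R D n := lt_le_trans X0 XN.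
have /andP[h1 h2] := h n x1N.
rewrite ger0_norm ?subr_ge0 //.
have : cc / scale R D n <= e.
  rewrite ler_pdivrMr // mulrC -ler_pdivrMr //; apply: le_trans XN.
  by rewrite /X -addrA addrCA lerDl addr_ge0.
lra.
Qed.

(** * Choice of the constants and conclusion *)

Section Final.
Variables (R : realType) (D : nat) (C : set 'rV[R]_D.+1) (kz : 'rV[int]_D.+1).
Hypothesis D0 : (0 < D)%N.
Hypothesis C_cone : convex_cone C.
Variable th : 'cV[R]_D.+1.
Hypothesis thP : forall x, C x -> `|x| <= dot x th.
Variable rho : R.
Hypothesis rho0 : 0 < rho.
Hypothesis rhoP : forall y, `|y| <= rho -> C (emb R kz + y).
Local Notation K := (dot (emb R kz) th).

Let kC : C (emb R kz) := kzC rho0 rhoP.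

(** The cost A eps^(D+2), which is kappa, has one more factor eps than the gain on the right, so a
    small eps suffices; t/(t+s) makes eps <= 1 and eps s <= t hold together. *)
Lemma choose_eps (A : R) : 0 < A -> exists eps : R,
  [/\ 0 < eps, eps <= 1, A * eps ^+ D.+2 <= 1 &
      2 * (A * eps ^+ D.+2) * (K + c5 R D) <= (eps / 2) ^+ D.+1 / 32].
Proof.
move=> A0; have K0 : 0 <= K by exact: (thP_ge0 thP kC).
have c0 := c5_ge0 R D.
pose t : R := 2^-1 ^+ D.+1 / 32; pose s := 2 * A * (K + c5 R D + 1).
have t0 : 0 < t by rewrite divr_gt0 // exprn_gt0.
have t1 : t <= 1.
  rewrite /t ler_pdivrMr // mul1r; apply: (@le_trans _ _ 1); last by lra.
  by rewrite exprn_ile1 //; lra.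
have s0 : 0 < s by rewrite mulr_gt0 ?mulr_gt0 //; lra.
have ts : 0 < t + s by lra.
exists (t / (t + s)); set eps := t / (t + s).
have e0 : 0 < eps by rewrite divr_gt0.
have e1 : eps <= 1 by rewrite ler_pdivrMr //; lra.
have es : eps * s <= t.
  have : eps * (t + s) = t by rewrite divfK // gt_eqF.
  have : 0 <= eps * t by rewrite mulr_ge0 // ltW.
  lra.
have eD : 0 < eps ^+ D.+1 by rewrite exprn_gt0.
have eD1 : eps ^+ D.+1 <= 1 by rewrite exprn_ile1 // ltW.
have Ae : A * eps <= 1.
  have : 0 <= A * eps * (K + c5 R D) by rewrite mulr_ge0 ?addr_ge0 // mulr_ge0 // ltW.
  have : 0 <= A * eps by rewrite mulr_ge0 // ltW.
  move: es; rewrite /s; lra.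
split=> //.
  rewrite exprS mulrA; apply: (@le_trans _ _ (1 * 1)); last by rewrite mulr1.
  by apply: ler_pM => //; [rewrite mulr_ge0 // ltW|rewrite ltW].
have -> : (eps / 2) ^+ D.+1 / 32 = t * eps ^+ D.+1 by rewrite exprMn /t; ring.
rewrite exprS (_ : 2 * _ * _ = 2 * A * (K + c5 R D) * eps * eps ^+ D.+1); last by ring.
rewrite ler_pM2r //; apply: le_trans es.
have : 0 <= A * eps by rewrite mulr_ge0 // ltW.
by rewrite /s; lra.
Qed.

Lemma typical_bounds : exists c1 c2 cc x1 : R, [/\ 0 < c1, 0 < c2, 0 <= cc &
  forall n, x1 <= scale R D n -> 0 < scale R D n /\
    exists Bd : {set {ffun Pn C kz th n -> 'I_(bn kz th n).+1}},
    #|Bd|%:R <= cc / scale R D n * #|Om C kz th n|%:R /\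
    forall w, w \in Om C kz th n -> w \notin Bd ->
      (forall i : 'I_D.+1, c1 < (num_faces i (Phi w))%:R / growth R D.+1 n < c2) /\
      c1 < (num_towers (Phi w))%:R / growth R D.+1 n < c2].
Proof.
have K0 : 0 <= K by exact: (thP_ge0 thP kC).
have [Bz [Bm [BC Bunit Bm0 Bbnd]]] := cone_frame C_cone rho0 rhoP.
pose c9 := (D.+1 * (2 * D + 3) * Bm)%N.
have c90 : (0 : R) < c9%:R by rewrite ltr0n !muln_gt0 Bm0 andbT addn_gt0 orbT.
(* Chosen so that kap = A eps^(D+2) satisfies [Lkap] whenever L <= eps N. *)
pose A : R := c9%:R / rho; have A0 : 0 < A by rewrite divr_gt0.
have [eps [e0 e1 kap1 heps]] := choose_eps A0.
pose kap := A * eps ^+ D.+2.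
have kap0 : 0 < kap by rewrite mulr_gt0 // exprn_gt0.
pose q := `|Num.ceil (D.+2%:R / kap ^+ D.+2)|%N.
have hq : D.+2%:R <= kap ^+ D.+2 * q.+1%:R.
  rewrite mulrC -ler_pdivrMr ?exprn_gt0 //; apply: le_trans (ceil_ge _) _.
  rewrite -[q.+1%:R]natr1 /q natr_absz; apply: (@le_trans _ _ (`|Num.ceil (D.+2%:R / kap ^+ D.+2)|%:~R)).
    by rewrite ler_int ler_norm.
  by rewrite lerDl.
pose c6 := (eps / 2) ^+ D.+1 / 32.
have c60 : 0 < c6 by rewrite divr_gt0 // exprn_gt0 // divr_gt0.
pose be : R := (2 * q.+1 + 1)%:R ^+ D.+1 * (1 + kap^-1).
have be0 : 0 <= be by rewrite mulr_ge0 ?exprn_ge0 // addr_ge0 // invr_ge0 ltW.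
have a0 : 0 <= D%:R * 4 ^+ q.+1 :> R by rewrite mulr_ge0 // exprn_ge0.
have [cc [x0 [cc0 x01 dec]]] := decay D0 a0 be0 c60 K0.
pose c10 : R := (2 * (D.+2 * (2 * D + 3)) + 1)%:R.
pose dl : R := (64 ^+ D * 2 * (3 ^+ D * c10 ^+ (D * D)))^-1.
pose c11 : R := dl ^+ D / (64 ^+ D * 2 * c10 ^+ (D * D)).
have c100 : 0 < c10 by rewrite ltr0n addn1.
have dl0 : 0 < dl by rewrite invr_gt0 !mulr_gt0 ?exprn_gt0.
have c110 : 0 < c11 by rewrite divr_gt0 ?mulr_gt0 ?exprn_gt0.
pose c12 := c11 * (eps / 2) ^+ (D.+1 * D).
have c120 : 0 < c12 by rewrite mulr_gt0 // exprn_gt0 // divr_gt0.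
pose c13 : R := 3 ^+ D.+1 + K.
have c130 : 0 <= c13 by rewrite addr_ge0 // exprn_ge0.
pose c14 : R := 3 * (2 * c13 + 1) ^+ D + c13 ^+ D * 2 ^+ D.+1.
have f0 : 0 <= 3 * (2 * c13 + 1) ^+ D by rewrite mulr_ge0 // exprn_ge0 //; lra.
have g0 : 0 <= c13 ^+ D * 2 ^+ D.+1 by rewrite mulr_ge0 // exprn_ge0.
(* Halving and adding 1 make the inequalities strict. The summand 2/eps ensures eps N >= 2, so that
   its integer part [L] is at least eps N / 2. *)
exists (c12 / 2), (c14 + 1), cc, (x0 + 2 / eps); split=> //.
- by rewrite divr_gt0.
- by rewrite /c14; lra.
move=> n; set N := scale R D n => hN.
have e2 : 0 < 2 / eps by rewrite divr_gt0.
have N1 : 1 <= N by lra.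
have N0 : 0 < N by lra.
have Nn : N ^+ D.+2 = n%:R := scaleX R D n.
have eN : 2 <= eps * N.
  have : 2 / eps <= N by lra.
  by rewrite ler_pdivrMr // mulrC.
pose L := `|Num.floor (eps * N)|%N.
have eN0 : 0 <= eps * N by lra.
have L1 : L%:R <= eps * N by rewrite /L natr_absz ger0_norm ?floor_ge0 // floor_le.
have L2 : eps / 2 * N <= L%:R.
  have : eps * N < L.+1%:R.
    rewrite /L -natr1 natr_absz ger0_norm ?floor_ge0 //.
    by have := floorD1_gt (eps * N); rewrite intrD.
  by rewrite -natr1; lra.
have L0 : (0 < L)%N by rewrite -(ltr_nat R); lra.
have Lkap : (L ^ D.+1 * zbnd D Bm L)%:R <= rho * (kap * n%:R).
  rewrite (_ : (L ^ D.+1 * zbnd D Bm L = c9 * L ^ D.+2)%N); last first.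
    rewrite /zbnd /genW /c9 (expnS L D.+1); set u := (L ^ _)%N; by clearbody u; clear; ring.
  have -> : rho * (kap * n%:R) = c9%:R * (eps * N) ^+ D.+2.
    by rewrite exprMn Nn /kap /A; field; rewrite gt_eqF.
  by rewrite natrM natrX ler_pM2l // lerXn2r ?nnegrE.
have [Bd [Bd1 Bd2]] := @good_configurations R D C kz D0 C_cone th thP rho rho0 rhoP Bz Bm
  BC Bunit Bbnd n L kap L0 kap0 kap1 Lkap N q N1 Nn hq.
split=> //; exists Bd; split.
  apply: le_trans Bd1 _.
  rewrite mulrCA [leRHS]mulrC ler_wpM2l //; apply: le_trans (dec N _); last by lra.
  have Y0 : 0 <= 2 * (N ^+ D.+2 * K) + 1.
    by rewrite addr_ge0 // mulr_ge0 // mulr_ge0 // exprn_ge0 // ltW.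
  rewrite -Nn [leLHS]mulrA [X in X * expR _ <= _]mulrA.
  apply: ler_wpM2l; first by rewrite mulr_ge0 // exprn_ge0.
  rewrite ler_expR.
  (* In units of c6 N^(D+1): the gain |cop|/4 is at least 2 and the cost 2 kap (K + c5) N^(D+1) at
     most 1, so the exponent keeps -1 besides the linear term be N. *)
  have cp : (eps / 2) ^+ D.+1 / 4 * N ^+ D.+1 <= #|cop D L|%:R.
    apply: (@le_trans _ _ (L%:R ^+ D.+1 / 4)).
      rewrite mulrAC ler_wpM2r //.
      by rewrite -exprMn lerXn2r ?nnegrE // mulr_ge0 ?divr_ge0 ?(ltW e0) ?(ltW N0).
    by rewrite ler_pdivrMr // mulrC -natrX -natrM ler_nat card_cop.
  have ND : 0 <= N ^+ D.+1 by rewrite exprn_ge0 // ltW.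
  have := ler_wpM2r ND heps; rewrite -/kap -/c6.
  have cp' : 8 * c6 * N ^+ D.+1 <= #|cop D L|%:R.
    by apply: le_trans cp; rewrite ler_wpM2r // /c6; lra.
  have -> : be * N = (2 * q.+1 + 1)%:R ^+ D.+1 * N * (1 + kap^-1) by rewrite /be mulrAC.
  move: cp'; set x := 8 * c6 * _; set y := 2 * kap * _ * _; set z := _ * N * _ => cp' hy.
  have xE : x = 8 * (c6 * N ^+ D.+1) by rewrite /x mulrA.
  clearbody x y z; move: (c6 * _) xE hy => u xE hy; lra.
move=> w wO wB.
have [g [E [hE hf ht hg]]] := Bd2 w wO wB `|Num.floor (dl * L%:R ^+ D)|%N.
have glow := @lower_estimate R D L _ g E L%:R c10 dl L0 erefl erefl erefl erefl hE hg.
have gr : growth R D.+1 n = N ^+ (D.+1 * D) by rewrite growthE.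
have gr0 : 0 < N ^+ (D.+1 * D) by rewrite exprn_gt0.
have glow2 : c12 * N ^+ (D.+1 * D) <= g%:R.
  apply: le_trans glow; rewrite -/c11 /c12 -mulrA ler_pM2l // -exprMn lerXn2r ?nnegrE //.
  by rewrite mulr_ge0 ?divr_ge0 ?(ltW e0) ?(ltW N0).
have low (m : nat) : (g <= m)%N -> c12 / 2 < m%:R / growth R D.+1 n.
  move=> gm; rewrite gr ltr_pdivlMr //.
  apply: (@lt_le_trans _ _ (c12 * N ^+ (D.+1 * D))).
    by rewrite ltr_pM2r // ltr_pdivrMr // ltr_pMr // ltr1n.
  by apply: le_trans glow2 _; rewrite ler_nat.
have nz := nz_bound thP rho0 rhoP N1 Nn wO.
have ND1 : 1 <= N ^+ D.+1 by rewrite exprn_ege1.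
set M := #|nzgen _| in nz.
have ub (m : nat) : m%:R <= c14 * N ^+ (D.+1 * D) -> m%:R / growth R D.+1 n < c14 + 1.
  move=> h; rewrite gr ltr_pdivrMr //; apply: le_lt_trans h _.
  by rewrite ltr_pM2r // ltrDl.
have nzD : M%:R ^+ D <= c13 ^+ D * N ^+ (D.+1 * D).
  by rewrite exprM -exprMn lerXn2r ?nnegrE // mulr_ge0 // exprn_ge0 // ltW.
split=> [i|]; apply/andP; split; try exact: low.
  apply: ub; have [_ le] := num_faces_ub (fun i => (w i)%:R *: emb R (pvec i)) i.
  rewrite -(ler_nat R) natrM natrX natrD natrM in le.
  apply: le_trans le _; rewrite /c14 [leRHS]mulrDl; apply: ler_wpDr.
    by rewrite mulr_ge0 // ltW.
  rewrite -mulrA ler_pM2l // exprM -exprMn lerXn2r ?nnegrE //.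
    by rewrite mulr_ge0 //; lra.
  rewrite -/M; move: (N ^+ D.+1) nz ND1 => x nz ND1; rewrite -/c13 in nz; lra.
apply: ub; have [_ le] := num_towers_ub (fun i => (w i)%:R *: emb R (pvec i)).
rewrite -(ler_nat R) natrM !natrX in le.
apply: le_trans le _; rewrite /c14 [leRHS]mulrDl; apply: ler_wpDl.
  by rewrite mulr_ge0 // ltW.
by rewrite mulrAC ler_wpM2r ?exprn_ge0.
Qed.

End Final.

Theorem theorem5p1 (R : realType) (d : nat) (C : set 'rV[R]_d) (k : 'rV[R]_d)
  (hd : (2 <= d)%N)
  (C_closed : closed C)
  (C_cone : convex_cone C)
  (C_pointed : ~ contains_line C)
  (C_int : C° !=set0)
  (k_int : k \is a mxOver Num.int)
  (k_in : C° k) :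
  exists c1 c2 : R,
    [/\ 0 < c1, 0 < c2,
        forall i : 'I_d,
          (fun n : nat => Q C k n
             [set T | c1 < (num_faces i T)%:R / growth R d n < c2])
            @ \oo --> (1 : R)
      & (fun n : nat => Q C k n
           [set T | c1 < (num_towers T)%:R / growth R d n < c2])
          @ \oo --> (1 : R)].
Proof.
case: d C k hd C_closed C_cone C_pointed C_int k_int k_in => [//|D] C k hD C_closed C_cone
  C_pointed _ k_int k_in.
have D0 : (0 < D)%N by [].
have [kz kE] := lattice_emb k_int; subst k.
have [th thP] := cone_functional C_cone C_closed C_pointed.
have [rho rho0 rhoP] := cone_interior k_in.
have kC := kzC rho0 rhoP.
have [c1 [c2 [cc [x1 [c10 c20 cc0 h]]]]] := typical_bounds D0 C_cone thP rho0 rhoP.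
(* One exceptional set serves every dimension and the towers, so the same [c1] and [c2] work
   throughout. *)
have cvg (Sn : nat -> set (set 'rV[R]_D.+1)) :
    (forall n (w : {ffun Pn C kz th n -> 'I_(bn kz th n).+1}),
      (forall i : 'I_D.+1, c1 < (num_faces i (Phi w))%:R / growth R D.+1 n < c2) /\
      c1 < (num_towers (Phi w))%:R / growth R D.+1 n < c2 -> Sn n (Phi w)) ->
    (fun n => Q C (emb R kz) n (Sn n)) @ \oo --> (1 : R).
  move=> hS; apply: (scale_squeeze cc0 (x1 := x1) (D := D)) => n /h[N0 [Bd [Bd1 Bd2]]].
  have /andP[p1 p2] := unif_prob_bounds C_cone C_pointed thP kC
    (fun w wO wB => hS n w (Bd2 w wO wB)).
  rewrite /Q p2 andbT; apply: le_trans p1; rewrite lerD2l lerN2.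
  by rewrite ler_pdivrMr // ltr0n (Om_neq0 C_cone thP kC).
exists c1, c2; split=> // [i|].
  by apply: cvg => n w [hf _]; exact: hf.
by apply: cvg => n w [].
Qed.
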